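(* Let $0<\alpha\le0.2$. There is a constant $c_1$ depending on $\alpha$ only such that $$E_fL(\mathrm{CI}^m_* )\ \le\ c_1\,L^*_\alpha(f,F_m)$$ for all monotonically nondecreasing functions $f\in F_m$. For example, $c_1$ can be taken to be $14.40$ for $\alpha=0.05$ and $12.67$ for $\alpha=0.01$.
   Context: White noise model: one observes $Y$ with $dY(t)=f(t)\,dt+n^{-1/2}\,dW(t)$, $-\frac12\le t\le\frac12$, where $W$ is standard Brownian motion and $n>0$ is known (the constant $c_1$ does not depend on $n$). $E_f$ denotes expectation when the true function is $f$. $F_m$ is the collection of all monotonically nondecreasing functions on $[-\frac12,\frac12]$. $z_\alpha=\Phi^{-1}(1-\alpha)$ with $\Phi$ the standard normal cdf. $\mathcal{I}_\alpha(F_m)$ is the collection of all confidence intervals based on $Y$ which cover $f(0)$ with probability at least $1-\alpha$ for every $f\in F_m$, and $L^*_\alpha(f,F_m)=\inf_{\mathrm{CI}\in\mathcal{I}_\alpha(F_m)}E_f(L(\mathrm{CI}))$, where $L(\mathrm{CI})$ is the length of $\mathrm{CI}$. For integers $j\ge2$ let $$\delta^R_j=2^j\bigl(Y(2^{-j})-Y(0)\bigr),\qquad \delta^L_j=2^j\bigl(Y(0)-Y(-2^{-j})\bigr),\qquad \sigma_j^2=\frac{2^{j-1}}{n},$$ $$\mathrm{CI}^m_j(\alpha)=\bigl[\delta^L_j-z_{\alpha/2}\sqrt2\,\sigma_j,\ \delta^R_j+z_{\alpha/2}\sqrt2\,\sigma_j\bigr],$$ with the convention that the interval is the empty set if the left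 endpoint exceeds the right endpoint; its length is thus $\max(\delta^R_j-\delta^L_j+2\sqrt2\,z_{\alpha/2}\sigma_j,\,0)$. Further let $$\xi_j=2^{j-1}\bigl(Y(2^{-j+1})-Y(2^{-j})\bigr)-2^{j-1}\bigl(Y(-2^{-j})-Y(-2^{-j+1})\bigr),\quad j\ge2,$$ $$\hat j=\inf\{j\ge2:\ \xi_j\le\tfrac32 z_\alpha\sigma_j\},\qquad \mathrm{CI}^m_*=\mathrm{CI}^m_{\hat j}(\alpha).$$ *)

(* Defs.v *)
From HB Require Import structures.
From mathcomp Require Import all_boot all_order all_algebra.
From mathcomp Require Import all_classical all_reals all_analysis measurable_realfun.

Set Implicit Arguments.
Unset Strict Implicit.
Unset Printing Implicit Defensive.

Import Order.TTheory GRing.Theory Num.Theory.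
Import numFieldNormedType.Exports.
Local Open Scope classical_set_scope.
Local Open Scope ring_scope.

(* Standard Brownian motion indexed by [a, b], started at time a.  The values
   of W outside [a, b] are irrelevant. *)
Definition brownian_motion (R : realType) (d : measure_display)
    (T : measurableType d) (P : probability T R) (a b : R) (W : R -> T -> R) :
    Prop :=
  [/\ forall t, t \in `[a, b] -> measurable_fun setT (W t),
      {ae P, forall w, W a w = 0},
      {ae P, forall w, {within `[a, b], continuous (W ^~ w)}},
      (* normal_prob takes the standard deviation *)
      forall s t, a <= s -> s < t -> t <= b ->
        forall A : set R, measurable A ->
        P [set w | A (W t w - W s w)] = normal_prob 0 (Num.sqrt (t - s)) A
    & forall (k : nat) (t : nat -> R) (A : nat -> set R),
        (forall i, (i <= k)%N -> t i \in `[a, b]) ->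
        (forall i, (i < k)%N -> t i <= t i.+1) ->
        (forall i, (i < k)%N -> measurable (A i)) ->
        P [set w | forall i, (i < k)%N -> A i (W (t i.+1) w - W (t i) w)] =
        (\prod_(i < k) P [set w | A i (W (t i.+1) w - W (t i) w)%R])%E].

(* Observed paths t |-> Y(t), with the sigma-algebra generated by the
   evaluations at the times t in [-1/2, 1/2] only, so that a measurable
   function of a path does not depend on its values at other times. *)
Definition evaluation_events (R : realType) : set (set (R -> R)) :=
  [set E | exists (t : R) (B : set R),
     [/\ t \in `[- 2^-1, 2^-1], measurable B & E = [set y | B (y t)]]].

Definition observation (R : realType) :=
  g_sigma_algebraType (@evaluation_events R).

(* The solution of dY(t) = f(t) dt + n^(-1/2) dW(t) with Y(-1/2) = 0. *)
Definition white_noise (R : realType) (T : Type) (W : R -> T -> R) (n : R)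
    (f : R -> R) (w : T) : observation R :=
  fun t => (\int[lebesgue_measure]_(s in `[- 2^-1, t]) f s)
           + (Num.sqrt n)^-1 * W t w.

Definition F_m (R : realType) : set (R -> R) :=
  [set f | {in `[- 2^-1, 2^-1] &, {homo f : x y / x <= y}}].

(* An interval is given by its pair of endpoints (l, u), possibly infinite; it
   stands for [l, u], which is empty when u < l. *)
Definition interval_length (R : realType) (I : \bar R * \bar R) : \bar R :=
  maxe (I.2 - I.1)%E 0%E.

Definition expected_length (R : realType) (d : measure_display)
    (T : measurableType d) (P : probability T R) (W : R -> T -> R) (n : R)
    (f : R -> R) (CI : observation R -> \bar R * \bar R) : \bar R :=
  (\int[P]_w interval_length (CI (white_noise W n f w)))%E.

Definition confidence_intervals (R : realType) (d : measure_display)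
    (T : measurableType d) (P : probability T R) (W : R -> T -> R) (n : R)
    (alpha : R) (F : set (R -> R)) : set (observation R -> \bar R * \bar R) :=
  [set CI : observation R -> \bar R * \bar R | measurable_fun setT CI /\
     forall f, F f ->
       ((1 - alpha)%:E <=
        P [set w | let I := CI (white_noise W n f w) in
                   I.1 <= (f 0)%:E <= I.2])%E].

Definition Lstar (R : realType) (d : measure_display)
    (T : measurableType d) (P : probability T R) (W : R -> T -> R) (n : R)
    (alpha : R) (f : R -> R) (F : set (R -> R)) : \bar R :=
  ereal_inf [set expected_length P W n f CI
            | CI in confidence_intervals P W n alpha F].

Definition Phi (R : realType) (x : R) : R :=
  fine (normal_prob 0 1 `]-oo, x]).

(* z_alpha = Phi^-1(1 - alpha); meaningful for 0 < alpha < 1. *)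
Definition z_ (R : realType) (alpha : R) : R :=
  xget 0 [set x | Phi x = 1 - alpha].

Section procedure.
Context {R : realType}.
Variables (n alpha : R).
Implicit Types (y : observation R) (j : nat).

Definition deltaR y j : R := 2 ^+ j * (y (2 ^- j) - y 0).

Definition deltaL y j : R := 2 ^+ j * (y 0 - y (- 2 ^- j)).

Definition sigma_ j : R := Num.sqrt (2 ^+ j.-1 / n).

Definition CIm y j : \bar R * \bar R :=
  ((deltaL y j - z_ (alpha / 2) * Num.sqrt 2 * sigma_ j)%:E,
   (deltaR y j + z_ (alpha / 2) * Num.sqrt 2 * sigma_ j)%:E).

Definition xi y j : R :=
  2 ^+ j.-1 * (y (2 ^- j.-1) - y (2 ^- j))
  - 2 ^+ j.-1 * (y (- 2 ^- j) - y (- 2 ^- j.-1)).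

Definition stops y j : bool :=
  (2 <= j)%N && (xi y j <= 3 / 2 * z_ alpha * sigma_ j).

(* None stands for the infimum of the empty set. *)
Definition jhat y : option nat :=
  match pselect (exists j, stops y j) with
  | left ex => Some (ex_minn ex)
  | right _ => None
  end.

(* On the event jhat = oo, of probability 0, where the procedure leaves the
   interval unspecified, we take the whole line: this is the choice with the
   largest length. *)
Definition CIm_star y : \bar R * \bar R :=
  if jhat y is Some j then CIm y j else (-oo%E, +oo%E).

End procedure.

(* E_f L(CI^m_star) <= c * L*_alpha(f, F_m) for every f in F_m, whatever the
   noise level and the Brownian motion that drives the model. *)
Definition adaptive_with_constant (R : realType) (alpha c : R) : Prop :=
  forall (n : R) (d : measure_display) (T : measurableType d)
    (P : probability T R) (W : R -> T -> R) (f : R -> R),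
    0 < n -> brownian_motion P (- 2^-1) 2^-1 W -> @F_m R f ->
    (expected_length P W n f (CIm_star n alpha) <=
     c%:E * Lstar P W n alpha f (@F_m R))%E.

(* Main.v *)
(* Lower bound.  Raising f to f(0) + c on [0, s], or lowering it to f(0) - c on
   [-s, 0], costs at most c * sqrt(n s) in L^2 norm as soon as f(s) or f(-s) is
   that far from f(0) (or s = 1/2).  By Neyman-Pearson an interval of coverage
   1 - alpha on F_m therefore contains f(0) +- c with P_f-probability at least
   Phi(z_alpha - c sqrt(n s)); integrating in c (Tonelli) bounds E_f L from
   below.  With J the first level at which the mean of xi_J is at most
   (3/2) z_alpha sigma_J, one takes s = 2^-(J-2) and gets a lower bound of order
   sigma_J.
   Upper bound.  xi_2, ..., xi_j and deltaR_j - deltaL_j depend on disjoint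
   pairs of increments, hence are independent, so
   E[L; jhat = j] = P(jhat = j) E[L_j].  Stopping before J is unlikely enough to
   pay for the bias, and each level after J is skipped with probability at most
   Phi(-(1 - 1/sqrt 2)(3/2) z_alpha) < 1/sqrt 2, while sigma_j grows by
   sqrt 2 only: E_f L is at most of order sigma_J. *)

From HB Require Import structures.
Require Import Defs.
From mathcomp Require Import all_boot all_order all_algebra.
From mathcomp Require Import all_classical all_reals all_analysis measurable_realfun.
From mathcomp Require Import lra zify.
Set Implicit Arguments.
Unset Strict Implicit.
Unset Printing Implicit Defensive.
Import Order.TTheory GRing.Theory Num.Theory.
Import numFieldNormedType.Exports.
Local Open Scope classical_set_scope.
Local Open Scope ring_scope.

(** * Densities and the standard Gaussian *)

(** A competing interval is an arbitrary measurable function of the whole path, so the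
    likelihood-ratio comparison must hold for every event generated by the evaluations. It is first
    proved for events seen through finitely many times, where the increments are independent
    Gaussians and the likelihood ratio is a finite product. A general event is then approximated by
    such cylinders under both laws at once, and continuity of [Phi] absorbs the error. The L^2
    distance of the drifts enters as a bound on discrete energies, uniform over all grids.

    The threshold 3/2 ties the two halves together. The mean of xi_j is half a difference of
    averages of f, so a mean above (3/2) z_alpha sigma_j forces f to vary by more than 3 z_alpha
    sigma_j between -s and s, where s = 2^-(j-1), and sigma_j is exactly 1 / sqrt (n s). Integrating
    [Phi] downwards from z_alpha over a range of length 3 z_alpha ends at -2 z_alpha, whence the
    factor z_alpha - phi (2 z_alpha). Both bounds being multiples of sigma_J, n and f cancel and the
    constant depends on alpha only. *)

Definition weighted_measure (d : measure_display) (T : measurableType d)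
    (R : realType) (mu : {measure set T -> \bar R}) (h : T -> R) (A : set T) :
    \bar R :=
  (\int[mu]_(x in A) (h x)%:E)%E.

Section weighted_measure.
Context (d : measure_display) (T : measurableType d) (R : realType).
Variables (mu : {measure set T -> \bar R}) (h : T -> R).
Hypotheses (mh : measurable_fun setT h) (h0 : forall x, 0 <= h x).

Let weighted0 : weighted_measure mu h set0 = 0%E.
Proof. by rewrite /weighted_measure integral_set0. Qed.

Let weighted_ge0 A : (0 <= weighted_measure mu h A)%E.
Proof. by apply: integral_ge0 => x _; rewrite lee_fin. Qed.

Let weighted_sigma_additive : semi_sigma_additive (weighted_measure mu h).
Proof.
move=> F mF tF mUF; rewrite /weighted_measure ge0_integral_bigcup//.
- apply: is_cvg_ereal_nneg_natsum_cond => n _ _.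
  by apply: integral_ge0 => x _; rewrite lee_fin.
- by apply/measurable_funTS/measurable_EFinP.
- by move=> x _; rewrite lee_fin.
Qed.

HB.instance Definition _ := isMeasure.Build _ _ _ (weighted_measure mu h)
  weighted0 weighted_ge0 weighted_sigma_additive.

Import HBNNSimple.

(** Both sides are monotone limits along the same simple functions, which reduces the identity to
    indicators, where it is the definition of the weighted measure. *)
Lemma ge0_integral_weighted (u : T -> \bar R) :
  measurable_fun setT u -> (forall x, 0 <= u x)%E ->
  (\int[weighted_measure mu h]_x u x = \int[mu]_x (u x * (h x)%:E))%E.
Proof.
move=> mu_ u0; pose f_ := nnsfun_approx measurableT mu_.
have cf x : (f_ n x)%:E @[n --> \oo] --> u x.
  by apply: cvg_nnsfun_approx => // y _; exact: u0.
transitivity (limn (fun n => \int[weighted_measure mu h]_x (f_ n x)%:E)%E).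
  rewrite -monotone_convergence//.
  - by apply: eq_integral => x _; apply/esym/cvg_lim => //; exact: cf.
  - by move=> n; exact/measurable_EFinP.
  - by move=> n x _; rewrite lee_fin.
  - by move=> x _ m n mn; rewrite lee_fin; exact/lefP/nd_nnsfun_approx.
transitivity (limn (fun n => \int[mu]_x ((f_ n x)%:E * (h x)%:E))%E); last first.
  rewrite -monotone_convergence//.
  - apply: eq_integral => x _; apply/cvg_lim => //.
    by apply: cvgeZr => //; exact: cf.
  - by move=> n; apply/measurable_EFinP; apply: measurable_funM.
  - by move=> n x _; rewrite lee_fin mulr_ge0.
  - move=> x _ m n mn; rewrite lee_fin ler_wpM2r//.
    exact/lefP/nd_nnsfun_approx.
congr (limn _); apply/funext => n.
under [LHS]eq_integral do rewrite fimfunE -fsumEFin//.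
rewrite [LHS]ge0_integral_fsum//; last 2 first.
- by move=> r; exact/measurable_EFinP/measurable_funM.
- by move=> r x _; rewrite nnfun_muleindic_ge0.
under [RHS]eq_integral.
  move=> x _; rewrite fimfunE -fsumEFin// ge0_mule_fsuml; last first.
    by move=> r; rewrite nnfun_muleindic_ge0.
  over.
rewrite [RHS]ge0_integral_fsum//; last 2 first.
- move=> r; apply/measurable_EFinP; apply: measurable_funM => //.
  exact: measurable_funM.
- by move=> r x _; rewrite mule_ge0 ?nnfun_muleindic_ge0// lee_fin.
apply: eq_fsbigr => r _; rewrite integralZl_indic_nnsfun//=.
rewrite integral_indic//= setIT.
have [r0|r0] := ltP r 0.
  rewrite preimage_nnfun0// measure0 mule0.
  apply/esym/integral0_eq => x _.
  by rewrite indic0 mulr0 mul0e.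
under eq_integral do rewrite EFinM -muleA.
rewrite ge0_integralZl//; last 2 first.
- by apply: emeasurable_funM => //; exact/measurable_EFinP.
- by move=> x _; rewrite mule_ge0// lee_fin.
congr (_ * _)%E; rewrite /weighted_measure [LHS]integral_mkcond.
apply: eq_integral => x _; rewrite patchE indicE.
by case: ifPn => _; rewrite ?mul1e ?mul0e.
Qed.

End weighted_measure.

(** Bundles the pushforward with the measurability of the map, so that it can serve as a measure in
    integrals and in uniqueness arguments. *)
Definition image_measure d d' (T1 : measurableType d) (T2 : measurableType d')
    (R : realType) (mu : {measure set T1 -> \bar R}) (f : T1 -> T2)
    (mf : measurable_fun setT f) : {measure set T2 -> \bar R}.
Proof. by refine (pushforward mu f : {measure set T2 -> \bar R}). Defined.

Lemma ge0_integral_image_measure d d' (T1 : measurableType d)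
    (T2 : measurableType d') (R : realType) (mu : {measure set T1 -> \bar R})
    (f : T1 -> T2) (mf : measurable_fun setT f) (u : T2 -> \bar R) :
  measurable_fun setT u -> (forall y, 0 <= u y)%E ->
  (\int[image_measure mu mf]_y u y = \int[mu]_x u (f x))%E.
Proof. by move=> mu_ u0; rewrite ge0_integral_pushforward. Qed.

Definition density_measure d (T : measurableType d) (R : realType)
    (mu : {measure set T -> \bar R}) (h : T -> R) (mh : measurable_fun setT h)
    (h0 : forall x, 0 <= h x) : {measure set T -> \bar R}.
Proof. by refine (weighted_measure mu h : {measure set T -> \bar R}). Defined.

Section affine_change_of_variables.
Context (R : realType).
Notation mu := (@lebesgue_measure R).

Let measurable_affine (a b : R) :
  measurable_fun setT (fun x : measurableTypeR R => a * x + b : measurableTypeR R).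
Proof. by apply: measurable_funD => //; exact: measurable_funM. Qed.

(** The left side is a scaled image of Lebesgue measure. It gives half-open intervals their length,
    and this characterizes Lebesgue measure. *)
Lemma lebesgue_measure_affine (a b : R) (A : set R) : 0 < a -> measurable A ->
  (a%:E * mu ((fun x : R => (a * x + b)%R) @^-1` A) = mu A)%E.
Proof.
move=> a0 mA; have a0' : 0 <= a by exact: ltW.
transitivity (mscale (NngNum a0') (image_measure mu (measurable_affine a b)) A) => //.
apply/esym/lebesgue_measure_unique => //= _ [[c e]] _ <-.
rewrite /mscale /image_measure/= /pushforward.
have -> : (fun x => a * x + b) @^-1` `]c, e] = `](c - b) / a, (e - b) / a]%classic.
  apply/seteqP; split => x /=; rewrite !in_itv/=;
  by rewrite ltr_pdivrMr// ler_pdivlMr// ltrBlDr lerBrDr mulrC.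
rewrite !lebesgue_measure_itv/= !lte_fin ltr_pM2r ?invr_gt0// ltrD2r.
case: ifPn => _; last by rewrite mule0.
by rewrite -!EFinB -EFinM -mulrBl mulrCA divff ?gt_eqF// mulr1; congr EFin; lra.
Qed.

Lemma ge0_integral_affine (a b : R) (f : R -> \bar R) : 0 < a ->
  measurable_fun setT f -> (forall x, 0 <= f x)%E ->
  (\int[mu]_x f x = a%:E * \int[mu]_x f (a * x + b)%R)%E.
Proof.
move=> a0 mf f0; have a0' : 0 <= a by exact: ltW.
transitivity (\int[mscale (NngNum a0') (image_measure mu (measurable_affine a b))]_x f x)%E.
  by apply: eq_measure_integral => /= A mA _; exact/esym/lebesgue_measure_affine.
by rewrite ge0_integral_mscale// ge0_integral_image_measure.
Qed.

End affine_change_of_variables.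

(** * The standard Gaussian: shifts, convolution, tails and quantiles *)

Section standard_gaussian.
Context (R : realType).
Notation mu := (@lebesgue_measure R).
Notation gauss := (@normal_prob R 0 1).
Notation phi := (@normal_pdf R 0 1).
Implicit Types (x y t s c : R).

Lemma normal_pdf01E x : phi x = normal_peak 1 * expR (- x ^+ 2 / 2).
Proof.
rewrite normal_pdfE ?oner_eq0//; congr (_ * expR _).
by rewrite subr0 expr1n.
Qed.

Lemma measurable_normal_pdf01 : measurable_fun setT phi.
Proof. exact: measurable_normal_pdf. Qed.

Let measurable_phiE : measurable_fun setT (fun x => (phi x)%:E).
Proof. by apply/measurable_EFinP; exact: measurable_normal_pdf. Qed.

Lemma ge0_integral_gauss (u : R -> \bar R) :
  measurable_fun setT u -> (forall x, 0 <= u x)%E ->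
  (\int[gauss]_x u x = \int[mu]_x (u x * (phi x)%:E))%E.
Proof.
move=> mu_ u0; rewrite -(ge0_integral_weighted mu measurable_normal_pdf01)//.
  exact: normal_pdf_ge0.
Qed.

Lemma normal_pdf01_shift c x : phi x * expR (c * x - c ^+ 2 / 2) = phi (x - c).
Proof.
by rewrite !normal_pdf01E -mulrA -expRD; congr (_ * expR _); lra.
Qed.

Lemma normal_pdf01N x : phi (- x) = phi x.
Proof. by rewrite !normal_pdf01E sqrrN. Qed.

(** Cameron-Martin formula in dimension one: by completing the square, the exponential factor turns
    the density at x into the density at x - c, and translation invariance of Lebesgue measure does
    the rest. *)
Lemma ge0_integral_gauss_shift c (u : R -> \bar R) :
  measurable_fun setT u -> (forall x, 0 <= u x)%E ->
  (\int[gauss]_x (u x * (expR (c * x - c ^+ 2 / 2))%:E) =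
   \int[gauss]_x u (x + c)%R)%E.
Proof.
move=> mu_ u0.
have mc : measurable_fun setT (fun x : R => x + c) by exact: measurable_funD.
have me : measurable_fun setT (fun x : R => expR (c * x - c ^+ 2 / 2)).
  by apply: measurableT_comp => //; exact: measurable_funB.
rewrite !ge0_integral_gauss//; last 3 first.
- exact: measurableT_comp mu_ mc.
- by apply: emeasurable_funM => //; exact/measurable_EFinP.
- by move=> x; rewrite mule_ge0// lee_fin expR_ge0.
rewrite [LHS](ge0_integral_affine c ltr01); last 2 first.
- apply: emeasurable_funM; last exact: measurable_phiE.
  by apply: emeasurable_funM => //; exact/measurable_EFinP.
- by move=> x; rewrite !mule_ge0// lee_fin ?expR_ge0 ?normal_pdf_ge0.
rewrite mul1e; apply: eq_integral => x _; rewrite mul1r.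
by rewrite -muleA -EFinM mulrC normal_pdf01_shift addrK.
Qed.

Lemma ge0_integral_gaussN (u : R -> \bar R) :
  measurable_fun setT u -> (forall x, 0 <= u x)%E ->
  (\int[gauss]_x u x = \int[gauss]_x u (- x)%R)%E.
Proof.
move=> mu_ u0.
have mN : measurable_fun setT (fun x : measurableTypeR R => - x : measurableTypeR R).
  exact: measurable_funN.
rewrite !ge0_integral_gauss//; last exact: measurableT_comp mu_ mN.
transitivity (\int[image_measure mu mN]_x (u x * (phi x)%:E))%E.
  by apply: eq_measure_integral => /= A mA _; exact/esym/lebesgue_measureN.
rewrite ge0_integral_image_measure.
- by apply: eq_integral => x _; rewrite normal_pdf01N.
- by apply: emeasurable_funM => //; exact: measurable_phiE.
- by move=> x; rewrite mule_ge0// lee_fin normal_pdf_ge0.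
Qed.

Lemma normal_prob_gauss s (A : set R) : 0 < s -> measurable A ->
  normal_prob 0 s A = gauss ((fun x => s * x) @^-1` A).
Proof.
move=> s0 mA; rewrite /normal_prob.
rewrite [LHS]integral_mkcond [RHS]integral_mkcond.
have mphi := @measurable_normal_pdf R 0 s.
rewrite [LHS](ge0_integral_affine 0 s0); last 2 first.
- apply/(measurable_restrictT _ mA); apply: measurable_funTS.
  exact/measurable_EFinP.
- by move=> x; rewrite patchE; case: ifPn => // _; rewrite lee_fin normal_pdf_ge0.
rewrite -ge0_integralZl//; last 3 first.
- apply: (@measurableT_comp _ _ _ _ _ _ ((fun x => (normal_pdf 0 s x)%:E) \_ A)).
    apply/(measurable_restrictT _ mA); apply: measurable_funTS.
    exact/measurable_EFinP.
  by apply: measurable_funD => //; exact: measurable_funM.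
- by move=> x _; rewrite patchE; case: ifPn => // _; rewrite lee_fin normal_pdf_ge0.
- by rewrite lee_fin ltW.
apply: eq_integral => x _; rewrite !patchE addr0.
have -> : (x \in (fun x => s * x) @^-1` A) = (s * x \in A).
  by apply/idP/idP; rewrite !inE.
case: ifPn => _; last by rewrite mule0.
rewrite -EFinM; congr EFin; rewrite !normal_pdfE ?oner_eq0 ?gt_eqF//.
rewrite mulrA; congr (_ * expR _); last first.
  rewrite !subr0 expr1n exprMn -(mulr_natr (s ^+ 2)) -mulrN invfM mulrACA divff ?mul1r//.
  by rewrite expf_neq0// gt_eqF.
rewrite /normal_peak expr1n mul1r -mulrnAr sqrtrM ?sqr_ge0// sqrtr_sqr gtr0_norm//.
by rewrite invfM mulrA divff ?mul1r// gt_eqF.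
Qed.

(** Written over the whole line, with the indicator inside the integrand, so that Tonelli can
    exchange it with another integral. *)
Lemma gauss_affine_preimage (a b : R) (B : set R) : 0 < a -> measurable B ->
  gauss ((fun y => b + a * y) @^-1` B) =
  (\int[mu]_z (\1_B z * (a^-1 * phi ((z - b) / a)))%:E)%E.
Proof.
move=> a0 mB.
have mq : measurable_fun setT (fun z : R => (\1_B z * (a^-1 * phi ((z - b) / a)))%:E).
  apply/measurable_EFinP; apply: measurable_funM; first exact: measurable_indic.
  apply: measurable_funM => //; apply: measurableT_comp.
    exact: measurable_normal_pdf.
  by apply: measurable_funM => //; exact: measurable_funB.
rewrite (ge0_integral_affine b a0 mq); last first.
  move=> z; rewrite lee_fin !mulr_ge0 ?normal_pdf_ge0 ?invr_ge0 ?(ltW a0)//.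
rewrite -ge0_integralZl//; last 3 first.
- by apply: (measurableT_comp mq); exact: measurable_funD.
- by move=> z _; rewrite lee_fin !mulr_ge0 ?normal_pdf_ge0 ?invr_ge0 ?(ltW a0).
- by rewrite lee_fin ltW.
rewrite /normal_prob [LHS]integral_mkcond; apply: eq_integral => x _.
rewrite patchE indicE addrK [a * x]mulrC mulfK ?gt_eqF// (addrC _ b).
have -> : (x \in (fun y => b + a * y) @^-1` B) = (b + x * a \in B).
  by apply/idP/idP; rewrite !inE/= mulrC.
case: ifPn => _; last by rewrite mul0r mule0.
by rewrite mul1r -EFinM mulrA divff ?gt_eqF// mul1r.
Qed.

(** With X, Y independent standard Gaussians and Z = s X + t Y, the left side is the joint density
    of (X, Z). The right side is the density of Z times the conditional density of X given Z = z,
    which is normal with mean s z / r^2 and standard deviation t / r. *)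
Lemma normal_pdf01_convolution s t x z : 0 < s -> 0 < t ->
  let r := Num.sqrt (s ^+ 2 + t ^+ 2) in
  phi x * (t^-1 * phi ((z - s * x) / t)) =
  r^-1 * phi (z / r) * ((t / r)^-1 * phi ((x - s * z / r ^+ 2) / (t / r))).
Proof.
move=> s0 t0 r.
have st0 : 0 < s ^+ 2 + t ^+ 2 by rewrite addr_gt0// exprn_gt0.
have r0 : 0 < r by rewrite sqrtr_gt0.
have r2 : r ^+ 2 = s ^+ 2 + t ^+ 2 by rewrite sqr_sqrtr// ltW.
suff h : x ^+ 2 + ((z - s * x) / t) ^+ 2 = (z / r) ^+ 2 +
    ((x - s * z / r ^+ 2) / (t / r)) ^+ 2.
  have ht : r^-1 * (t / r)^-1 = t^-1.
    by rewrite invf_div mulrA mulVf ?mul1r ?gt_eqF.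
  rewrite !normal_pdf01E.
  set A := expR (- x ^+ 2 / 2); set B := expR (- ((z - s * x) / t) ^+ 2 / 2).
  set C := expR (- (z / r) ^+ 2 / 2); set D := expR (- ((x - s * z / r ^+ 2) / (t / r)) ^+ 2 / 2); set k := normal_peak 1.
  have AB : A * B = C * D by rewrite -!expRD; congr expR; rewrite !mulNr -!opprD -!mulrDl h.
  transitivity (t^-1 * k ^+ 2 * (A * B)); first by lra.
  by rewrite AB -ht; lra.
have e1 : (z / r) ^+ 2 = z ^+ 2 / r ^+ 2 by rewrite exprMn exprVn.
have e2 : ((z - s * x) / t) ^+ 2 = (z - s * x) ^+ 2 / t ^+ 2 by rewrite exprMn exprVn.
have e3 : ((x - s * z / r ^+ 2) / (t / r)) ^+ 2 =
  (x - s * z / r ^+ 2) ^+ 2 * r ^+ 2 / t ^+ 2.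
  by rewrite invf_div !exprMn exprVn mulrA.
rewrite e1 e2 e3; set p := t ^+ 2 in r2 *; set q := r ^+ 2 in r2 *.
have p0 : p != 0 by rewrite gt_eqF// exprn_gt0.
have q0 : q != 0 by rewrite gt_eqF// exprn_gt0.
have -> : (x - s * z / q) ^+ 2 * q = x ^+ 2 * q - 2 * x * s * z + s ^+ 2 * z ^+ 2 / q.
  rewrite sqrrB !mulrDl !mulNr; congr (_ - _ + _).
    by rewrite -mulrnAl -!mulrA mulVf//; lra.
  by rewrite !exprMn exprVn -!mulrA expr2 invfM -mulrA mulVf// mulr1.
apply: (mulIf p0); rewrite !mulrDl !divfK//.
apply: (mulIf q0); rewrite !mulrDl.
have -> : s ^+ 2 * z ^+ 2 / q * q = s ^+ 2 * z ^+ 2 by rewrite divfK.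
have -> : z ^+ 2 / q * p * q = z ^+ 2 * p by rewrite mulrAC divfK.
by rewrite r2; lra.
Qed.

(** For s, t > 0, exchanging the integrals of the joint density of (X, s X + t Y) integrates out the
    conditional density of X. The degenerate cases s = 0 and t = 0 have no such density and are
    treated apart. *)
Lemma gauss_convolution s t (B : set R) : 0 <= s -> 0 <= t -> measurable B ->
  (gauss \x gauss)%E [set xy | B (s * xy.1 + t * xy.2)] =
  gauss [set x | B (Num.sqrt (s ^+ 2 + t ^+ 2) * x)].
Proof.
rewrite le_eqVlt => /predU1P[<-|s0].
  move=> t0 mB; rewrite expr0n/= add0r sqrtr_sqr ger0_norm//.
  rewrite (_ : [set _ | _] = setT `*` [set x | B (t * x)]); last first.
    by apply/seteqP; split => -[x y]/=; rewrite mul0r add0r => // -[].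
  rewrite product_measure1E//.
    by rewrite -[RHS]mul1e; congr (_ * _)%E; exact: integral_normal_pdf.
  rewrite -[X in measurable X]setTI.
  exact: (@measurable_funM _ _ R setT (cst t) id).
rewrite le_eqVlt => /predU1P[<-|t0] mB.
  rewrite expr0n/= addr0 sqrtr_sqr gtr0_norm//.
  rewrite (_ : [set _ | _] = [set x | B (s * x)] `*` setT); last first.
    by apply/seteqP; split => -[x y]/=; rewrite mul0r addr0 => // -[].
  rewrite product_measure1E//.
    by rewrite -[RHS]mule1; congr (_ * _)%E; exact: integral_normal_pdf.
  rewrite -[X in measurable X]setTI.
  exact: (@measurable_funM _ _ R setT (cst s) id).
set r := Num.sqrt _.
have st0 : 0 < s ^+ 2 + t ^+ 2 by rewrite addr_gt0// exprn_gt0.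
have r0 : 0 < r by rewrite sqrtr_gt0.
pose f (p : R * R) := (phi p.1 * (\1_B p.2 * (t^-1 * phi ((p.2 - s * p.1) / t))))%:E.
have mf : measurable_fun setT f.
  apply/measurable_EFinP; apply: measurable_funM.
    by apply: measurableT_comp => //; exact: measurable_normal_pdf.
  apply: measurable_funM; first by apply: measurableT_comp => //; exact: measurable_indic.
  apply: measurable_funM => //; apply: measurableT_comp.
    exact: measurable_normal_pdf.
  apply: measurable_funM => //; apply: measurable_funB => //.
  exact: measurable_funM.
have f0 p : (0 <= f p)%E.
  by rewrite lee_fin !mulr_ge0 ?normal_pdf_ge0 ?invr_ge0 ?(ltW t0).
have mS : measurable [set xy : R * R | B (s * xy.1 + t * xy.2)].
  rewrite -[X in measurable X]setTI.
  apply: (measurable_funD (f := fun xy : R * R => s * xy.1)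
    (g := fun xy : R * R => t * xy.2)) => //; exact: measurable_funM.
transitivity (\int[mu]_x \int[mu]_z f (x, z))%E.
  rewrite /product_measure1 ge0_integral_gauss//=; last first.
    exact: measurable_fun_xsection.
  apply: eq_integral => x _.
  rewrite (_ : xsection _ x = (fun y => s * x + t * y) @^-1` B); last first.
    by apply/seteqP; split => y; rewrite /xsection/= inE.
  rewrite gauss_affine_preimage// muleC -ge0_integralZl//.
  - apply/measurable_EFinP; apply: measurable_funM; first exact: measurable_indic.
    apply: measurable_funM => //; apply: measurableT_comp.
      exact: measurable_normal_pdf.
    by apply: measurable_funM => //; exact: measurable_funB.
  - by move=> z _; rewrite lee_fin !mulr_ge0 ?normal_pdf_ge0 ?invr_ge0 ?(ltW t0).
  - by rewrite lee_fin normal_pdf_ge0.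
transitivity (\int[mu]_z \int[mu]_x f (x, z))%E.
  exact: (@fubini_tonelli _ _ (measurableTypeR R) (measurableTypeR R) R mu mu f).
rewrite (_ : [set x | _] = (fun y => 0 + r * y) @^-1` B); last first.
  by apply/seteqP; split => y /=; rewrite add0r.
rewrite gauss_affine_preimage//; apply: eq_integral => z _; rewrite subr0.
have tr0 : 0 < t / r by rewrite divr_gt0.
transitivity (\int[mu]_x ((\1_B z * (r^-1 * phi (z / r)))%:E *
  (\1_setT x * ((t / r)^-1 * phi ((x - s * z / r ^+ 2) / (t / r))))%:E))%E.
  apply: eq_integral => x _; rewrite /f/= -EFinM indicT mul1r; congr EFin.
  by rewrite mulrCA normal_pdf01_convolution// !mulrA.
rewrite ge0_integralZl//; last 3 first.
- apply/measurable_EFinP; apply: measurable_funM; first exact: measurable_indic.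
  apply: measurable_funM => //; apply: measurableT_comp.
    exact: measurable_normal_pdf.
  by apply: measurable_funM => //; exact: measurable_funB.
- by move=> x _; rewrite lee_fin !mulr_ge0 ?normal_pdf_ge0 ?invr_ge0 ?(ltW tr0).
- by rewrite lee_fin !mulr_ge0 ?normal_pdf_ge0 ?invr_ge0 ?(ltW r0).
rewrite -gauss_affine_preimage// preimage_setT.
by rewrite -[RHS]mule1; congr (_ * _)%E; exact: integral_normal_pdf.
Qed.

Lemma is_derive_normal_pdf01 x : is_derive x 1 phi (- (x * phi x)).
Proof.
have -> : phi = (fun x => normal_peak 1 * expR (- x ^+ 2 / 2)).
  by apply/funext => y; rewrite normal_pdf01E.
by apply: is_derive_eq; rewrite /GRing.scale/= mulr0 mulr0 add0r; lra.
Qed.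

Lemma Phi_gauss x : gauss `]-oo, x] = (Phi x)%:E.
Proof. by rewrite /Phi fineK// fin_num_measure. Qed.

Lemma is_derive_Phi x : is_derive x 1 (@Phi R) (phi x).
Proof.
have [] := @continuous_FTC1 R phi -oo%O x (x + 1).
- by rewrite ltrDl.
- by apply: (integrableS measurableT) => //; exact: integrable_normal_pdf.
- by rewrite /Order.lt/=.
- exact: continuous_normal_pdf.
move=> dP P'; apply: DeriveDef; first exact: dP.
by rewrite -derive1E; exact: P'.
Qed.

Lemma continuous_Phi : continuous (@Phi R).
Proof.
move=> x; apply: differentiable_continuous; apply/derivable1_diffP.
exact: (@ex_derive _ _ _ _ _ _ _ (is_derive_Phi x)).
Qed.

Lemma gauss_complement (A : set R) : measurable A -> gauss (~` A) = (1 - gauss A)%E.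
Proof. exact: (@probability_setC _ _ R (normal_prob 0 1)). Qed.

Lemma gauss_set1 x : gauss [set x] = 0%E.
Proof.
rewrite /normal_prob; exact: integral_set1.
Qed.

Lemma gauss_opp (A : set R) : measurable A -> gauss (-%R @^-1` A) = gauss A.
Proof.
move=> mA.
have mN : measurable_fun setT (fun x : R => - x) by exact: measurable_funN.
have mB : measurable (-%R @^-1` A) by rewrite -[X in measurable X]setTI; exact: mN.
have E B : measurable B -> gauss B = (\int[gauss]_x (\1_B x)%:E)%E.
  by move=> mB'; rewrite integral_indic// setIT.
rewrite !E// [RHS]ge0_integral_gaussN//.
exact/measurable_EFinP/measurable_indic.
Qed.

Lemma gauss_itvcy x : gauss `[x, +oo[ = (Phi (- x))%:E.
Proof.
rewrite -Phi_gauss -(gauss_opp (A := `[x, +oo[))//; congr gauss.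
by apply/seteqP; split => y /=; rewrite !in_itv/= andbT lerNr.
Qed.

Lemma gauss_itvoy x : gauss `]x, +oo[ = (Phi (- x))%:E.
Proof.
rewrite -gauss_itvcy -(@setU1itv _ _ _ _ false)// measureU//.
- by rewrite -[LHS]add0e; congr (_ + _)%E; exact/esym/gauss_set1.
- by rewrite -subset0 => y [/= ->]; rewrite in_itv/= ltxx.
Qed.

Lemma PhiN x : Phi (- x) = 1 - Phi x.
Proof.
have := gauss_complement (measurable_itv `]-oo, x]).
by rewrite setCitvl Phi_gauss [X in X = _ -> _]gauss_itvoy -EFinB => -[].
Qed.

Lemma Phi_ge0 x : 0 <= Phi x.
Proof. by rewrite -lee_fin -Phi_gauss. Qed.

Lemma Phi_le1 x : Phi x <= 1.
Proof. by rewrite -lee_fin -Phi_gauss; exact: (@probability_le1 _ _ R (normal_prob 0 1)). Qed.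

Lemma Phi0 : Phi (0 : R) = 2^-1.
Proof. by have := PhiN 0; rewrite oppr0; lra. Qed.

Lemma normal_pdf01_gt0 x : 0 < phi x.
Proof. by rewrite normal_pdf01E mulr_gt0 ?expR_gt0 ?normal_peak_gt0 ?oner_eq0. Qed.

Lemma Phi_increasing : {homo (@Phi R) : x y / x < y}.
Proof.
move=> x y xy; have [c _ e] := @MVT R (@Phi R) phi x y xy (fun z _ => is_derive_Phi z)
  (continuous_subspaceT continuous_Phi).
by rewrite -subr_gt0 e mulr_gt0 ?subr_gt0 ?normal_pdf01_gt0.
Qed.

Lemma ler_Phi : {mono (@Phi R) : x y / x <= y}.
Proof. exact/le_mono/Phi_increasing. Qed.

Lemma ltr_Phi : {mono (@Phi R) : x y / x < y}.
Proof. exact/leW_mono/ler_Phi. Qed.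

Lemma normal_peak1_gt0 : 0 < @normal_peak R 1.
Proof. by rewrite normal_peak_gt0// oner_eq0. Qed.

Lemma normal_pdf01_le_peak x : phi x <= normal_peak 1.
Proof. by apply: normal_pdf_ub; rewrite oner_eq0. Qed.

Lemma normal_peak1_le : @normal_peak R 1 <= 2^-1.
Proof.
rewrite /normal_peak lef_pV2 ?posrE ?sqrtr_gt0//; last first.
  by rewrite expr1n mul1r mulrn_wgt0// pi_gt0.
rewrite (_ : 2 = Num.sqrt (2 ^+ 2)); last by rewrite sqrtr_sqr ger0_norm.
rewrite expr1n mul1r; move: (pi_ge2 R); move: (@pi R) => p p2.
by rewrite ler_sqrt; lra.
Qed.

Lemma cvg_normal_pdf01 : phi x @[x --> +oo] --> (0 : R).
Proof.
apply: (@squeeze_cvgr _ _ _ _ (cst 0) (fun x => expR 2^-1 * expR (- x))).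
- near=> x; rewrite normal_pdf_ge0/= normal_pdf01E -expRD.
  rewrite -[leRHS]mul1r ler_pM ?expR_ge0 ?(ltW normal_peak1_gt0)//.
    by have := normal_peak1_le; lra.
  by rewrite ler_expR; have := sqr_ge0 (x - 1); lra.
- exact: cvg_cst.
- by rewrite -(mulr0 (expR 2^-1)); apply: cvgM; [exact: cvg_cst|exact: cvgr_expR].
Unshelve. all: by end_near. Qed.

Lemma continuous_normal_pdf01 : continuous phi.
Proof. by apply: continuous_normal_pdf; rewrite oner_eq0. Qed.

Lemma integral_tail_xphi t : 0 <= t ->
  (\int[mu]_(x in `[t, +oo[) (x * phi x)%:E = (phi t)%:E)%E.
Proof.
move=> t0; rewrite (@ge0_continuous_FTC2y R _ (fun x => - phi x) t 0).
- by rewrite EFinN oppeK add0e.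
- by move=> x tx; rewrite mulr_ge0 ?normal_pdf_ge0// (le_trans t0).
- apply: continuous_subspaceT => x.
  by apply: cvgM; [exact: cvg_id|exact: continuous_normal_pdf01].
- by have := cvgN cvg_normal_pdf01; rewrite oppr0; exact.
- by move=> x _; apply: derivableN; exact: (@ex_derive _ _ _ _ _ _ _ (is_derive_normal_pdf01 x)).
- by apply: cvgN; apply: cvg_at_right_filter; exact: continuous_normal_pdf01.
- move=> x _; rewrite derive1E deriveN; last first.
    exact: (@ex_derive _ _ _ _ _ _ _ (is_derive_normal_pdf01 x)).
  by rewrite (@derive_val _ _ _ _ _ _ _ (is_derive_normal_pdf01 x)) opprK.
Qed.

(** Mills-ratio upper bound: on the tail x is at most the variable of integration y, and y * phi y
    integrates exactly to phi x. *)
Lemma Phi_tail_le x : 0 <= x -> x * Phi (- x) <= phi x.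
Proof.
move=> x0; rewrite -lee_fin -(integral_tail_xphi x0) EFinM -gauss_itvcy.
rewrite /normal_prob -ge0_integralZl//.
- apply: ge0_le_integral => //.
  + by move=> y _; rewrite mule_ge0 ?lee_fin ?normal_pdf_ge0.
  + apply: emeasurable_funM => //; apply: measurable_funTS; exact: measurable_phiE.
  + apply/measurable_EFinP; apply: measurable_funM => //.
    by apply: measurable_funTS; exact: measurable_normal_pdf.
  + move=> y /=; rewrite in_itv/= andbT => xy; rewrite lee_fin ler_wpM2r//.
    exact: normal_pdf_ge0.
- by apply: measurable_funTS; exact: measurable_phiE.
- by move=> y _; rewrite lee_fin normal_pdf_ge0.
Qed.

(** Mills-ratio lower bound: - phi y / y is an antiderivative of phi y * (1 + y^-2), and the last
    factor is at most 1 + x^-2 on the tail. It yields the lower estimates of the quantiles. *)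
Lemma Phi_tail_ge x : 0 < x -> phi x / x <= (1 + x ^- 2) * Phi (- x).
Proof.
move=> x0.
have dF y : 0 < y -> is_derive y 1 (fun z => - (phi z * z^-1)) (phi y * (1 + y ^- 2)).
  move=> y0; have yn0 : y != 0 by rewrite gt_eqF.
  have h1 := is_derive_normal_pdf01 y.
  have h2 := is_deriveV yn0 (is_derive_id y (1 : R)).
  apply: is_derive_eq; rewrite /GRing.scale/=.
  by have : y^-1 * (y * phi y) = phi y by [rewrite mulrA mulVf ?mul1r|]; lra.
have dF' y : 0 < y -> derivable (fun z => - (phi z * z^-1)) y 1.
  by move=> /dF h; exact: ex_derive.
have cvgV0 : y^-1 @[y --> +oo] --> (0 : R).
  apply/gtr0_cvgV0; last exact: cvg_id.
  by near=> y; near: y; exact: nbhs_pinfty_gt.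
have cf : {within `[x, +oo[, continuous (fun y => phi y * (1 + y ^- 2))}.
  apply: continuous_in_subspaceT => y; rewrite inE/= in_itv/= andbT => xy.
  have yn0 : y != 0 by rewrite gt_eqF// (lt_le_trans x0).
  apply: cvgM; first exact: continuous_normal_pdf01.
  apply: cvgD; first exact: cvg_cst.
  apply: cvgV; first by rewrite expf_neq0.
  exact: exprn_continuous.
have E : (\int[mu]_(y in `[x, +oo[) (phi y * (1 + y ^- 2))%:E = (phi x / x)%:E)%E.
  rewrite (@ge0_continuous_FTC2y R _ (fun z => - (phi z * z^-1)) x 0).
  - by rewrite EFinN oppeK add0e.
  - by move=> y _; rewrite mulr_ge0 ?normal_pdf_ge0// addr_ge0// invr_ge0 sqr_ge0.
  - exact: cf.
  - have := cvgN (cvgM cvg_normal_pdf01 cvgV0).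
    by rewrite mulr0 oppr0; exact.
  - by move=> y xy; apply: dF'; exact: lt_trans xy.
  - apply: cvgN; apply: cvg_at_right_filter; apply: cvgM.
      exact: continuous_normal_pdf01.
    by apply: cvgV; [rewrite gt_eqF|exact: cvg_id].
  - move=> y; rewrite in_itv/= andbT => xy; rewrite derive1E.
    by have := dF y (lt_trans x0 xy) => h; rewrite derive_val.
rewrite -lee_fin -E EFinM -gauss_itvcy /normal_prob -ge0_integralZl//.
- apply: ge0_le_integral => //.
  + by move=> y _; rewrite lee_fin mulr_ge0 ?normal_pdf_ge0// addr_ge0// invr_ge0 sqr_ge0.
  + by apply/measurable_EFinP; exact: subspace_continuous_measurable_fun cf.
  + apply: emeasurable_funM => //; apply: measurable_funTS; exact: measurable_phiE.
  + move=> y /=; rewrite in_itv/= andbT => xy; rewrite -EFinM lee_fin mulrC ler_wpM2r//.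
      exact: normal_pdf_ge0.
    rewrite lerD2l lef_pV2 ?posrE ?exprn_gt0//; last exact: lt_le_trans xy.
    by rewrite ler_sqr ?nnegrE ?(ltW x0)// (le_trans (ltW x0)).
- by apply: measurable_funTS; exact: measurable_phiE.
- by move=> y _; rewrite lee_fin normal_pdf_ge0.
- by rewrite lee_fin addr_ge0// invr_ge0 sqr_ge0.
Unshelve. all: by end_near. Qed.

Lemma is_derive_PhiD_pdf (u : R) :
  is_derive u 1 (fun x : R => x * Phi x + phi x) (Phi u).
Proof.
have h1 := is_derive_normal_pdf01 u; have h2 := is_derive_Phi u.
by apply: is_derive_eq; rewrite /GRing.scale/= mulr1; lra.
Qed.

Lemma Phi_ivt (p : R) : 0 < p -> p < 1 -> exists x, Phi x = p.
Proof.
(* With m the smaller of p and 1 - p, the Mills bound at 1 / m gives Phi (- 1 / m) <= m, so that the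
   points -1 / m and 1 / m bracket the value p. *)
move=> p0 p1; pose m := Num.min p (1 - p).
have m0 : 0 < m by rewrite lt_min p0 subr_gt0.
have tail : Phi (- m^-1) <= m.
  have iv0 : 0 < m^-1 by rewrite invr_gt0.
  have := Phi_tail_le (ltW iv0); rewrite mulrC ler_pdivrMr//.
  move=> /le_trans; apply; rewrite ler_piMl ?(ltW m0)//.
  by rewrite (le_trans (normal_pdf01_le_peak _))// (le_trans normal_peak1_le)//; lra.
have mp : m <= p by rewrite ge_min lexx.
have mq : m <= 1 - p by rewrite ge_min lexx orbT.
have le : Phi (- m^-1) <= p <= Phi m^-1.
  by have := PhiN m^-1 => e; apply/andP; split; lra.
have ab : - m^-1 <= m^-1 by rewrite ge0_cp// invr_ge0 ltW.
have [|c _ <-] := IVT ab (continuous_subspaceT continuous_Phi) (v := p).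
  by move/andP: le => [le1 le2]; rewrite ge_min le1 le_max le2 orbT.
by exists c.
Qed.

Lemma Phi_z_ (alpha : R) : 0 < alpha -> alpha < 1 -> Phi (z_ alpha) = 1 - alpha.
Proof.
move=> a0 a1.
have [x Px] : exists x, Phi x = 1 - alpha by apply: Phi_ivt; lra.
by apply: (xgetPex 0 (P := [set x | Phi x = 1 - alpha])); exists x.
Qed.

(** The exact value is t * Phi t + phi t. By symmetry twice the integral is that of max (t + x) 0 +
    max (t - x) 0, which is at most 2 t, plus |x| on the tail |x| >= t; in this way all integrands
    stay nonnegative. *)
Lemma ge0_integral_gauss_pos_part t : 0 <= t ->
  (\int[gauss]_x (Num.max (t + x) 0)%:E <= (t + phi t)%:E)%E.
Proof.
move=> t0.
pose T x := (x * \1_`[t, +oo[ x)%:E.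
have mT : measurable_fun setT T.
  by apply/measurable_EFinP; apply: measurable_funM => //; exact: measurable_indic.
have T0 x : (0 <= T x)%E.
  rewrite lee_fin indicE; case: (boolP (x \in _)) => [|_]; last by rewrite mulr0.
  by rewrite inE/= in_itv/= andbT mulr1; exact: le_trans.
have IT : (\int[gauss]_x T x = (phi t)%:E)%E.
  rewrite ge0_integral_gauss// -(integral_tail_xphi t0) [RHS]integral_mkcond.
  apply: eq_integral => x _; rewrite patchE /T indicE.
  by case: ifPn => _; rewrite -EFinM ?mulr1 ?mulr0 ?mul0r.
have mN : measurable_fun setT (fun x : R => - x) by exact: measurable_funN.
have mM : measurable_fun setT (fun x : R => (Num.max (t + x) 0)%:E).
  by apply/measurable_EFinP; apply: measurable_maxr => //; exact: measurable_funD.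
have mM' : measurable_fun setT (fun x : R => (Num.max (t - x) 0)%:E).
  by apply/measurable_EFinP; apply: measurable_maxr => //; exact: measurable_funB.
set I := (\int[_]_x _)%E.
have I0 : (0 <= I)%E by apply: integral_ge0 => x _; rewrite lee_fin le_max lexx orbT.
have I2 : (I + I <= (2 * (t + phi t))%:E)%E.
  rewrite [X in (_ + X)%E](_ : _ = \int[gauss]_x (Num.max (t - x) 0)%:E)%E; last first.
    by rewrite /I ge0_integral_gaussN// => x; rewrite lee_fin le_max lexx orbT.
  rewrite -ge0_integralD//; [|by move=> x _; rewrite lee_fin le_max lexx orbT..].
  apply: (@le_trans _ _ (\int[gauss]_x ((2 * t)%:E + (T x + T (- x)%R)))%E).
    apply: ge0_le_integral => //.
    - by move=> x _; rewrite adde_ge0// lee_fin le_max lexx orbT.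
    - by apply: emeasurable_funD.
    - apply: emeasurable_funD => //; apply: emeasurable_funD => //.
      exact: measurableT_comp mT mN.
    - move=> x _; rewrite -!EFinD lee_fin !indicE.
      have itvE y : (y \in `[t, +oo[%classic) = (t <= y).
        by apply/idP/idP; rewrite inE/= in_itv/= andbT.
      rewrite !itvE; case: (leP t x) => tx; case: (leP t (- x)) => tx';
      case: (leP (t + x) 0) => h1; case: (leP (t - x) 0) => h2; rewrite /=; lra.
  rewrite ge0_integralD//; last 3 first.
  - by move=> x _; rewrite lee_fin mulr_ge0.
  - by move=> x _; rewrite adde_ge0.
  - by apply: emeasurable_funD => //; exact: measurableT_comp mT mN.
  rewrite ge0_integralD//; last exact: measurableT_comp mT mN.
  rewrite -(ge0_integral_gaussN mT)// IT integral_cst// [X in (_ * X)%E]probability_setT.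
  by rewrite mule1 -!EFinD lee_fin; lra.
have Ifin : I \is a fin_num.
  rewrite ge0_fin_numE//; apply: le_lt_trans (ltry (2 * (t + phi t))).
  by apply: le_trans I2; rewrite leeDl.
by move: I2; rewrite -(fineK Ifin) -EFinD !lee_fin; lra.
Qed.

End standard_gaussian.

Lemma measure_unique_rectangle d1 d2 (T1 : measurableType d1)
    (T2 : measurableType d2) (R : realType)
    (m1 m2 : {measure set (T1 * T2) -> \bar R}) :
  (m1 setT < +oo)%E ->
  (forall A B, measurable A -> measurable B -> m1 (A `*` B) = m2 (A `*` B)) ->
  forall S, measurable S -> m1 S = m2 S.
Proof.
move=> m1T m12 S mS.
pose G : set (set (T1 * T2)) := [set A `*` B | A in measurable & B in measurable].
apply: (measure_unique G (fun _ => setT)) => //.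
- by rewrite measurable_prod_measurableType.
- move=> _ _ [A1 mA1 [B1 mB1 <-]] [A2 mA2 [B2 mB2 <-]].
  by rewrite -setXI; exists (A1 `&` A2); [exact: measurableI|
     exists (B1 `&` B2) => //; exact: measurableI].
- by move=> _; exists setT => //; exists setT => //; rewrite setXTT.
- by rewrite bigcup_const.
- by move=> _ [A mA [B mB <-]]; exact: m12.
Qed.

(** * Normally distributed random variables *)

Section normal_laws.
Context d (T : measurableType d) (R : realType) (P : probability T R).
Notation gauss := (@normal_prob R 0 1).
Notation phi := (@normal_pdf R 0 1).
Implicit Types (X Y : T -> R) (m s t x : R).

(** Expressed as the image of the standard Gaussian under an affine map, so that s = 0 (a constant
    variable) and negative s are meaningful. *)
Definition normal_law X m s := forall A : set R, measurable A ->
  P (X @^-1` A) = gauss ((fun x => m + s * x) @^-1` A).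

Let measurable_affine m s : measurable_fun setT (fun x : R => m + s * x).
Proof. by apply: measurable_funD => //; exact: measurable_funM. Qed.

Lemma ge0_integral_normal_law X m s (u : R -> \bar R) :
  measurable_fun setT X -> normal_law X m s ->
  measurable_fun setT u -> (forall x, 0 <= u x)%E ->
  (\int[P]_w u (X w) = \int[gauss]_x u (m + s * x)%R)%E.
Proof.
move=> mX nX mu_ u0.
rewrite -(ge0_integral_image_measure P mX)//.
transitivity (\int[image_measure gauss (measurable_affine m s)]_y u y)%E.
  by apply: eq_measure_integral => /= A mA _; exact: nX.
exact: ge0_integral_image_measure.
Qed.

Lemma normal_law_affine X m s (a b : R) : normal_law X m s ->
  normal_law (fun w => a + b * X w) (a + b * m) (b * s).
Proof.
move=> nX A mA.
have mB : measurable ((fun x => a + b * x) @^-1` A).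
  by rewrite -[X in measurable X]setTI; exact: measurable_affine.
rewrite [LHS](nX _ mB); congr normal_prob.
by apply/seteqP; split => x /=; rewrite mulrDr mulrA addrA.
Qed.

Lemma normal_law_le X m s x : 0 < s -> normal_law X m s ->
  P [set w | X w <= x] = (Phi ((x - m) / s))%:E.
Proof.
move=> s0 nX; have := nX _ (measurable_itv `]-oo, x]); rewrite -Phi_gauss.
have -> : X @^-1` `]-oo, x] = [set w | X w <= x].
  by apply/seteqP; split => w; rewrite /= in_itv.
move=> ->; congr normal_prob.
by apply/seteqP; split => y; rewrite /= !in_itv/= ler_pdivlMr// lerBrDl mulrC.
Qed.

Lemma normal_law_ge X m s x : 0 < s -> normal_law X m s ->
  P [set w | x <= X w] = (Phi ((m - x) / s))%:E.
Proof.
move=> s0 nX; have := nX _ (measurable_itv `[x, +oo[); rewrite -[_ / s]opprK -gauss_itvcy.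
have -> : X @^-1` `[x, +oo[ = [set w | x <= X w].
  by apply/seteqP; split => w; rewrite /= in_itv/= andbT.
move=> ->; congr normal_prob.
by apply/seteqP; split => y; rewrite /= !in_itv/= !andbT -mulNr opprB ler_pdivrMr// lerBlDl mulrC.
Qed.

Lemma normal_law_gt X m s x : 0 < s -> normal_law X m s ->
  P [set w | x < X w] = (Phi ((m - x) / s))%:E.
Proof.
move=> s0 nX; have := nX _ (measurable_itv `]x, +oo[); rewrite -[_ / s]opprK -gauss_itvoy.
have -> : X @^-1` `]x, +oo[ = [set w | x < X w].
  by apply/seteqP; split => w; rewrite /= in_itv/= andbT.
move=> ->; congr normal_prob.
by apply/seteqP; split => y; rewrite /= !in_itv/= !andbT -mulNr opprB ltr_pdivrMr// ltrBlDl mulrC.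
Qed.

Lemma ge0_integral_normal_law_pos_part X m s : measurable_fun setT X ->
  0 <= m -> 0 < s -> normal_law X m s ->
  (\int[P]_w (Num.max (X w) 0)%:E <= (m + s * phi (m / s))%:E)%E.
Proof.
move=> mX m0 s0 nX.
rewrite (@ge0_integral_normal_law X m s (fun x => (Num.max x 0)%:E))//; last 2 first.
- by apply/measurable_EFinP; exact: measurable_maxr.
- by move=> x; rewrite lee_fin le_max lexx orbT.
have ms0 : 0 <= m / s by rewrite divr_ge0// ltW.
rewrite (_ : (\int[_]_x _)%E =
  (\int[gauss]_x (s%:E * (Num.max (m / s + x) 0)%:E))%E); last first.
  apply: eq_integral => x _; rewrite -EFinM maxr_pMr ?(ltW s0)// mulr0 mulrDr.
  by rewrite mulrCA divff ?mulr1// gt_eqF.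
have -> : m + s * phi (m / s) = s * (m / s + phi (m / s)).
  by rewrite mulrDr mulrCA divff ?mulr1// gt_eqF.
rewrite ge0_integralZl//.
- rewrite EFinM lee_pmul2l ?lte_fin//.
  exact: ge0_integral_gauss_pos_part.
- apply/measurable_EFinP; apply: measurable_maxr => //; exact: measurable_funD.
- by move=> x _; rewrite lee_fin le_max lexx orbT.
- by rewrite lee_fin ltW.
Qed.

End normal_laws.

(** * Independence *)

Section independence.
Context d (T : measurableType d) (R : realType) (P : probability T R).

(** All k coordinates enter the product; a subfamily is obtained by taking [setT] for the other
    sets. This is the form in which [brownian_motion] provides the independence of increments. *)
Definition mutually_independent d' (T' : measurableType d') (k : nat)
    (X : nat -> T -> T') :=
  forall A : nat -> set T', (forall i, (i < k)%N -> measurable (A i)) ->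
  P [set w | forall i, (i < k)%N -> A i (X i w)] =
  (\prod_(i < k) P (X i @^-1` A i))%E.

Lemma measurable_family_event d' (T' : measurableType d') (k : nat)
    (X : nat -> T -> T') (A : nat -> set T') (Q : pred nat) :
  (forall i, (i < k)%N -> measurable_fun setT (X i)) ->
  (forall i, (i < k)%N -> measurable (A i)) ->
  measurable [set w | forall i, (i < k)%N -> Q i -> A i (X i w)].
Proof.
move=> mX mA.
rewrite (_ : [set w | _] = \bigcap_(i in [set i | (i < k)%N /\ Q i]) (X i @^-1` A i)).
  apply: bigcap_measurableType => i [ik _].
  by rewrite -[X in measurable X]setTI; apply: mX => //; exact: mA.
apply/seteqP; split => w /= h i; first by move=> [ik Qi]; exact: h.
by move=> ik Qi; exact: h.
Qed.

Section generated.
Context d' (T' : measurableType d') (G : set (set T')).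
Hypotheses (mG : measurable = <<s G >>) (setIG : setI_closed G) (GT : G setT).

(** The induction frees one coordinate at a time: the first m sets are arbitrary measurable sets,
    the remaining ones lie in the generating pi-system. *)
Lemma mutually_independent_generated (k : nat) (X : nat -> T -> T') :
  (forall i, (i < k)%N -> measurable_fun setT (X i)) ->
  (forall A : nat -> set T', (forall i, (i < k)%N -> G (A i)) ->
    P [set w | forall i, (i < k)%N -> A i (X i w)] =
    (\prod_(i < k) P (X i @^-1` A i))%E) ->
  mutually_independent k X.
Proof.
move=> mX hG.
have Gm : G `<=` measurable by rewrite mG; exact: sub_sigma_algebra.
suff h m : (m <= k)%N -> forall A : nat -> set T',
    (forall i, (i < k)%N -> measurable (A i)) ->
    (forall i, (m <= i < k)%N -> G (A i)) ->
    P [set w | forall i, (i < k)%N -> A i (X i w)] =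
    (\prod_(i < k) P (X i @^-1` A i))%E.
  move=> A mA; apply: (h k) => // i /andP[ki ik].
  by move: ik; rewrite ltnNge ki.
elim: m => [_ A _ GA|m IH mk A mA GA]; first by apply: hG => i ik; exact: GA.
pose C := [set w | forall i, (i < k)%N -> i != m -> A i (X i w)].
have mC : measurable C by exact: measurable_family_event.
pose c := (\prod_(i < k | i != m :> nat) P (X i @^-1` A i))%E.
have mXA i B : (i < k)%N -> measurable B -> measurable (X i @^-1` B).
  by move=> ik mB; rewrite -[X in measurable X]setTI; exact: mX.
have c0 : (0 <= c)%E by apply: prode_ge0 => i _; exact: measure_ge0.
have cfin : c \is a fin_num.
  by apply: prode_fin_num => i _; rewrite fin_num_measure//; apply: mXA => //; exact: mA.
have fc0 : 0 <= fine c by exact: fine_ge0.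
have setE B : [set w | forall i, (i < k)%N -> (if i == m then B else A i) (X i w)] =
    X m @^-1` B `&` C.
  apply/seteqP; split => w /=.
    move=> h; split; first by have := h m mk; rewrite eqxx.
    by move=> i ik im; have := h i ik; rewrite (negbTE im).
  by move=> [Bw Cw] i ik; case: ifPn => [/eqP->//|im]; exact: Cw.
have prodE B : (\prod_(i < k) P (X i @^-1` (if i == m :> nat then B else A i)) =
    P (X m @^-1` B) * c)%E.
  rewrite (bigD1 (Ordinal mk))//= eqxx; congr (_ * _)%E.
  by apply: eq_bigr => i; rewrite -val_eqE/= => /negbTE ->.
(* As functions of the m-th set both sides are finite measures. They agree on [G] by the induction
   hypothesis, hence on all measurable sets. *)
pose m1 := image_measure (mrestr P mC) (mX m mk).
pose m2 : {measure set T' -> \bar R} :=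
  mscale (NngNum fc0) (image_measure P (mX m mk)).
have m1E B : m1 B = P [set w | forall i, (i < k)%N ->
    (if i == m then B else A i) (X i w)] by rewrite setE.
have m2E B : m2 B = (\prod_(i < k) P (X i @^-1` (if i == m :> nat then B else A i)))%E.
  by rewrite prodE muleC -[c]fineK.
have key B : measurable B -> m1 B = m2 B.
  apply: (measure_unique G (fun _ => setT)) => //.
  - by rewrite bigcup_const.
  - move=> B' GB'; rewrite m1E m2E.
    apply: (IH (ltnW mk) (fun i => if i == m then B' else A i)).
    + by move=> i ik; case: ifPn => // _; [exact: Gm|exact: mA].
    + move=> i /andP[mi ik]; case: ifPn => // im.
      by apply: GA; rewrite ik andbT ltn_neqAle eq_sym im.
  - move=> _; rewrite m1E; apply: (@le_lt_trans _ _ 1%E); last exact: ltry.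
    by rewrite setE probability_le1//; apply: measurableI => //; exact: mXA.
have := key (A m) (mA m mk); rewrite m1E m2E.
have e i : (if i == m then A m else A i) = A i by case: eqP => // ->.
have -> : [set w | forall i, (i < k)%N -> (if i == m then A m else A i) (X i w)] =
    [set w | forall i, (i < k)%N -> A i (X i w)].
  by apply/seteqP; split => w h i ik; have := h i ik; rewrite e.
by move=> ->; apply: eq_bigr => i _; rewrite e.
Qed.

End generated.

Lemma mutually_independent_comp d1 d2 (T1 : measurableType d1)
    (T2 : measurableType d2) (k : nat) (X : nat -> T -> T1)
    (g : nat -> T1 -> T2) :
  mutually_independent k X ->
  (forall i, (i < k)%N -> measurable_fun setT (g i)) ->
  mutually_independent k (fun i w => g i (X i w)).
Proof.
move=> iX mg A mA; apply: (iX (fun i => g i @^-1` A i)) => i ik.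
by rewrite -[X in measurable X]setTI; apply: mg => //; exact: mA.
Qed.

Lemma mutually_independent2 d' (T' : measurableType d') (k : nat)
    (X : nat -> T -> T') i j (A B : set T') :
  mutually_independent k X -> (i < k)%N -> (j < k)%N -> i != j ->
  measurable A -> measurable B ->
  P (X i @^-1` A `&` X j @^-1` B) = (P (X i @^-1` A) * P (X j @^-1` B))%E.
Proof.
move=> iX ik jk ij mA mB.
pose C l := if l == i then A else if l == j then B else setT.
have -> : X i @^-1` A `&` X j @^-1` B = [set w | forall l, (l < k)%N -> C l (X l w)].
  apply/seteqP; split => w /=.
    by move=> [Aw Bw] l lk; rewrite /C; case: eqP => [->//|_]; case: eqP => [->|].
  move=> h; split; first by have := h i ik; rewrite /C eqxx.
  by have := h j jk; rewrite /C eqxx eq_sym (negbTE ij).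
rewrite iX; last by move=> l _; rewrite /C; case: eqP => // _; case: eqP.
rewrite (bigD1 (Ordinal ik))//= (bigD1 (Ordinal jk))/=; last first.
  by rewrite -val_eqE/= eq_sym.
rewrite big1 ?mule1 /C ?eqxx//; first by rewrite eq_sym (negbTE ij).
move=> l; rewrite -!val_eqE/= => /andP[/negbTE -> /negbTE ->].
by rewrite preimage_setT probability_setT.
Qed.

(** Coordinate i is paired with its mirror image. On rectangles the claim is the independence of all
    2 j coordinates with the factors regrouped, and rectangles generate the product
    sigma-algebra. *)
Lemma mutually_independent_pairs d' (T' : measurableType d') (j : nat)
    (X : nat -> T -> T') :
  (forall i, (i < j + j)%N -> measurable_fun setT (X i)) ->
  mutually_independent (j + j) X ->
  mutually_independent j (fun i w => (X i w, X (j + j - i.+1)%N w)).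
Proof.
move=> mX iX.
have lt1 i : (i < j)%N -> (i < j + j)%N by move=> ij; rewrite ltn_addr.
have lt2 i : (i < j)%N -> (j + j - i.+1 < j + j)%N by lia.
have ne i : (i < j)%N -> i != (j + j - i.+1)%N by lia.
apply: (@mutually_independent_generated _ _ [set A `*` B | A in measurable & B in measurable]).
- exact: measurable_prod_measurableType.
- move=> _ _ [A1 mA1 [B1 mB1 <-]] [A2 mA2 [B2 mB2 <-]].
  by rewrite -setXI; exists (A1 `&` A2); [exact: measurableI|
     exists (B1 `&` B2) => //; exact: measurableI].
- by exists setT => //; exists setT => //; rewrite setXTT.
- by move=> i ij; apply: measurable_fun_pair; apply: mX; [exact: lt1|exact: lt2].
move=> A hA.
have /choice[B hB] : forall i, exists B : set T' * set T', (i < j)%N ->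
    [/\ measurable B.1, measurable B.2 & A i = B.1 `*` B.2].
  move=> i; case: (ltnP i j) => ij; last by exists (setT, setT).
  by have [C mC [D mD CD]] := hA i ij; exists (C, D).
pose E l := if (l < j)%N then (B l).1 else (B (j + j - l.+1)%N).2.
have E1 i : (i < j)%N -> E i = (B i).1 by rewrite /E => ->.
have E2 i : (i < j)%N -> E (j + j - i.+1)%N = (B i).2.
  move=> ij; rewrite /E ifF; last by lia.
  by congr (B _).2; lia.
have mE l : (l < j + j)%N -> measurable (E l).
  rewrite /E => lj; case: ifPn => ij; first by have [] := hB l ij.
  by have [] := hB (j + j - l.+1)%N; first by lia.
have -> : [set w | forall i, (i < j)%N -> A i (X i w, X (j + j - i.+1)%N w)] =
    [set w | forall l, (l < j + j)%N -> E l (X l w)].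
  apply/seteqP; split => w /= h l lj.
    case: (ltnP l j) => lj'.
      by rewrite E1//; have := h l lj'; have [_ _ ->] := hB l lj'; case.
    have lj2 : (j + j - l.+1 < j)%N by lia.
    have -> : l = (j + j - (j + j - l.+1).+1)%N by lia.
    by rewrite E2//; have := h _ lj2; have [_ _ ->] := hB _ lj2; case.
  have [_ _ ->] := hB l lj; split => /=.
    by rewrite -E1//; apply: h; exact: lt1.
  by rewrite -E2//; apply: h; exact: lt2.
rewrite iX// big_split_ord/= [X in (_ * X)%E](reindex_inj rev_ord_inj)/= -big_split/=.
apply: eq_bigr => i _; have [mB1 mB2 ->] := hB i (ltn_ord i).
have -> : (j + (j - i.+1) = j + j - i.+1)%N by have := ltn_ord i; lia.
rewrite E1// E2// -(mutually_independent2 iX)//; [exact: lt1|exact: lt2|exact: ne].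
Qed.

(** The hypothesis on H says that weighting P by H multiplies the law of X by c; integrating u
    against both measures gives the claim. *)
Lemma ge0_integral_indep d' (T' : measurableType d') (H : T -> R) (X : T -> T')
    (c : R) (u : T' -> \bar R) :
  measurable_fun setT H -> (forall w, 0 <= H w) -> measurable_fun setT X ->
  0 <= c ->
  (forall A, measurable A ->
    \int[P]_(w in X @^-1` A) (H w)%:E = c%:E * P (X @^-1` A))%E ->
  measurable_fun setT u -> (forall x, 0 <= u x)%E ->
  (\int[P]_w (u (X w) * (H w)%:E) = c%:E * \int[P]_w u (X w))%E.
Proof.
move=> mH H0 mX c0 HX mu_ u0.
have muX : measurable_fun setT (u \o X) by exact: measurableT_comp.
rewrite -(ge0_integral_weighted P mH H0 muX); last by move=> w; exact: u0.
transitivity (\int[image_measure (density_measure P mH H0) mX]_x u x)%E.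
  by rewrite ge0_integral_image_measure.
transitivity (\int[mscale (NngNum c0) (image_measure P mX)]_x u x)%E.
  by apply: eq_measure_integral => /= A mA _; exact: HX.
by rewrite ge0_integral_mscale// ge0_integral_image_measure.
Qed.

(** The indicators in the definition of independence are replaced by the functions [u i] one
    coordinate at a time; in [v m A] the first m are already replaced. Finiteness of the integrals
    makes the product over the other coordinates a real constant, to which [ge0_integral_indep]
    applies. *)
Lemma mutually_independent_integral_prod d' (T' : measurableType d') (k : nat)
    (X : nat -> T -> T') (u : nat -> T' -> R) :
  (forall i, (i < k)%N -> measurable_fun setT (X i)) ->
  mutually_independent k X ->
  (forall i, measurable_fun setT (u i)) -> (forall i x, 0 <= u i x) ->
  (forall i, (i < k)%N -> \int[P]_w (u i (X i w))%:E \is a fin_num)%E ->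
  (\int[P]_w (\prod_(i < k) u i (X i w))%:E =
   \prod_(i < k) \int[P]_w (u i (X i w))%:E)%E.
Proof.
move=> mX iX mu_ u0 ufin.
have PI (A : set T) : measurable A -> P A = (\int[P]_w (\1_A w)%:E)%E.
  by move=> mA; rewrite integral_indic// setIT.
pose v m (A : nat -> set T') i x : R := if (i < m)%N then u i x else \1_(A i) x.
have v0 m A i x : 0 <= v m A i x by rewrite /v; case: ifP.
have mv m (A : nat -> set T') i : ((m <= i)%N -> measurable (A i)) ->
    measurable_fun setT (v m A i).
  move=> mA; rewrite /v; case: ltnP => // mi; exact/measurable_indic/mA.
have mvX m (A : nat -> set T') i : (i < k)%N -> ((m <= i)%N -> measurable (A i)) ->
    measurable_fun setT (fun w => v m A i (X i w)).
  by move=> ik mA; apply: measurableT_comp (mX i ik); exact: mv.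
have vfin m (A : nat -> set T') i : (i < k)%N -> ((m <= i)%N -> measurable (A i)) ->
    (\int[P]_w (v m A i (X i w))%:E)%E \is a fin_num.
  rewrite /v => ik; case: ltnP => [_ _|mi mA]; first exact: ufin.
  have mXA : measurable (X i @^-1` A i).
    by rewrite -[X in measurable X]setTI; apply: mX => //; exact: mA.
  rewrite (_ : (\int[P]_w _)%E = (\int[P]_w (\1_(X i @^-1` A i) w)%:E)%E)//.
  by rewrite -PI// fin_num_measure.
suff h m : (m <= k)%N -> forall A : nat -> set T',
    (forall i, (m <= i < k)%N -> measurable (A i)) ->
    (\int[P]_w (\prod_(i < k) v m A i (X i w))%:E =
     \prod_(i < k) \int[P]_w (v m A i (X i w))%:E)%E.
  have := h k (leqnn k) (fun _ => setT).
  have e i w : (i < k)%N -> v k (fun _ => setT) i w = u i w by rewrite /v => ->.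
  move=> E; transitivity (\int[P]_w (\prod_(i < k) v k (fun=> [set: T']) i (X i w))%:E)%E.
    by apply: eq_integral => w _; congr EFin; apply: eq_bigr => i _; rewrite e.
  rewrite E//.
  apply: eq_bigr => i _; apply: eq_integral => w _; by rewrite e.
elim: m => [_ A mA|m IH mk A mA].
  have mE : measurable [set w | forall i, (i < k)%N -> A i (X i w)].
    rewrite (_ : [set w | _] = [set w | forall i, (i < k)%N -> predT i -> A i (X i w)]).
      exact: measurable_family_event.
    by apply/seteqP; split => w h i ik; [move=> _|]; exact: h.
  transitivity (P [set w | forall i, (i < k)%N -> A i (X i w)]).
    rewrite PI//; apply: eq_integral => w _; congr EFin.
    rewrite indicE; case: (boolP (w \in _)) => [|/negP].
      rewrite inE/= => h; apply: big1 => i _; rewrite /v/= indicE mem_set//.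
      exact: h.
    rewrite inE/= => /existsNP[i /not_implyP[ik nA]].
    by rewrite (bigD1 (Ordinal ik))//= /v/= indicE memNset ?mul0r.
  rewrite iX//; apply: eq_bigr => i _.
  have mXA : measurable (X i @^-1` A i).
    by rewrite -[X in measurable X]setTI; apply: mX => //; apply: mA; rewrite ltn_ord.
  by rewrite PI.
pose H w := \prod_(i < k | i != m :> nat) v m.+1 A i (X i w).
pose c := (\prod_(i < k | i != m :> nat) \int[P]_w (v m.+1 A i (X i w))%:E)%E.
have mAi i : (i < k)%N -> (m < i)%N -> measurable (A i).
  by move=> ik mi; apply: mA; rewrite mi.
have c0 : (0 <= c)%E.
  by apply: prode_ge0 => i _; apply: integral_ge0 => w _; rewrite lee_fin.
have cfin : c \is a fin_num.
  by apply: prode_fin_num => i _; apply: vfin => // mi; exact: mAi.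
have H0 w : 0 <= H w by apply: prodr_ge0.
have mH : measurable_fun setT H.
  rewrite (_ : H = fun w => \prod_(i < k) (if i != m :> nat then
      v m.+1 A i (X i w) else 1)); last first.
    by apply/funext => w; rewrite /H big_mkcond.
  apply: measurable_prod => i _; case: eqP => _ //=.
  by apply: mvX => // mi; exact: mAi.
have fc0 : 0 <= fine c by exact: fine_ge0.
have vne (B : nat -> set T') i w : i != m -> (forall l, l != m -> B l = A l) ->
    v m B i w = v m.+1 A i w.
  move=> im BA; rewrite /v ltnS [(i <= m)%N]leq_eqVlt (negbTE im)/=.
  by case: ifP => // _; rewrite BA.
have HB B : measurable B ->
    (\int[P]_(w in X m @^-1` B) (H w)%:E = (fine c)%:E * P (X m @^-1` B))%E.
  move=> mB; pose A' i := if i == m then B else A i.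
  have mA' i : (m <= i < k)%N -> measurable (A' i).
    rewrite /A'; case: eqVneq => // im /andP[mi ik].
    by apply: mA; rewrite ik andbT ltn_neqAle eq_sym im.
  have A'A l : l != m -> A' l = A l by rewrite /A' => /negbTE ->.
  have := IH (ltnW mk) A' mA'.
  rewrite (bigD1 (Ordinal mk))//= [X in (X * _)%E](_ : _ = P (X m @^-1` B)); last first.
    rewrite /v ltnn /A' eqxx PI//.
    by rewrite -[X in measurable X]setTI; exact: mX.
  rewrite [X in (_ * X)%E](_ : _ = c); last first.
    apply: eq_bigr => i; rewrite -val_eqE/= => im.
    by apply: eq_integral => w _; rewrite vne.
  rewrite fineK// muleC => <-; rewrite [LHS]integral_mkcond.
  apply: eq_integral => w _; rewrite patchE (bigD1 (Ordinal mk))//=.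
  rewrite {1}/v ltnn {1}/A' eqxx indicE.
  have -> : (w \in X m @^-1` B) = (X m w \in B) by apply/idP/idP; rewrite !inE.
  case: ifPn => _; last by rewrite mul0r.
  rewrite -[true%:R]/(1 : R) mul1r; congr EFin; rewrite /H.
  by apply: eq_big => [i|i im]; [rewrite -val_eqE|rewrite vne].
have mum : measurable_fun setT (fun x => (u m x)%:E) by exact/measurable_EFinP.
have := ge0_integral_indep mH H0 (mX m mk) fc0 HB mum.
rewrite fineK// => E.
rewrite [RHS](bigD1 (Ordinal mk))//= [X in (_ * X)%E](_ : _ = c); last first.
  by apply: eq_bigl => i; rewrite -val_eqE.
rewrite [X in (X * _)%E](_ : _ = (\int[P]_w (u m (X m w))%:E)%E); last first.
  by apply: eq_integral => w _; rewrite /v ltnS leqnn.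
rewrite muleC -E//; last by move=> x; rewrite lee_fin.
apply: eq_integral => w _; rewrite (bigD1 (Ordinal mk))//= {1}/v ltnS leqnn.
by rewrite -EFinM; congr (_ * _)%:E; apply: eq_bigl => i; rewrite -val_eqE.
Qed.

Notation gauss := (@normal_prob R 0 1).

Lemma normal_law_normr (X : T -> R) m s : normal_law P X m s ->
  normal_law P X m `|s|.
Proof.
move=> nX; have [s0|s0] := leP 0 s; first by rewrite ger0_norm.
move=> A mA; rewrite nX// ltr0_norm//.
have mf : measurable_fun setT (fun x : R => m + s * x).
  by apply: measurable_funD => //; exact: measurable_funM.
rewrite -[LHS]gauss_opp; last by rewrite -[X in measurable X]setTI; exact: mf.
by congr normal_prob; apply/seteqP; split => x /=; rewrite mulrN mulNr.
Qed.

(** The event C will constrain the remaining variables of a family. Keeping it in the statement lets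
    [normal_law_sum] carry the independence of a partial sum from the later variables through its
    induction. *)
Lemma normal_law_sum_on (X Y : T -> R) (C : set T) (m1 s1 m2 s2 : R) :
  measurable_fun setT X -> measurable_fun setT Y -> measurable C ->
  0 <= s1 -> 0 <= s2 ->
  (forall A B : set R, measurable A -> measurable B ->
    P (X @^-1` A `&` Y @^-1` B `&` C) =
    (gauss ((fun x => (m1 + s1 * x)%R) @^-1` A) *
     gauss ((fun x => (m2 + s2 * x)%R) @^-1` B) * P C)%E) ->
  forall A, measurable A ->
    P ((fun w => X w + Y w) @^-1` A `&` C) =
    (gauss ((fun x => (m1 + m2 + Num.sqrt (s1 ^+ 2 + s2 ^+ 2) * x)%R) @^-1` A) * P C)%E.
Proof.
move=> mX mY mC s10 s20 hXY A mA.
have maff (m s : R) : measurable_fun setT (fun x : R => m + s * x).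
  by apply: measurable_funD => //; exact: measurable_funM.
have PC0 : 0 <= fine (P C) by exact: fine_ge0.
have PCfin : P C \is a fin_num by exact: fin_num_measure.
have mXY : measurable_fun setT (fun w => (X w, Y w)) by exact: measurable_fun_pair.
pose fg (x : R * R) := (m1 + s1 * x.1, m2 + s2 * x.2).
have mfg : measurable_fun setT fg.
  apply: measurable_fun_pair.
    exact: measurableT_comp (maff m1 s1) measurable_fst.
  exact: measurableT_comp (maff m2 s2) measurable_snd.
pose mu1 := image_measure (mrestr P mC) mXY.
pose mu2 : {measure set (R * R) -> \bar R} :=
  mscale (NngNum PC0) (image_measure (gauss \x gauss)%E mfg).
have mu12 S : measurable S -> mu1 S = mu2 S.
  apply: measure_unique_rectangle => [|A' B' mA' mB'].
    apply: (@le_lt_trans _ _ 1%E); last exact: ltry.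
    by apply: probability_le1; rewrite preimage_setT setTI.
  rewrite -[LHS]/(P (X @^-1` A' `&` Y @^-1` B' `&` C)) hXY//.
  rewrite -[RHS]/((fine (P C))%:E * (gauss \x gauss)%E (fg @^-1` (A' `*` B')))%E.
  rewrite fineK// muleC; congr (_ * _)%E; apply/esym.
  apply: (product_measure1E gauss gauss (A1 := (fun x => m1 + s1 * x) @^-1` A')
    (A2 := (fun x => m2 + s2 * x) @^-1` B')).
    by rewrite -[X in measurable X]setTI; exact: maff.
  by rewrite -[X in measurable X]setTI; exact: maff.
pose S := [set xy : R * R | A (xy.1 + xy.2)].
have mS : measurable S.
  by rewrite -[X in measurable X]setTI; exact: measurable_funD.
have := mu12 S mS.
rewrite -[X in X = _ -> _]/(P ((fun w => X w + Y w) @^-1` A `&` C)) => ->.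
rewrite -[LHS]/((fine (P C))%:E * (gauss \x gauss)%E (fg @^-1` S))%E fineK// muleC.
congr (_ * _)%E.
have mB : measurable [set z : R | A (m1 + m2 + z)].
  rewrite -[X in measurable X]setTI.
  exact: (@measurable_funD _ _ R setT (cst (m1 + m2)) id).
rewrite [RHS](_ : _ = gauss [set x | [set z : R | A (m1 + m2 + z)]
  (Num.sqrt (s1 ^+ 2 + s2 ^+ 2) * x)])//.
have -> : fg @^-1` S =
    [set xy : R * R | [set z : R | A (m1 + m2 + z)] (s1 * xy.1 + s2 * xy.2)].
  by apply/seteqP; split => -[x y]; rewrite /S/= addrACA.
exact: gauss_convolution.
Qed.

Lemma normal_law_sum (k : nat) (X : nat -> T -> R) (m s : nat -> R) :
  (forall i, (i < k)%N -> measurable_fun setT (X i)) ->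
  mutually_independent k X ->
  (forall i, (i < k)%N -> normal_law P (X i) (m i) (s i)) ->
  normal_law P (fun w => \sum_(i < k) X i w) (\sum_(i < k) m i)
    (Num.sqrt (\sum_(i < k) s i ^+ 2)).
Proof.
move=> mX iX nX.
pose C j (A : nat -> set R) := [set w | forall i, (i < k)%N -> (j <= i)%N -> A i (X i w)].
have mC j A : (forall i, (i < k)%N -> measurable (A i)) -> measurable (C j A).
  by move=> mA; exact: (measurable_family_event (leq j)).
have PC j A : (forall i, (i < k)%N -> measurable (A i)) ->
    (P (C j A) = \prod_(i < k) (if (j <= i)%N then P (X i @^-1` A i) else 1))%E.
  move=> mA; pose A' i := if (j <= i)%N then A i else setT.
  have -> : C j A = [set w | forall i, (i < k)%N -> A' i (X i w)].
    apply/seteqP; split => w h i ik; last by move=> ji; have := h i ik; rewrite /A' ji.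
    by rewrite /A'; case: ifPn => // ji; exact: h.
  rewrite iX; last by move=> i ik; rewrite /A'; case: ifPn => // _; exact: mA.
  apply: eq_bigr => i _; rewrite /A'; case: ifPn => // _.
  by rewrite preimage_setT probability_setT.
(* The strengthened claim: the sum of the first j variables is normal and independent of the events
   [C j A] about the other ones. *)
suff h j : (j <= k)%N -> forall A, (forall i, (i < k)%N -> measurable (A i)) ->
    forall B : set R, measurable B ->
    P ((fun w => \sum_(i < j) X i w) @^-1` B `&` C j A) =
    (gauss ((fun x => (\sum_(i < j) m i + Num.sqrt (\sum_(i < j) s i ^+ 2) * x)%R) @^-1` B) *
     P (C j A))%E.
  move=> B mB; have := h k (leqnn k) (fun _ => setT) (fun _ _ => measurableT) B mB.
  have -> : C k (fun _ => setT) = setT by apply/seteqP; split.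
  by rewrite setIT probability_setT mule1.
elim: j => [_ A mA B mB|j IH jk A mA B mB].
  rewrite !big_ord0 sqrtr0.
  have [B0|B0] := pselect (B 0).
    have e1 : (fun w : T => \sum_(i < 0) X i w) @^-1` B = setT.
      by apply/seteqP; split => w //= _; rewrite big_ord0.
    have e2 : (fun x : R => 0 + 0 * x) @^-1` B = setT.
      by apply/seteqP; split => w //= _; rewrite mul0r addr0.
    rewrite e1 e2 setTI; rewrite [X in (X * _)%E](_ : _ = 1%E) ?mul1e//.
    exact: integral_normal_pdf.
  have e1 : (fun w : T => \sum_(i < 0) X i w) @^-1` B = set0.
    by apply/seteqP; split => w //=; rewrite big_ord0.
  have e2 : (fun x : R => 0 + 0 * x) @^-1` B = set0.
    by apply/seteqP; split => w //=; rewrite mul0r addr0.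
  by rewrite e1 e2 set0I !measure0 mul0e.
have mS i : (i <= k)%N -> measurable_fun setT (fun w => \sum_(l < i) X l w).
  move=> ik; apply: measurable_sum => l; apply: mX.
  exact: leq_trans (ltn_ord l) ik.
have s2 : 0 <= \sum_(i < j) s i ^+ 2 by apply: sumr_ge0 => i _; exact: sqr_ge0.
have := @normal_law_sum_on (fun w => \sum_(i < j) X i w) (X j) (C j.+1 A)
  (\sum_(i < j) m i) (Num.sqrt (\sum_(i < j) s i ^+ 2)) (m j) `|s j|
  (mS j (ltnW jk)) (mX j jk) (mC _ _ mA) (sqrtr_ge0 _) (normr_ge0 _).
rewrite sqr_sqrtr// real_normK ?num_real//.
have -> : \sum_(i < j.+1) m i = \sum_(i < j) m i + m j by rewrite big_ord_recr.
have -> : \sum_(i < j.+1) s i ^+ 2 = \sum_(i < j) s i ^+ 2 + s j ^+ 2.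
  by rewrite big_ord_recr.
move=> h; have -> : (fun w => \sum_(i < j.+1) X i w) = (fun w => \sum_(i < j) X i w + X j w).
  by apply/funext => w; rewrite big_ord_recr.
apply: h => // A' B' mA' mB'.
pose D i := if i == j then B' else A i.
have mD i : (i < k)%N -> measurable (D i).
  by rewrite /D; case: eqP => // _; exact: mA.
have CD : X j @^-1` B' `&` C j.+1 A = C j D.
  apply/seteqP; split => w /=.
    move=> [Bw Cw] i ik; rewrite leq_eqVlt => /predU1P[<-|ji]; rewrite /D ?eqxx//.
    by rewrite gtn_eqF//; exact: Cw.
  move=> h'; split; first by have := h' j jk (leqnn _); rewrite /D eqxx.
  by move=> i ik ji; have := h' i ik (ltnW ji); rewrite /D gtn_eqF.
have PD : P (C j D) = (P (X j @^-1` B') * P (C j.+1 A))%E.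
  rewrite !PC// [LHS](bigD1 (Ordinal jk))//= leqnn {1}/D eqxx; congr (_ * _)%E.
  rewrite [RHS](bigD1 (Ordinal jk))//= ltnn mul1e.
  apply: eq_bigr => i; rewrite -val_eqE/= => ij.
  by rewrite /D (negbTE ij) leq_eqVlt eq_sym (negbTE ij).
rewrite -setIA CD -muleA; apply: (eq_trans (IH (ltnW jk) _ mD _ mA')).
congr (_ * _)%E; apply: (eq_trans PD); congr (_ * _)%E.
exact: (normal_law_normr (nX j jk)).
Qed.

End independence.

(** * Shifting the drift of the white noise *)

(** Under the weighted measure S is normal with mean s^2, so the event s^2 - x s <= S has weighted
    probability Phi x and plain probability Phi (x - s). Any other candidate E trades points where
    the density is at least k for points where it is at most k, and can only be more probable. *)
Lemma neyman_pearson d (T : measurableType d) (R : realType)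
    (P : probability T R) (S : T -> R) (s x : R) (E : set T) :
  measurable_fun setT S -> 0 <= s -> normal_law P S 0 s -> measurable E ->
  ((Phi x)%:E <= \int[P]_(w in E) (expR (S w - s ^+ 2 / 2))%:E)%E ->
  ((Phi (x - s))%:E <= P E)%E.
Proof.
move=> mS; rewrite le_eqVlt => /predU1P[<-|s0] nS mE.
  (* For s = 0 the variable S vanishes almost surely, so the density is 1. *)
  rewrite subr0 => /le_trans; apply.
  have -> : P E = (\int[P]_(w in E) (cst 1 w))%E by rewrite integral_cst// mul1e.
  apply: ae_ge0_le_integral => //.
    apply/measurable_funTS/measurable_EFinP; apply: measurableT_comp => //.
    exact: measurable_funB.
  exists (S @^-1` (~` [set 0])); split.
  - rewrite -[X in measurable X]setTI; apply: mS => //; exact: measurableC.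
  - apply: (eq_trans (nS _ _)); first exact: measurableC.
    rewrite (_ : _ @^-1` _ = set0) ?measure0//.
    by apply/seteqP; split => y //=; rewrite mul0r addr0.
  - move=> w /= h Sw; apply: h => _; rewrite Sw expr0n/= mul0r subr0 expR0.
    exact: lexx.
move=> QE; pose s0' := s ^+ 2 - x * s; pose k := expR (s0' - s ^+ 2 / 2).
pose N := [set w | s0' <= S w].
pose Q (A : set T) := (\int[P]_(w in A) (expR (S w - s ^+ 2 / 2))%:E)%E.
have mN : measurable N.
  rewrite (_ : N = S @^-1` `[s0', +oo[); last first.
    by apply/seteqP; split => w; rewrite /= in_itv/= andbT.
  by rewrite -[X in measurable X]setTI; exact: mS.
have mZ : measurable_fun setT (fun w => (expR (S w - s ^+ 2 / 2))%:E).
  apply/measurable_EFinP; apply: measurableT_comp => //; exact: measurable_funB.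
have Z0 w : (0 <= (expR (S w - s ^+ 2 / 2))%:E)%E by rewrite lee_fin expR_ge0.
have PN : P N = (Phi (x - s))%:E.
  rewrite (normal_law_ge _ s0 nS) /s0'; congr (Phi _)%:E.
  by rewrite sub0r opprB mulrBl mulfK ?gt_eqF// expr2 mulfK ?gt_eqF.
have QN : Q N = (Phi x)%:E.
  pose u (y : R) := (\1_`[s0', +oo[ y * expR (y - s ^+ 2 / 2))%:E.
  have mu_ : measurable_fun setT u.
    apply/measurable_EFinP; apply: measurable_funM; first exact: measurable_indic.
    by apply: measurableT_comp => //; exact: measurable_funB.
  have u0 y : (0 <= u y)%E by rewrite lee_fin mulr_ge0// expR_ge0.
  transitivity (\int[P]_w u (S w))%E.
    rewrite /Q [LHS]integral_mkcond; apply: eq_integral => w _.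
    rewrite patchE /u indicE.
    have -> : (w \in N) = (S w \in `[s0', +oo[%classic).
      by apply/idP/idP; rewrite !inE/= in_itv/= andbT.
    by case: ifPn => _; rewrite ?mul1r ?mul0r.
  rewrite (ge0_integral_normal_law mS nS mu_ u0).
  pose v (y : R) := (\1_`[s0', +oo[ (s * y))%:E : \bar R.
  have mv : measurable_fun setT v.
    apply/measurable_EFinP.
    apply: (@measurableT_comp _ _ _ _ _ _ (\1_`[s0', +oo[ : R -> R)).
      exact: measurable_indic.
    exact: measurable_funM.
  transitivity (\int[normal_prob 0 1]_y (v y * (expR (s * y - s ^+ 2 / 2))%:E))%E.
    by apply: eq_integral => y _; rewrite /u add0r EFinM.
  rewrite ge0_integral_gauss_shift//; last by move=> y; rewrite lee_fin.
  transitivity (\int[normal_prob 0 1]_y (\1_`[- x, +oo[ y)%:E)%E.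
    apply: eq_integral => y _; rewrite /v !indicE.
    have -> : (s * (y + s) \in `[s0', +oo[%classic) = (y \in `[- x, +oo[%classic).
      have e : (s0' <= s * (y + s)) = (- x <= y).
        by rewrite /s0' mulrDr -expr2 addrC lerD2r mulrC -mulrN ler_pM2l.
      by apply/idP/idP; rewrite !inE/= !in_itv/= !andbT e.
    by [].
  rewrite integral_indic// setIT; apply: (eq_trans (gauss_itvcy _)).
  by rewrite opprK.
have PD A : measurable A -> A `<=` ~` N -> (Q A <= k%:E * P A)%E.
  move=> mA AN; rewrite -integral_cst//; apply: ge0_le_integral => //.
  - exact: measurable_funTS.
  - move=> w /AN; rewrite /N/= lee_fin ler_expR lerD2r => /negP.
    by rewrite -ltNge => /ltW.
have PD' A : measurable A -> A `<=` N -> (k%:E * P A <= Q A)%E.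
  move=> mA AN; rewrite -integral_cst//; apply: ge0_le_integral => //.
  - by move=> w _; rewrite lee_fin expR_ge0.
  - exact: measurable_funTS.
  - by move=> w /AN; rewrite /N/= lee_fin ler_expR lerD2r.
have QU A B : measurable A -> measurable B -> (Q A = Q (A `&` B) + Q (A `\` B))%E.
  move=> mA mB; rewrite /Q -ge0_integral_setU//.
  - by rewrite setUIDK.
  - exact: measurableI.
  - exact: measurableD.
  - by rewrite setUIDK; exact: measurable_funTS.
  - by rewrite disj_set2E; apply/eqP; apply/seteqP; split => // y [[_ ?] []].
have PU A B : measurable A -> measurable B -> (P A = P (A `&` B) + P (A `\` B))%E.
  move=> mA mB; rewrite -measureU ?setUIDK//; first exact: measurableI.
    exact: measurableD.
  by apply/seteqP; split => // y [[_ ?] []].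
have Qfin : Q (E `&` N) \is a fin_num.
  rewrite ge0_fin_numE; last by apply: integral_ge0.
  apply: (@le_lt_trans _ _ (Q N)); last by rewrite QN ltry.
  by apply: ge0_subset_integral => //; [exact: measurableI|exact: measurable_funTS].
have k0 : 0 < k by exact: expR_gt0.
have QD : (Q (N `\` E) <= Q (E `\` N))%E.
  move: QE; rewrite -QN -/(Q E) (QU E N)// (QU N E)// [N `&` E]setIC.
  by rewrite leeD2lE.
have : (P (N `\` E) <= P (E `\` N))%E.
  rewrite -(@lee_pmul2l _ k%:E)// ?fin_num_measure//.
  apply: le_trans (PD' _ _ _) _ => //; first exact: measurableD.
  apply: le_trans QD _; apply: PD; first exact: measurableD.
  by move=> w [].
by rewrite -PN (PU E N)// (PU N E)// [N `&` E]setIC leeD2lE// fin_num_measure//;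
  exact: measurableI.
Qed.

Lemma eq_measure_off_negligible d (T : measurableType d) (R : realType)
    (mu : {measure set T -> \bar R}) (N A B : set T) :
  mu.-negligible N -> measurable A -> measurable B ->
  A `&` ~` N = B `&` ~` N -> mu A = mu B.
Proof.
move=> [N' [mN' N'0 NN']] mA mB AB.
have AB' : A `&` ~` N' = B `&` ~` N'.
  have NN : ~` N' = ~` N `&` ~` N'.
    by apply/esym/setIidPr => w h /NN'.
  by rewrite NN !setIA AB.
have E C : measurable C -> mu C = mu (C `&` ~` N').
  move=> mC; rewrite -setDE (measureDI mu mC mN') [X in (_ + X)%E](_ : _ = 0)%E ?adde0//.
  apply/eqP; rewrite eq_le measure_ge0 andbT -N'0; apply: le_measure => //.
  - by rewrite inE; exact: measurableI.
  - by rewrite inE.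
by rewrite (E A)// (E B)// AB'.
Qed.

(** * Approximation of events by an algebra of sets *)

Section algebra_approximation.
Context d (T : measurableType d) (R : realType).
Variable m : {measure set T -> \bar R}.
Hypothesis mfin : (m setT < +oo)%E.
Variable G : set (set T).
Hypotheses (Gm : G `<=` measurable) (G0 : G set0).
Hypotheses (GC : forall E, G E -> G (~` E)).
Hypotheses (GU : forall E F, G E -> G F -> G (E `|` F)).

Let symdiff (A E : set T) := (A `\` E) `|` (E `\` A).

Let measurable_symdiff A E : measurable A -> measurable E -> measurable (symdiff A E).
Proof. by move=> mA mE; apply: measurableU; exact: measurableD. Qed.

(** The sets that can be approximated form a sigma-algebra containing G. For a countable union, half
    of the error cuts it down to N sets and the other half is shared among the approximations of
    these. *)
Lemma algebra_approximation (A : set T) : <<s G >> A -> forall e : R, 0 < e ->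
  exists2 E, G E & (m ((A `\` E) `|` (E `\` A)) <= e%:E)%E.
Proof.
pose L := [set A | measurable A /\ forall e : R, 0 < e ->
  exists2 E, G E & (m (symdiff A E) <= e%:E)%E].
suff : <<s G >> `<=` L by move=> h /h [].
have mlt B : measurable B -> (m B < +oo)%E.
  by move=> mB; apply: le_lt_trans mfin; apply: le_measure; rewrite ?inE.
apply: smallest_sub; last first.
  move=> E GE; split => [|e e0]; first exact: Gm.
  by exists E => //; rewrite /symdiff setDv setUid measure0 lee_fin ltW.
split.
- split => // e e0; exists set0 => //.
  by rewrite /symdiff setDv setUid measure0 lee_fin ltW.
- move=> A' [mA' hA']; split => [|e e0]; first exact: measurableD.
  have [E GE mE] := hA' e e0; exists (~` E); first exact: GC.
  rewrite (_ : symdiff _ _ = symdiff A' E)//.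
  apply/seteqP; split => x; rewrite /symdiff /=;
  by have [?|?] := pselect (A' x); have [?|?] := pselect (E x); tauto.
- move=> F LF; have mF i : measurable (F i) by have [] := LF i.
  have mU : measurable (\bigcup_i F i) by exact: bigcupT_measurable.
  split=> // e e0; pose U N := \bigcup_(i < N) F i.
  have mUN N : measurable (U N) by apply: bigcup_measurable => i _.
  have [N hN] : exists N, (m ((\bigcup_i F i) `\` U N) <= (e / 2)%:E)%E.
    have cv : m ((\bigcup_i F i) `\` U N) @[N --> \oo] --> (0 : \bar R)%E.
      rewrite -(measure0 m) (_ : set0 = \bigcap_N ((\bigcup_i F i) `\` U N)); last first.
        apply/esym/seteqP; split => // x h; have [[i _ Fix] _] := h 0%N I.
        by have [_] := h i.+1 I; apply; exists i => //=.
      apply: nonincreasing_cvg_mu => //.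
      - by apply: mlt; exact: measurableD.
      - by move=> N; exact: measurableD.
      - by apply: bigcapT_measurable => N; exact: measurableD.
      - move=> N N' NN'; apply/subsetPset; apply: setDS => x [i /= iN Fi].
        by exists i => //=; exact: leq_trans NN'.
    have e20 : 0 < e / 2 by rewrite divr_gt0.
    have /fine_cvgP[_ /cvgr_lt h] := cv.
    have [N _ /(_ N (leqnn N)) hN] := h (e / 2) e20.
    exists N; rewrite -[leLHS]fineK ?lee_fin ?ltW//.
    by rewrite ge0_fin_numE// mlt//; exact: measurableD.
  (* The successor keeps the divisor positive when N = 0. *)
  pose del := e / 2 / N.+1%:R.
  have del0 : 0 < del by rewrite !divr_gt0.
  have /choice[E hE] : forall i, exists E, G E /\ (m (symdiff (F i) E) <= del%:E)%E.
    by move=> i; have [_ /(_ _ del0)[E]] := LF i; exists E.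
  have mE i : measurable (E i) by apply: Gm; have [] := hE i.
  pose V n := \bigcup_(i < n) E i.
  have GV n : G (V n).
    elim: n => [|n IH]; first by rewrite /V bigcup_mkord big_ord0.
    rewrite /V bigcup_mkord big_ord_recr/= -bigcup_mkord; apply: GU => //.
    by have [] := hE n.
  have mS n : measurable (\bigcup_(i < n) symdiff (F i) (E i)).
    by apply: bigcup_measurable => i _; exact: measurable_symdiff.
  exists (V N) => //.
  apply: (@le_trans _ _ (m (((\bigcup_i F i) `\` U N) `|`
      \bigcup_(i < N) symdiff (F i) (E i)))).
    apply: le_measure; rewrite ?inE.
    - by apply: measurable_symdiff => //; exact: Gm.
    - by apply: measurableU => //; exact: measurableD.
    move=> x [[[i _ Fi] nV]|[[i iN Ei] nF]].
      have [UNx|UNx] := pselect (U N x); last by left; split => //; exists i.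
      right; have [k kN Fk] := UNx; exists k => //; left; split => // Ek.
      by apply: nV; exists k.
    right; exists i => //; right; split => // Fi.
    by apply: nF; exists i.
  apply: (le_trans (measureU2 _ _ _)) => //; first exact: measurableD.
  rewrite (_ : e%:E = (e / 2)%:E + (e / 2)%:E)%E; last by rewrite -EFinD; congr EFin; lra.
  apply: leeD => //; rewrite bigcup_mkord.
  apply: (le_trans (@Boole_inequality _ _ _ m (fun i => symdiff (F i) (E i)) N _)).
    by move=> i _; exact: measurable_symdiff.
  apply: (@le_trans _ _ (\sum_(i < N) del%:E)%E).
    by apply: lee_sum => i _; have [] := hE i.
  rewrite sumEFin lee_fin sumr_const card_ord -(mulr_natr del).
  rewrite /del -mulrA ler_piMr ?divr_ge0 ?(ltW e0)//.
  by rewrite mulrC ler_pdivrMr// mul1r ler_nat.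
Qed.

End algebra_approximation.

(** * Change of measure on finite grids, then for events on whole paths *)

Section gaussian_shift.
Context d (T : measurableType d) (R : realType) (P : probability T R).
Variable W : R -> T -> R.
Notation a := (- 2^-1 : R).
Notation b := (2^-1 : R).
Hypothesis BW : brownian_motion P a b W.

Lemma brownian_motion_measurable t : t \in `[a, b] -> measurable_fun setT (W t).
Proof. by have [mW _ _ _ _] := BW; exact: mW. Qed.

Lemma brownian_increment_law s t : a <= s -> s < t -> t <= b ->
  normal_law P (fun w => W t w - W s w) 0 (Num.sqrt (t - s)).
Proof.
move=> as_ st tb A mA; have [_ _ _ lW _] := BW.
apply: (eq_trans (lW s t as_ st tb A mA)).
rewrite normal_prob_gauss ?sqrtr_gt0 ?subr_gt0//.
by congr normal_prob; apply/seteqP; split => x /=; rewrite add0r.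
Qed.

Lemma brownian_increments_independent (k : nat) (t : nat -> R) :
  (forall i, (i <= k)%N -> t i \in `[a, b]) ->
  (forall i, (i < k)%N -> t i <= t i.+1) ->
  mutually_independent P k (fun i w => W (t i.+1) w - W (t i) w).
Proof. by have [_ _ _ _ iW] := BW => tab nt A mA; exact: iW. Qed.

Lemma measurable_brownian_increment s t : s \in `[a, b] -> t \in `[a, b] ->
  measurable_fun setT (fun w => W t w - W s w).
Proof.
by move=> sab tab; apply: measurable_funB; exact: brownian_motion_measurable.
Qed.

Variable n : R.
Hypothesis n0 : 0 < n.

(** The signal enters through its primitive F, here any function. For F equal to [primitive f] this
    is convertible to [white_noise W n f]. *)
Definition signal_plus_noise (F : R -> R) (w : T) : observation R :=
  fun t => F t + (Num.sqrt n)^-1 * W t w.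

Lemma measurable_signal_plus_noise F : measurable_fun setT (signal_plus_noise F).
Proof.
apply: (@measurability _ _ _ (observation R) _ _ (@evaluation_events R)) => // _ [_ [t [B [tab mB ->]]] <-].
rewrite setTI.
rewrite -[X in measurable X]setTI.
apply: (measurable_funD (f := fun _ => F t) (g := fun w => (Num.sqrt n)^-1 * W t w)) => //.
by apply: measurable_funM => //; exact: brownian_motion_measurable.
Qed.

Lemma measurable_evaluation t : t \in `[a, b] ->
  measurable_fun setT (fun y : observation R => y t).
Proof.
move=> tab _ B mB; rewrite setTI; apply: sub_sigma_algebra.
by exists t, B; split.
Qed.

Section grid.
Variables (k : nat) (t : nat -> R).
Hypotheses (t0 : t 0%N = a) (tab : forall i, (i <= k)%N -> t i \in `[a, b]).
Hypothesis tlt : forall i, (i < k)%N -> t i < t i.+1.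

(** A pi-system on which independence of the increments gives a product formula. The starting value
    is included so that the values at all grid points can be recovered. *)
Definition grid_events : set (set (observation R)) :=
  [set E | exists (B : set R) (A : nat -> set R),
    [/\ measurable B, forall i, measurable (A i) &
        E = [set y | B (y (t 0%N)) /\
               forall i, (i < k)%N -> A i (y (t i.+1) - y (t i))]]].

Lemma grid_events_setI : setI_closed grid_events.
Proof.
move=> _ _ [B [A [mB mA ->]]] [B' [A' [mB' mA' ->]]].
exists (B `&` B'), (fun i => A i `&` A' i); split; first exact: measurableI.
  by move=> i; exact: measurableI.
apply/seteqP; split => y /=.
  by move=> [[By Ay] [B'y A'y]]; split => // i ik; split; [exact: Ay|exact: A'y].
move=> [[By B'y] h]; split; split => // i ik; by have [] := h i ik.
Qed.

Lemma grid_eventsT : grid_events setT.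
Proof.
exists setT, (fun _ => setT); split => //.
by apply/esym/seteqP; split.
Qed.

Lemma grid_events_measurable : grid_events `<=` measurable.
Proof.
move=> _ [B [A [mB mA ->]]].
have tab0 : t 0%N \in `[a, b] by exact: tab.
rewrite (_ : [set y | _] = ((fun y : observation R => y (t 0%N)) @^-1` B) `&`
    \bigcap_(i in `I_k) ((fun y : observation R => y (t i.+1) - y (t i)) @^-1` A i)).
  apply: measurableI.
    by rewrite -[X in measurable X]setTI; exact: measurable_evaluation.
  apply: bigcap_measurableType => i /= ik; rewrite -[X in measurable X]setTI.
  apply: measurable_funB => //; apply: measurable_evaluation; apply: tab => //.
  exact: ltnW.
by apply/seteqP; split.
Qed.

Let dt i := t i.+1 - t i.

Let dt_gt0 i : (i < k)%N -> 0 < dt i.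
Proof. by move=> ik; rewrite subr_gt0 tlt. Qed.

Let increment_law i : (i < k)%N ->
  normal_law P (fun w => W (t i.+1) w - W (t i) w) 0 (Num.sqrt (dt i)).
Proof.
move=> ik; apply: brownian_increment_law; last 1 first.
- by have := tab ik; rewrite in_itv/= => /andP[].
- by have := tab (ltnW ik); rewrite in_itv/= => /andP[].
- exact: tlt.
Qed.

Let measurable_increment i : (i < k)%N ->
  measurable_fun setT (fun w => W (t i.+1) w - W (t i) w).
Proof.
by move=> ik; apply: measurable_brownian_increment; [exact/tab/ltnW|exact: tab].
Qed.

Let increments_independent :
  mutually_independent P k (fun i w => W (t i.+1) w - W (t i) w).
Proof.
by apply: brownian_increments_independent => // i ik; exact/ltW/tlt.
Qed.

Hypothesis W0 : forall w, W a w = 0.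
Variables F G : R -> R.
Hypothesis FGa : F a = G a.

Let dF i := F (t i.+1) - F (t i).
Let dG i := G (t i.+1) - G (t i).
(** Tilting a Gaussian increment of variance [dt i] with slope [c i] shifts its mean by
    [c i * dt i], that is by sqrt n * (dG i - dF i). After division by sqrt n this moves the
    increment of the signal from [dF i] to [dG i]. *)
Let c i : R := Num.sqrt n * ((dG i - dF i) / dt i).

Let score i (x : R) : R := expR (c i * x - (c i * Num.sqrt (dt i)) ^+ 2 / 2).

Let measurable_score i : measurable_fun setT (score i).
Proof.
by apply: measurableT_comp => //; apply: measurable_funB => //; exact: measurable_funM.
Qed.

(* One-dimensional Cameron-Martin formula on the i-th cell of the grid. *)
Let integral_score i (A : set R) : (i < k)%N -> measurable A ->
  (\int[P]_w (\1_A (dF i + (Num.sqrt n)^-1 * (W (t i.+1) w - W (t i) w)) *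
     score i (W (t i.+1) w - W (t i) w))%:E =
   P [set w | A (dG i + (Num.sqrt n)^-1 * (W (t i.+1) w - W (t i) w))%R])%E.
Proof.
move=> ik mA; set X := fun w => W (t i.+1) w - W (t i) w.
have dti := dt_gt0 ik; set s := Num.sqrt (dt i).
have sn0 : Num.sqrt n != 0 by rewrite gt_eqF// sqrtr_gt0.
have mAf (m : R) : measurable [set x : R | A (m + (Num.sqrt n)^-1 * x)].
  rewrite -[X in measurable X]setTI.
  apply: (measurable_funD (f := cst m) (g := fun x => (Num.sqrt n)^-1 * x)) => //.
  exact: measurable_funM.
have m1 : measurable_fun setT (fun x : R => \1_A (dF i + (Num.sqrt n)^-1 * x) : R).
  apply: (@measurableT_comp _ _ _ _ _ _ (\1_A : R -> R)); first exact: measurable_indic.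
  by apply: measurable_funD => //; exact: measurable_funM.
pose u x := (\1_A (dF i + (Num.sqrt n)^-1 * x) * score i x)%:E.
have mu_ : measurable_fun setT u by apply/measurable_EFinP; exact: measurable_funM.
have u0 x : (0 <= u x)%E by rewrite lee_fin mulr_ge0// expR_ge0.
rewrite (ge0_integral_normal_law (measurable_increment ik) (increment_law ik) mu_ u0).
pose v x := (\1_A (dF i + (Num.sqrt n)^-1 * (s * x)))%:E : \bar R.
have mv : measurable_fun setT v.
  apply/measurable_EFinP.
  apply: (@measurableT_comp _ _ _ _ _ _ (\1_A : R -> R)); first exact: measurable_indic.
  apply: measurable_funD => //; apply: measurable_funM => //; exact: measurable_funM.
transitivity (\int[normal_prob 0 1]_x (v x * (expR ((c i * s) * x - (c i * s) ^+ 2 / 2))%:E))%E.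
  by apply: eq_integral => x _; rewrite /u /v /score add0r EFinM mulrA.
rewrite ge0_integral_gauss_shift//; last by move=> x; rewrite lee_fin.
have := increment_law ik (mAf (dG i)).
rewrite -[X in X = _ -> _]/(P [set w | A (dG i + (Num.sqrt n)^-1 * (W (t i.+1) w - W (t i) w))]).
move=> ->.
pose B := [set x : R | A (dG i + (Num.sqrt n)^-1 * (0 + s * x))].
have mB : measurable B.
  rewrite (_ : B = (fun x => s * x) @^-1` [set x : R | A (dG i + (Num.sqrt n)^-1 * x)]).
    by rewrite -[X in measurable X]setTI; apply: measurable_funM.
  by apply/seteqP; split => x; rewrite /B/= add0r.
rewrite -[RHS]/(normal_prob 0 1 B).
transitivity (\int[normal_prob 0 1]_x (\1_B x)%:E)%E; last by rewrite integral_indic// setIT.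
apply: eq_integral => x _; rewrite /v; congr EFin; rewrite !indicE.
suff e : dF i + (Num.sqrt n)^-1 * (s * (x + c i * s)) =
    dG i + (Num.sqrt n)^-1 * (0 + s * x).
  by rewrite e; congr (_%:R); apply/idP/idP; rewrite !inE.
rewrite add0r mulrDr mulrDr.
have -> : (Num.sqrt n)^-1 * (s * (c i * s)) = dG i - dF i.
  have ss : s * s = dt i by rewrite -expr2 sqr_sqrtr ?(ltW dti).
  rewrite [s * _]mulrC -[c i * s * s]mulrA ss /c mulrA mulrA mulVf// mul1r divfK//.
  by rewrite gt_eqF.
by lra.
Qed.

Let S w := \sum_(i < k) c i * (W (t i.+1) w - W (t i) w).
Let s := Num.sqrt (\sum_(i < k) (c i * Num.sqrt (dt i)) ^+ 2).

Let measurable_S : measurable_fun setT S.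
Proof.
apply: measurable_sum => i; apply: measurable_funM => //.
exact: measurable_increment.
Qed.

Let score_prod w :
  expR (S w - s ^+ 2 / 2) = \prod_(i < k) score i (W (t i.+1) w - W (t i) w).
Proof.
rewrite -expR_sum; congr expR; rewrite big_split/= sumrN -mulr_suml.
by rewrite sqr_sqrtr// sumr_ge0// => i _; exact: sqr_ge0.
Qed.

Let measurable_density : measurable_fun setT (fun w => expR (S w - s ^+ 2 / 2)).
Proof. by apply: measurableT_comp => //; exact: measurable_funB. Qed.

Let density_ge0 w : 0 <= expR (S w - s ^+ 2 / 2). Proof. exact: expR_ge0. Qed.

(** Both sides are finite measures in E. On a grid event the density factors over the cells,
    independence turns the integral into a product, and each factor is given by [integral_score]. *)
Lemma grid_change_of_measure (E : set (observation R)) : <<s grid_events >> E ->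
  (P (signal_plus_noise G @^-1` E) =
   \int[P]_(w in signal_plus_noise F @^-1` E) (expR (S w - s ^+ 2 / 2))%:E)%E.
Proof.
pose mu1 := image_measure P (measurable_signal_plus_noise G).
pose mu2 := image_measure (density_measure P measurable_density density_ge0)
  (measurable_signal_plus_noise F).
suff : forall E, <<s grid_events >> E -> mu1 E = mu2 E by apply.
apply: (@g_sigma_algebra_measure_unique _ R (observation R) grid_events
  grid_events_measurable (fun _ => setT)).
- by move=> _; exact: grid_eventsT.
- by rewrite bigcup_const.
- exact: grid_events_setI.
- move=> _ [B [A [mB mA ->]]].
  set E0 := [set y | _].
  rewrite -[LHS]/(P (signal_plus_noise G @^-1` E0)).
  rewrite -[RHS]/(\int[P]_(w in signal_plus_noise F @^-1` E0) (expR (S w - s ^+ 2 / 2))%:E)%E.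
  have pre H w : (signal_plus_noise H @^-1` E0) w =
      (B (H a) /\ forall i, (i < k)%N -> A i (H (t i.+1) - H (t i) +
         (Num.sqrt n)^-1 * (W (t i.+1) w - W (t i) w))).
    rewrite /E0 /signal_plus_noise/= t0 W0 mulr0 addr0; apply/propext.
    split=> -[Bw h]; split => // i ik; have := h i ik; congr (A i _); lra.
  (* Since W vanishes at the left endpoint, the starting value is the constant F a = G a, and the
     constraint on it is either sure or impossible. *)
  have [BF|BF] := pselect (B (F a)); last first.
    rewrite (_ : signal_plus_noise G @^-1` E0 = set0); last first.
      by apply/seteqP; split => // w; rewrite pre -FGa => -[].
    rewrite (_ : signal_plus_noise F @^-1` E0 = set0); last first.
      by apply/seteqP; split => // w; rewrite pre => -[].
    by rewrite measure0 integral_set0.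
  pose A' i := [set x : R | A i (dG i + (Num.sqrt n)^-1 * x)].
  have mA' i : measurable (A' i).
    rewrite -[X in measurable X]setTI.
    apply: (measurable_funD (f := cst (dG i)) (g := fun x => (Num.sqrt n)^-1 * x)) => //.
    exact: measurable_funM.
  transitivity (\prod_(i < k) P [set w | A' i (W (t i.+1) w - W (t i) w)%R])%E.
    apply/esym; apply: (eq_trans (esym (increments_independent (A := A') _))) => //.
    congr (P _).
    by apply/seteqP; split => w; rewrite pre -FGa => // -[].
  pose u i x := \1_(A i) (dF i + (Num.sqrt n)^-1 * x) * score i x.
  have mu_ i : measurable_fun setT (u i).
    apply: measurable_funM => //.
    apply: (@measurableT_comp _ _ _ _ _ _ (\1_(A i) : R -> R)).
      exact: measurable_indic.
    by apply: measurable_funD => //; exact: measurable_funM.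
  have u0 i x : 0 <= u i x by rewrite mulr_ge0// expR_ge0.
  transitivity (\int[P]_w (\prod_(i < k) u i (W (t i.+1) w - W (t i) w))%:E)%E.
    rewrite (mutually_independent_integral_prod measurable_increment
      increments_independent mu_ u0).
      by apply: eq_bigr => i _; rewrite integral_score.
    move=> i ik; rewrite integral_score// fin_num_measure//.
    rewrite -[X in measurable X]setTI.
    exact: (measurable_increment ik measurableT (mA' i)).
  rewrite [RHS]integral_mkcond; apply: eq_integral => w _.
  rewrite patchE big_split/= -score_prod.
  case: ifPn => [|/negP]; rewrite inE pre => h.
    rewrite big1 ?mul1r// => i _; rewrite indicE mem_set//.
    by have [_] := h; apply.
  have /existsNP[i /not_implyP[ik nA]] : ~ forall i, (i < k)%N -> A i (dF i +
      (Num.sqrt n)^-1 * (W (t i.+1) w - W (t i) w)) by move=> h'; apply: h.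
  by rewrite (bigD1 (Ordinal ik))//= indicE memNset ?mul0r.
- move=> _; apply: (@le_lt_trans _ _ 1%E); last exact: ltry.
  by apply: probability_le1; rewrite preimage_setT.
Qed.

Lemma grid_neyman_pearson (E : set (observation R)) (x : R) :
  <<s grid_events >> E ->
  ((Phi x)%:E <= P (signal_plus_noise G @^-1` E))%E ->
  ((Phi (x - s))%:E <= P (signal_plus_noise F @^-1` E))%E.
Proof.
move=> gE; rewrite grid_change_of_measure//; apply: neyman_pearson => //.
- by rewrite sqrtr_ge0.
- have := @normal_law_sum _ _ R P k (fun i w => c i * (W (t i.+1) w - W (t i) w))
    (fun _ => 0) (fun i => c i * Num.sqrt (dt i)).
  rewrite big1//; apply.
  + by move=> i ik; apply: measurable_funM => //; exact: measurable_increment.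
  + apply: (mutually_independent_comp (g := fun i x => c i * x) increments_independent).
    by move=> i ik; exact: measurable_funM.
  + move=> i ik; have := normal_law_affine 0 (c i) (increment_law ik).
    by rewrite mulr0 addr0 => h A mA; rewrite -h//; congr (P _);
      apply/seteqP; split => w; rewrite /= add0r.
- rewrite -[X in measurable X]setTI; apply: measurable_signal_plus_noise => //.
  exact: (smallest_sub (@sigma_algebra_measurable _ _) grid_events_measurable) gE.
Qed.

End grid.

Definition cylinder_events (ts : seq R) : set (set (observation R)) :=
  <<s [set E : set (observation R) | exists u (B : set R),
        [/\ u \in ts, measurable B & E = [set y | B (y u)]]] >>.

Lemma cylinder_events_sub (ts ts' : seq R) : {subset ts <= ts'} ->
  cylinder_events ts `<=` cylinder_events ts'.
Proof.
move=> sub; apply: sub_sigma_algebra2 => E [u [B [uts mB ->]]].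
by exists u, B; split => //; exact: sub.
Qed.

(** Adding the left endpoint and sorting without repetition gives a grid, on which each value is the
    starting value plus a sum of increments. *)
Lemma cylinder_events_grid (ts : seq R) : (forall u, u \in ts -> u \in `[a, b]) ->
  exists (k : nat) (t : nat -> R),
    [/\ t 0%N = a, forall i, (i <= k)%N -> t i \in `[a, b],
        forall i, (i < k)%N -> t i < t i.+1 &
        cylinder_events ts `<=` <<s grid_events k t >>].
Proof.
move=> tsab; pose l := sort <=%R (undup (a :: ts)).
have lmem u : (u \in l) = (u \in a :: ts) by rewrite mem_sort mem_undup.
have lab u : u \in l -> u \in `[a, b].
  rewrite lmem in_cons => /predU1P[->|/tsab//].
  by rewrite in_itv/= lexx/=; lra.
have al : a \in l by rewrite lmem mem_head.
have l0 : (0 < size l)%N by case: (l) al.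
have lsort : sorted <%R l.
  by rewrite lt_sorted_uniq_le sort_uniq undup_uniq sort_le_sorted.
have lt i j : (i < size l)%N -> (j < size l)%N -> (i < j)%N -> nth a l i < nth a l j.
  by move=> il jl ij; apply: (sorted_ltn_nth lt_trans) => //; rewrite inE.
pose t := nth a l; pose k := (size l).-1.
have kl i : (i <= k)%N -> (i < size l)%N by rewrite /k; lia.
have t0 : t 0%N = a.
  case: (posnP (index a l)) => [i0|i0]; first by have := nth_index a al; rewrite i0.
  have : t 0%N < a by rewrite -[X in _ < X](nth_index a al) lt// index_mem.
  have : t 0%N \in `[a, b] by apply: lab; exact: mem_nth.
  by rewrite in_itv/= => /andP[]; lra.
exists k, t; split => //.
- by move=> i ik; apply: lab; apply: mem_nth; exact: kl.
- by move=> i ik; apply: lt; rewrite ?kl//; exact: ltnW.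
apply: smallest_sub; first exact: smallest_sigma_algebra.
pose GT := g_sigma_algebraType (grid_events k t).
have mt0 : measurable_fun setT (fun y : GT => (y : R -> R) (t 0%N)).
  move=> _ B mB; rewrite setTI; apply: sub_sigma_algebra.
  exists B, (fun _ => setT); split => //.
  by apply/seteqP; split => y //=; case.
have mdt i : (i < k)%N ->
    measurable_fun setT (fun y : GT => (y : R -> R) (t i.+1) - (y : R -> R) (t i)).
  move=> ik _ B mB; rewrite setTI; apply: sub_sigma_algebra.
  exists setT, (fun j => if j == i then B else setT); split => //.
    by move=> j; case: ifP.
  apply/seteqP; split => y /=.
    by move=> By; split => // j jk; case: eqP => // ->.
  by move=> [_ /(_ i ik)]; rewrite eqxx.
have mt i : (i <= k)%N -> measurable_fun setT (fun y : GT => (y : R -> R) (t i)).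
  elim: i => [//|i IH] ik.
  rewrite (_ : (fun y : GT => _) =
    (fun y : GT => (y : R -> R) (t i) + ((y : R -> R) (t i.+1) - (y : R -> R) (t i)))).
    by apply: measurable_funD; [apply: IH; exact: ltnW|exact: mdt].
  by apply/funext => y; rewrite addrC subrK.
move=> _ [u [B [uts mB ->]]].
have ul : u \in l by rewrite lmem in_cons uts orbT.
have ik : (index u l <= k)%N by rewrite /k -ltnS prednK// index_mem.
have := mt _ ik measurableT B mB; rewrite setTI /t.
by rewrite nth_index.
Qed.

Variables (F G : R -> R) (s : R).
Hypothesis FGa : F a = G a.
Hypothesis s0 : 0 <= s.
Hypothesis FG : forall (k : nat) (t : nat -> R),
  (forall i, (i <= k)%N -> t i \in `[a, b]) ->
  (forall i, (i < k)%N -> t i < t i.+1) ->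
  n * \sum_(i < k) ((G (t i.+1) - G (t i)) - (F (t i.+1) - F (t i))) ^+ 2 /
    (t i.+1 - t i) <= s ^+ 2.

(** The variance of the logarithm of the likelihood ratio on a grid is the discrete energy bounded
    by [FG], and [Phi] is increasing. The bound holds for every grid, so the loss s does not depend
    on the cylinder. *)
Lemma cylinder_neyman_pearson (W0 : forall w, W a w = 0) (ts : seq R)
    (E : set (observation R)) (x : R) :
  (forall u, u \in ts -> u \in `[a, b]) -> cylinder_events ts E ->
  ((Phi x)%:E <= P (signal_plus_noise G @^-1` E))%E ->
  ((Phi (x - s))%:E <= P (signal_plus_noise F @^-1` E))%E.
Proof.
move=> /cylinder_events_grid[k [t [t0 tab tlt sub]]] /sub gE hG.
apply: le_trans (grid_neyman_pearson t0 tab tlt W0 FGa gE hG).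
rewrite lee_fin ler_Phi lerD2l lerN2 -[leRHS]ger0_norm// -sqrtr_sqr.
rewrite ler_sqrt ?sqr_ge0//; apply: le_trans (FG tab tlt).
rewrite mulr_sumr ler_sum// => i _.
have dt0 : 0 < t i.+1 - t i by rewrite subr_gt0 tlt.
rewrite exprMn sqr_sqrtr ?(ltW dt0)// exprMn sqr_sqrtr ?(ltW n0)//.
rewrite -mulrA ler_pM2l// expr_div_n -mulrA expr2 ler_wpM2l ?sqr_ge0//.
by rewrite [X in X^-1]expr2 invfM -mulrA mulVf ?mulr1// gt_eqF.
Qed.

Let cylinders : set (set (observation R)) :=
  [set E | exists2 ts, (forall u, u \in ts -> u \in `[a, b]) & cylinder_events ts E].

Let cylinders_measurable : cylinders `<=` measurable.
Proof.
move=> E [ts tsab]; apply: smallest_sub => //.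
  exact: sigma_algebra_measurable.
move=> _ [u [B [uts mB ->]]]; apply: sub_sigma_algebra.
by exists u, B; split => //; exact: tsab.
Qed.

Let cylinders_setC E : cylinders E -> cylinders (~` E).
Proof.
move=> [ts tsab cE]; exists ts => //.
exact: (@measurableC _ (g_sigma_algebraType _)).
Qed.

Let cylinders_setU E E' : cylinders E -> cylinders E' -> cylinders (E `|` E').
Proof.
move=> [ts tsab cE] [ts' ts'ab cE']; exists (ts ++ ts').
  by move=> u; rewrite mem_cat => /orP[/tsab|/ts'ab].
apply: (@measurableU _ (g_sigma_algebraType _)).
- by apply: cylinder_events_sub cE => u uts; rewrite mem_cat uts.
- by apply: cylinder_events_sub cE' => u uts; rewrite mem_cat uts orbT.
Qed.

(** A general event A is close, under both laws, to a cylinder E. The lower bound under G passes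
    from A to E, the cylinder inequality moves it to F, and there it returns from E to A; continuity
    of [Phi] makes the total loss smaller than any given gap. *)
Lemma pinned_gaussian_shift (W0 : forall w, W a w = 0) (A : set (observation R))
    (x : R) : measurable A ->
  ((Phi x)%:E <= P (signal_plus_noise G @^-1` A))%E ->
  ((Phi (x - s))%:E <= P (signal_plus_noise F @^-1` A))%E.
Proof.
move=> mA hG; rewrite leNgt; apply/negP => hF.
have mY H (E : set (observation R)) : measurable E ->
    measurable (signal_plus_noise H @^-1` E).
  move=> mE; rewrite -[X in measurable X]setTI.
  exact: (measurable_signal_plus_noise H).
pose p := fine (P (signal_plus_noise F @^-1` A)).
have pE : P (signal_plus_noise F @^-1` A) = p%:E.
  by rewrite /p fineK// fin_num_measure//; exact: mY.
(* If the claim failed, the gap would be 4 del. Replacing x by x - eta costs at most one del, and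
   the approximation under F at most another. *)
pose del := (Phi (x - s) - p) / 4.
have del0 : 0 < del by move: hF; rewrite pE lte_fin /del; lra.
have [eta eta0 heta] : exists2 eta : R, 0 < eta & Phi (x - s) - del < Phi (x - eta - s).
  have := @continuous_Phi R (x - s) => /cvgrPdist_lt/(_ _ del0)[e /= e0 he].
  exists (e / 2); first by rewrite divr_gt0.
  have /he : ball_ Num.norm (x - s) e (x - e / 2 - s).
    by rewrite /= (_ : _ - _ = e / 2) ?gtr0_norm ?divr_gt0//; lra.
  by move=> /ltr_normlW; lra.
(* The second term of the minimum ensures that, after a loss of eps under G, the probability is
   still at least Phi (x - eta). *)
pose eps := Num.min del (Phi x - Phi (x - eta)).
have eps0 : 0 < eps by rewrite lt_min del0 subr_gt0 Phi_increasing//; lra.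
(* Summing the two laws makes a single cylinder approximate A under both. *)
pose m := measure_add (image_measure P (measurable_signal_plus_noise F))
  (image_measure P (measurable_signal_plus_noise G)).
have mE B : m B = (P (signal_plus_noise F @^-1` B) + P (signal_plus_noise G @^-1` B))%E.
  by rewrite /m measure_addE.
have Gall : <<s cylinders >> A.
  apply: sub_sigma_algebra2 mA => E [u [B [uab mB ->]]].
  exists [:: u]; first by move=> v; rewrite inE => /eqP ->.
  by apply: sub_sigma_algebra; exists u, B; split => //; rewrite inE.
have mT : (m setT < +oo)%E.
  rewrite mE !preimage_setT !probability_setT -EFinD; exact: ltry.
have c0 : cylinders set0.
  by exists [::] => //; exact: (@measurable0 _ (g_sigma_algebraType _)).
have [E cE] := @algebra_approximation _ _ _ m mT cylinders cylinders_measurable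
  c0 cylinders_setC cylinders_setU A Gall eps eps0.
have mE' : measurable E by exact: cylinders_measurable.
set D := (A `\` E) `|` (E `\` A) => hm.
have hE : (P (signal_plus_noise F @^-1` D) + P (signal_plus_noise G @^-1` D) <= eps%:E)%E.
  by rewrite -mE; exact: hm.
have mD : measurable D by apply: measurableU; exact: measurableD.
have le1 H : (P (signal_plus_noise H @^-1` A) <=
    P (signal_plus_noise H @^-1` E) + P (signal_plus_noise H @^-1` D))%E.
  apply: le_trans (measureU2 _ _ _); [|exact: mY..].
  apply: le_measure; rewrite ?inE; [exact: mY|by apply: measurableU; exact: mY|].
  by move=> w /= Aw; have [?|?] := pselect (E (signal_plus_noise H w)); [left|right; left].
have le2 H : (P (signal_plus_noise H @^-1` E) <=
    P (signal_plus_noise H @^-1` A) + P (signal_plus_noise H @^-1` D))%E.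
  apply: le_trans (measureU2 _ _ _); [|exact: mY..].
  apply: le_measure; rewrite ?inE; [exact: mY|by apply: measurableU; exact: mY|].
  by move=> w /= Aw; have [?|?] := pselect (A (signal_plus_noise H w)); [left|right; right].
have hDF : (P (signal_plus_noise F @^-1` D) <= eps%:E)%E.
  by apply: le_trans hE; rewrite leeDl.
have hDG : (P (signal_plus_noise G @^-1` D) <= eps%:E)%E.
  by apply: le_trans hE; rewrite leeDr.
have hGE : ((Phi (x - eta))%:E <= P (signal_plus_noise G @^-1` E))%E.
  have := le_trans hG (le_trans (le1 G) (leeD (lexx _) hDG)).
  have ee : eps <= Phi x - Phi (x - eta) by rewrite ge_min lexx orbT.
  rewrite -[P (_ @^-1` E)]fineK ?fin_num_measure//; last exact: mY.
  by rewrite -EFinD !lee_fin; lra.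
have [ts tsab cE'] := cE.
have hFE := cylinder_neyman_pearson W0 tsab cE' hGE.
have := le_trans hFE (le_trans (le2 F) (leeD (lexx _) hDF)).
have ee : eps <= del by rewrite ge_min lexx.
have pd : p = Phi (x - s) - 4 * del by rewrite /del; lra.
rewrite pE -EFinD lee_fin pd.
move: heta ee del0; clearbody eps del.
by move: (Phi (x - s)) (Phi (x - eta - s)) => u v; lra.
Qed.

End gaussian_shift.

Section gaussian_shift_main.
Context d (T : measurableType d) (R : realType) (P : probability T R).
Variable W : R -> T -> R.
Notation a := (- 2^-1 : R).
Notation b := (2^-1 : R).
Hypothesis BW : brownian_motion P a b W.

(** W is 0 at the left endpoint only almost surely. Subtracting its value there changes no increment
    and makes every path start at 0. *)
Let V t w := W t w - W a w.

Let inc s t w : V t w - V s w = W t w - W s w.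
Proof. by rewrite /V; lra. Qed.

Let aab : a \in `[a, b]. Proof. by rewrite in_itv/= lexx/=; lra. Qed.

Lemma pinned_brownian_motion : brownian_motion P a b V.
Proof.
have [mW W0 cW lW iW] := BW; split.
- by move=> t tab; apply: measurable_funB; apply: mW.
- by apply: aeW => w; rewrite /V subrr.
- apply: filterS cW => w cw.
  have -> : V ^~ w = (fun t => W t w - W a w) by [].
  by move=> x; apply: cvgB; [exact: cw|exact: cvg_cst].
- move=> s t as_ st tb A mA; rewrite -(lW s t as_ st tb A mA); congr (P _).
  by apply/seteqP; split => w /=; rewrite inc.
- move=> k t A tab nt mA.
  rewrite (_ : [set w | _] = [set w | forall i, (i < k)%N -> A i (W (t i.+1) w - W (t i) w)]).
    rewrite (iW k t A tab nt mA); apply: eq_bigr => i _; congr (P _).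
    by apply/seteqP; split => w /=; rewrite inc.
  by apply/seteqP; split => w /= h i ik; have := h i ik; rewrite inc.
Qed.

Lemma gaussian_shift (n : R) (F G : R -> R) (s : R) (A : set (observation R)) (x : R) :
  0 < n -> F a = G a -> 0 <= s ->
  (forall (k : nat) (t : nat -> R),
    (forall i, (i <= k)%N -> t i \in `[a, b]) ->
    (forall i, (i < k)%N -> t i < t i.+1) ->
    n * \sum_(i < k) ((G (t i.+1) - G (t i)) - (F (t i.+1) - F (t i))) ^+ 2 /
      (t i.+1 - t i) <= s ^+ 2) ->
  measurable A ->
  ((Phi x)%:E <= P (signal_plus_noise W n G @^-1` A))%E ->
  ((Phi (x - s))%:E <= P (signal_plus_noise W n F @^-1` A))%E.
Proof.
move=> n0 FGa s0 FG mA.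
have [_ W0 _ _ _] := BW.
have mY U H : brownian_motion P a b U ->
    measurable (signal_plus_noise U n H @^-1` A).
  move=> BU; rewrite -[X in measurable X]setTI.
  exact: (measurable_signal_plus_noise BU).
have E H : P (signal_plus_noise W n H @^-1` A) = P (signal_plus_noise V n H @^-1` A).
  apply: (eq_measure_off_negligible W0); [exact: mY|exact: mY pinned_brownian_motion|].
  apply/seteqP; split => w /= [Aw /contrapT w0]; split; rewrite ?w0//;
    move: Aw; rewrite (_ : signal_plus_noise V n H w = signal_plus_noise W n H w)//;
    by apply/funext => t; rewrite /signal_plus_noise /V w0 subr0.
rewrite !E; apply: (pinned_gaussian_shift pinned_brownian_motion n0 FGa s0 FG) => //.
by move=> w; rewrite /V subrr.
Qed.

End gaussian_shift_main.

(** * Lower bound *)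

Section primitive.
Context (R : realType).
Local Notation mu := (@lebesgue_measure R).
Implicit Types (f g h : R -> R) (s t l u : R).

Definition primitive f t : R := \int[mu]_(x in `[- 2^-1, t]) f x.

Lemma primitive_start f : primitive f (- 2^-1) = 0.
Proof. by rewrite /primitive set_itv1 Rintegral_set1. Qed.

Lemma integrable_itv_sub h s t : mu.-integrable `[- 2^-1, 2^-1] (EFin \o h) ->
  - 2^-1 <= s -> t <= 2^-1 -> mu.-integrable `[s, t] (EFin \o h).
Proof.
move=> ih a_s tb; apply: integrableS ih => //.
by apply: subset_itv; rewrite bnd_simp.
Qed.

Lemma primitive_incr h s t : mu.-integrable `[- 2^-1, 2^-1] (EFin \o h) ->
  - 2^-1 <= s -> s <= t -> t <= 2^-1 ->
  primitive h t - primitive h s = \int[mu]_(x in `]s, t[) h x.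
Proof.
move=> ih a_s st tb; rewrite /primitive (@Rintegral_itvB _ h (BLeft (- 2^-1)) (BRight t) s).
- rewrite Rintegral_itv_bndo_bndc//; apply: integrableS ih => //.
  by apply: subset_itv; rewrite bnd_simp// ltW.
- exact: integrable_itv_sub.
- by rewrite bnd_simp.
- by rewrite bnd_simp.
Qed.

Lemma integrable_itv_oo h s t : mu.-integrable `[- 2^-1, 2^-1] (EFin \o h) ->
  - 2^-1 <= s -> t <= 2^-1 -> mu.-integrable `]s, t[ (EFin \o h).
Proof.
move=> ih a_s tb; apply: integrableS ih => //.
by apply: subset_itv; rewrite bnd_simp.
Qed.

Lemma integrable_cst_oo (c : R) s t : mu.-integrable `]s, t[ (EFin \o cst c).
Proof.
apply: measurable_bounded_integrable => //.
- by rewrite /= lebesgue_measure_itv; case: ifP => _; rewrite ?ltry.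
- by exists `|c|; split; [exact: num_real|move=> M cM x _ /=; exact: ltW].
Qed.

Lemma lebesgue_itv_oo s t : s <= t -> fine (mu `]s, t[) = t - s.
Proof.
rewrite lebesgue_measure_itv /= lte_fin le_eqVlt => /predU1P[->|->//].
by rewrite ltxx subrr.
Qed.

Lemma primitive_incr_le h s t u : mu.-integrable `[- 2^-1, 2^-1] (EFin \o h) ->
  - 2^-1 <= s -> s <= t -> t <= 2^-1 -> (forall x, s < x < t -> h x <= u) ->
  primitive h t - primitive h s <= u * (t - s).
Proof.
move=> ih a_s st tb hu; rewrite primitive_incr// -(lebesgue_itv_oo st).
rewrite -(@Rintegral_cst _ _ _ mu)//; apply: le_Rintegral => //.
- exact: integrable_itv_oo.
- exact: integrable_cst_oo.
Qed.

Lemma primitive_incr_ge h s t l : mu.-integrable `[- 2^-1, 2^-1] (EFin \o h) ->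
  - 2^-1 <= s -> s <= t -> t <= 2^-1 -> (forall x, s < x < t -> l <= h x) ->
  l * (t - s) <= primitive h t - primitive h s.
Proof.
move=> ih a_s st tb hl; rewrite primitive_incr// -(lebesgue_itv_oo st).
rewrite -(@Rintegral_cst _ _ _ mu)//; apply: le_Rintegral => //.
- exact: integrable_cst_oo.
- exact: integrable_itv_oo.
Qed.

Lemma primitiveB f g t : mu.-integrable `[- 2^-1, 2^-1] (EFin \o f) ->
  mu.-integrable `[- 2^-1, 2^-1] (EFin \o g) -> t <= 2^-1 ->
  primitive g t - primitive f t = primitive (fun x => g x - f x) t.
Proof.
by move=> fi gi tb; rewrite /primitive RintegralB//; exact: integrable_itv_sub.
Qed.

Lemma F_m_integrable f : F_m f -> mu.-integrable `[- 2^-1, 2^-1] (EFin \o f).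
Proof.
move=> fm; have ab : (- 2^-1 : R) <= 2^-1 by lra.
have aI : (- 2^-1 : R) \in `[- 2^-1, 2^-1] by rewrite in_itv /= lexx ab.
have bI : (2^-1 : R) \in `[- 2^-1, 2^-1] by rewrite in_itv /= ab lexx.
apply: measurable_bounded_integrable => //.
- by rewrite /= lebesgue_measure_itv; case: ifP => _; rewrite ?ltry.
(* f is monotone on the closed interval only; composed with the projection onto that interval it is
   monotone on the whole line, hence measurable. *)
- pose clamp (x : R) : R := Num.max (- 2^-1) (Num.min 2^-1 x).
  have clampI x : clamp x \in `[- 2^-1, 2^-1].
    by rewrite in_itv /= /clamp; apply/andP; split; rewrite ?le_max ?ge_max ?lexx ?ge_min ?ab ?lexx.
  apply: (@eq_measurable_fun _ _ _ _ _ (f \o clamp)).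
    move=> x; rewrite inE /= in_itv /= => /andP[ax xb].
    by rewrite /clamp (min_idPr xb) (max_idPr ax).
  apply: nondecreasing_measurable => // x y xy; apply: fm => //.
  by rewrite /clamp le_max2// le_min2.
- exists (`|f (- 2^-1)| + `|f 2^-1|); split; first exact: num_real.
  move=> M cM x; rewrite /= in_itv /= => xI; apply: le_trans (ltW cM).
  have xI' : x \in `[- 2^-1, 2^-1] by rewrite in_itv.
  move: xI => /andP[ax xb].
  have := fm _ _ aI xI' ax; have := fm _ _ xI' bI xb => h1 h2.
  rewrite ler_norml; apply/andP; split.
    by have := ler_norm (- f (- 2^-1)); rewrite normrN; have := normr_ge0 (f 2^-1); lra.
  by have := ler_norm (f (2^-1)); have := normr_ge0 (f (- 2^-1)); lra.
Qed.

End primitive.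

Section primitive_energy.
Context (R : realType).
Local Notation mu := (@lebesgue_measure R).

Lemma F_m_primitive_le (f : R -> R) s t : F_m f -> - 2^-1 <= s -> s <= t -> t <= 2^-1 ->
  f s * (t - s) <= primitive f t - primitive f s <= f t * (t - s).
Proof.
move=> fm a_s st tb; have fi := F_m_integrable fm; apply/andP; split.
  apply: primitive_incr_ge => // x /andP[sx xt].
  by apply: fm; rewrite ?in_itv /=; lra.
apply: primitive_incr_le => // x /andP[sx xt].
by apply: fm; rewrite ?in_itv /=; lra.
Qed.

(** Discrete form of bounding the integral of h^2 by c^2 * (u - l). Since 0 <= h <= c, each
    increment of the primitive is at most c * dt, so its square over dt is at most c times the
    increment itself; the increments telescope, and only the part between l and u contributes. *)
Lemma primitive_energy (h : R -> R) (c l u : R) (k : nat) (t : nat -> R) :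
  mu.-integrable `[- 2^-1, 2^-1] (EFin \o h) ->
  - 2^-1 <= l -> l <= u -> u <= 2^-1 ->
  (forall x, - 2^-1 <= x <= 2^-1 -> 0 <= h x <= c) ->
  (forall x, - 2^-1 < x < l -> h x <= 0) ->
  (forall x, u < x < 2^-1 -> h x <= 0) ->
  (forall i, (i <= k)%N -> t i \in `[- 2^-1, 2^-1]) ->
  (forall i, (i < k)%N -> t i < t i.+1) ->
  \sum_(i < k) (primitive h (t i.+1) - primitive h (t i)) ^+ 2 / (t i.+1 - t i)
  <= c ^+ 2 * (u - l).
Proof.
move=> ih al lu ub hc hl hu tI tinc.
have c0 : 0 <= c.
  by have := hc l; rewrite al (le_trans lu ub) => /(_ isT) /andP[]; exact: le_trans.
have Hinc s r : - 2^-1 <= s -> s <= r -> r <= 2^-1 -> 0 <= primitive h r - primitive h s.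
  move=> a_s sr rb; have := @primitive_incr_ge _ h s r 0 ih a_s sr rb.
  rewrite mul0r; apply => x /andP[sx xr].
  by have /andP[] : 0 <= h x <= c by apply: hc; lra.
have Hub : primitive h (2^-1) - primitive h u <= 0.
  by have := @primitive_incr_le _ h u (2^-1) 0 ih; rewrite mul0r; apply => //; lra.
have Hla : primitive h l - primitive h (- 2^-1) <= 0.
  by have := @primitive_incr_le _ h (- 2^-1) l 0 ih; rewrite mul0r; apply => //; lra.
have Hlu : primitive h u - primitive h l <= c * (u - l).
  apply: primitive_incr_le => // x /andP[sx xr].
  by have /andP[] : 0 <= h x <= c by apply: hc; lra.
apply: (@le_trans _ _ (c * (primitive h (t k) - primitive h (t 0%N)))).
  have -> : primitive h (t k) - primitive h (t 0%N) =
      \sum_(i < k) (primitive h (t i.+1) - primitive h (t i)).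
    by rewrite -(big_mkord xpredT (fun i => primitive h (t i.+1) - primitive h (t i))) telescope_sumr.
  rewrite mulr_sumr; apply: ler_sum => i _.
  have ti := tinc i (ltn_ord i).
  have := tI i (ltnW (ltn_ord i)); have := tI i.+1 (ltn_ord i).
  rewrite !in_itv /= => /andP[a1 b1] /andP[a0 b0].
  rewrite ler_pdivrMr ?subr_gt0// expr2 mulrAC; apply: ler_wpM2r.
    by apply: Hinc => //; exact: ltW.
  apply: primitive_incr_le => //; first exact: ltW.
  move=> x /andP[sx xr].
  by have /andP[] : 0 <= h x <= c by apply: hc; lra.
rewrite expr2 -mulrA; apply: ler_wpM2l => //.
have := tI 0%N (leq0n k); have := tI k (leqnn k).
rewrite !in_itv /= => /andP[a1 b1] /andP[a0 b0].
have := Hinc _ _ a1 b1 (lexx _); have := Hinc _ _ (lexx _) a0 b0.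
lra.
Qed.

End primitive_energy.

Section coverage_shift.
Context d (T : measurableType d) (R : realType) (P : probability T R).
Variable (W : R -> T -> R).
Hypothesis BW : brownian_motion P (- 2^-1) 2^-1 W.
Local Notation mu := (@lebesgue_measure R).

Definition covers n f (CI : observation R -> \bar R * \bar R) (u : R) : set T :=
  [set w | let I := CI (white_noise W n f w) in (I.1 <= u%:E <= I.2)%E].

Lemma measurable_covering (CI : observation R -> \bar R * \bar R) (u : R) :
  measurable_fun setT CI ->
  measurable [set y | ((CI y).1 <= u%:E <= (CI y).2)%E].
Proof.
move=> mCI.
have -> : [set y | ((CI y).1 <= u%:E <= (CI y).2)%E] =
    setT `&` CI @^-1` (`]-oo, u%:E]%classic `*` `[u%:E, +oo[%classic).
  rewrite setTI; apply/seteqP; split => y /=; rewrite !in_itv /= andbT.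
    by move=> /andP[].
  by move=> [-> ->].
by apply: mCI => //; apply: measurableX; exact: emeasurable_itv.
Qed.

(** Coverage at g is at least 1 - alpha = Phi (z_ alpha), and moving from g to f costs the energy of
    h. The energy does not see the sign of h, so raising and lowering f share this lemma. *)
Lemma coverage_shift (n alpha c l u : R) (f g h : R -> R) (CI : observation R -> \bar R * \bar R) :
  0 < n -> 0 < alpha < 1 -> confidence_intervals P W n alpha (@F_m R) CI ->
  F_m f -> F_m g ->
  (h = (fun x => g x - f x) \/ h = (fun x => f x - g x)) ->
  - 2^-1 <= l -> l <= u -> u <= 2^-1 -> 0 <= c ->
  (forall x, - 2^-1 <= x <= 2^-1 -> 0 <= h x <= c) ->
  (forall x, - 2^-1 < x < l -> h x <= 0) ->
  (forall x, u < x < 2^-1 -> h x <= 0) ->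
  ((Phi (z_ alpha - c * Num.sqrt (n * (u - l)))%R)%:E <= P (covers n f CI (g 0%R)))%E.
Proof.
move=> n0 a01 [mCI cov] fm gm hE al lu ub c0 hc hl hu.
have fi := F_m_integrable fm; have gi := F_m_integrable gm.
have ih : mu.-integrable `[- 2^-1, 2^-1] (EFin \o h).
  by case: hE => ->; [have := integrableB _ gi fi|have := integrableB _ fi gi]; apply.
apply: (gaussian_shift BW (F := primitive f) (G := primitive g)
  (A := [set y | ((CI y).1 <= (g 0)%:E <= (CI y).2)%E])) => //.
- by rewrite !primitive_start.
- by rewrite mulr_ge0// sqrtr_ge0.
- move=> k t tI tinc; rewrite exprMn sqr_sqrtr; last by rewrite mulr_ge0 ?subr_ge0// ltW.
  have := primitive_energy ih al lu ub hc hl hu tI tinc.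
  move=> /(ler_wpM2l (ltW n0)); rewrite mulrCA; apply: le_trans.
  rewrite le_eqVlt; apply/orP; left; apply/eqP; congr (_ * _).
  apply: eq_bigr => i _; congr (_ / _).
  have tb j : (j <= k)%N -> t j <= 2^-1 by move=> /tI; rewrite in_itv /= => /andP[].
  case: hE => ->; rewrite -!primitiveB ?tb ?(ltn_ord i) ?(ltnW (ltn_ord i))//.
    by congr (_ ^+ 2); lra.
  by rewrite -sqrrN; congr (_ ^+ 2); lra.
- exact: measurable_covering.
- by case/andP: a01 => a0 a1; rewrite (Phi_z_ a0 a1); exact: cov.
Qed.

Lemma coverage_shift_right (n alpha c s : R) (f : R -> R) (CI : observation R -> \bar R * \bar R) :
  0 < n -> 0 < alpha < 1 -> confidence_intervals P W n alpha (@F_m R) CI ->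
  F_m f -> 0 <= c -> 0 < s <= 2^-1 -> s = 2^-1 \/ f 0 + c <= f s ->
  ((Phi (z_ alpha - c * Num.sqrt (n * s))%R)%:E <= P (covers n f CI (f 0 + c)%R))%E.
Proof.
move=> n0 a01 ci fm c0 /andP[s0 sb] fs.
(* A monotone function that differs from f only between 0 and s: at s the function f has already
   reached f 0 + c, or s is the end of the interval. *)
pose g x := if 0 <= x then Num.max (f x) (f 0 + c) else f x.
have gm : F_m g.
  move=> x y xI yI xy; rewrite /g; have fxy := fm _ _ xI yI xy.
  have [x0|x0] := lerP 0 x.
    by rewrite (le_trans x0 xy) le_max2.
  by case: ifP => _ //; rewrite le_max fxy.
have g0 : g 0 = f 0 + c by rewrite /g lexx; apply/max_idPr; rewrite lerDl.
have fle x y : - 2^-1 <= x -> x <= y -> y <= 2^-1 -> f x <= f y.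
  by move=> *; apply: fm; rewrite ?in_itv /=; lra.
rewrite -g0 -[in n * s](subr0 s).
apply: (@coverage_shift n alpha c 0 s f g (fun x => g x - f x)) => //.
- by left.
- by lra.
- move=> x /andP[ax xb]; rewrite /g; case: (lerP 0 x) => x0; last by rewrite subrr lexx.
  have fx := fle 0 x (_ : _) x0 xb.
  have {fx} : f 0 <= f x by apply: fx; lra.
  by case: (lerP (f x) (f 0 + c)) => h1 h2; lra.
- by move=> x /andP[ax x0]; rewrite /g ifF ?subrr//; apply/negbTE; rewrite -ltNge.
- move=> x /andP[sx xb]; case: fs => fs; first by lra.
  have fx : f s <= f x by apply: fle; lra.
  rewrite /g; case: ifP => _; rewrite ?subrr//.
  by rewrite (max_idPl _) ?subrr// (le_trans fs).
Qed.

Lemma coverage_shift_left (n alpha c s : R) (f : R -> R) (CI : observation R -> \bar R * \bar R) :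
  0 < n -> 0 < alpha < 1 -> confidence_intervals P W n alpha (@F_m R) CI ->
  F_m f -> 0 <= c -> 0 < s <= 2^-1 -> s = 2^-1 \/ f (- s) <= f 0 - c ->
  ((Phi (z_ alpha - c * Num.sqrt (n * s))%R)%:E <= P (covers n f CI (f 0 - c)%R))%E.
Proof.
move=> n0 a01 ci fm c0 /andP[s0 sb] fs.
pose g x := if x <= 0 then Num.min (f x) (f 0 - c) else f x.
have gm : F_m g.
  move=> x y xI yI xy; rewrite /g; have fxy := fm _ _ xI yI xy.
  have [y0|y0] := lerP y 0.
    by rewrite (le_trans xy y0) le_min2.
  by case: ifP => _ //; rewrite ge_min fxy.
have g0 : g 0 = f 0 - c by rewrite /g lexx; apply/min_idPr; rewrite gerBl.
have fle x y : - 2^-1 <= x -> x <= y -> y <= 2^-1 -> f x <= f y.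
  by move=> *; apply: fm; rewrite ?in_itv /=; lra.
rewrite -g0 -[in n * s](opprK s) -[in n * _](sub0r (- s)).
apply: (@coverage_shift n alpha c (- s) 0 f g (fun x => f x - g x)) => //.
- by right.
- by lra.
- by lra.
- move=> x /andP[ax xb]; rewrite /g; case: (lerP x 0) => x0; last by rewrite subrr lexx.
  have fx := fle x 0 ax x0.
  have {fx} : f x <= f 0 by apply: fx; lra.
  by case: (lerP (f x) (f 0 - c)) => h1 h2; lra.
- move=> x /andP[ax xs]; case: fs => fs; first by lra.
  have fx : f x <= f (- s) by apply: fle; lra.
  rewrite /g; case: ifP => _; rewrite ?subrr//.
  by rewrite (min_idPl _) ?subrr// (le_trans fx).
- by move=> x /andP[x0 xb]; rewrite /g ifF ?subrr//; apply/negbTE; rewrite -ltNge.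
Qed.

End coverage_shift.

Lemma lebesgue_measure_le_interval_length (R : realType) (I : \bar R * \bar R) :
  (lebesgue_measure [set u : R | (I.1 <= u%:E <= I.2)%E] <= interval_length I)%E.
Proof.
case: I => [[l| |] [r| |]]; rewrite /interval_length /=.
- have -> : [set u : R | (l%:E <= u%:E <= r%:E)%E] = `[l, r]%classic.
    by apply/seteqP; split => u /=; rewrite in_itv /= !lee_fin.
  rewrite lebesgue_measure_itv /= lte_fin; case: ifPn => lr.
    by rewrite le_max -!EFinB lexx.
  by rewrite le_max lexx orbT.
- by rewrite addye// le_max leey.
- have -> : [set u : R | (l%:E <= u%:E <= -oo)%E] = set0.
    by apply/seteqP; split => u //=; rewrite leeNy_eq andbF.
  by rewrite measure0 le_max lexx orbT.
- have -> : [set u : R | (+oo <= u%:E <= r%:E)%E] = set0.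
    by apply/seteqP; split => u //=; rewrite leye_eq.
  by rewrite measure0 le_max lexx orbT.
- have -> : [set u : R | (+oo <= u%:E <= +oo)%E] = set0.
    by apply/seteqP; split => u //=; rewrite leye_eq.
  by rewrite measure0 le_max lexx orbT.
- have -> : [set u : R | (+oo <= u%:E <= -oo)%E] = set0.
    by apply/seteqP; split => u //=; rewrite leye_eq.
  by rewrite measure0 le_max lexx orbT.
- by rewrite le_max leey.
- by rewrite le_max leey.
- have -> : [set u : R | (-oo <= u%:E <= -oo)%E] = set0.
    by apply/seteqP; split => u //=; rewrite leeNy_eq andbF.
  by rewrite measure0 le_max lexx orbT.
Qed.

(** * Expected length as integrated coverage *)

Section expected_length_coverage.
Context d (T : measurableType d) (R : realType) (P : probability T R).
Local Notation mu := (@lebesgue_measure R).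

(** Tonelli for the set of pairs (w, u) with u in the interval of w: one family of sections consists
    of the intervals, the other of the coverage events. *)
Lemma ge0_integral_coverage (I : T -> \bar R * \bar R) : measurable_fun setT I ->
  measurable_fun setT (fun u : R => P [set w | (I w).1 <= u%:E <= (I w).2]%E) /\
  (\int[mu]_u P [set w | (I w).1 <= u%:E <= (I w).2]%E <=
   \int[P]_w interval_length (I w))%E.
Proof.
move=> mI.
pose E := [set p : T * R | (I p.1).1 <= p.2%:E <= (I p.1).2]%E.
have m1 : measurable_fun setT (fun p : T * R => (I p.1).1).
  by apply: (measurableT_comp (f := fun w => (I w).1)) => //; apply: (measurableT_comp measurable_fst).
have m2 : measurable_fun setT (fun p : T * R => (I p.1).2).
  by apply: (measurableT_comp (f := fun w => (I w).2)) => //; apply: (measurableT_comp measurable_snd).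
have mu2 : measurable_fun setT (fun p : T * R => p.2%:E).
  by apply/measurable_EFinP.
have mE : measurable E.
  (* The point u is finite, so these differences of extended reals are well defined even for
     infinite endpoints. *)
  have -> : E = (setT `&` [set p | 0 <= p.2%:E - (I p.1).1]%E) `&`
                (setT `&` [set p | 0 <= (I p.1).2 - p.2%:E]%E).
    rewrite !setTI; apply/seteqP; split => p; rewrite /E /setI [in X in _ -> X]/mkset /mkset.
      by move=> /andP[h1 h2]; rewrite !sube_ge0 ?orbT.
    by rewrite !sube_ge0 ?orbT// => -[-> ->].
  by apply: measurableI; apply: emeasurable_fun_c_infty => //; exact: emeasurable_funB.
have sec2 u : ysection E u = [set w | (I w).1 <= u%:E <= (I w).2]%E.
  by apply/seteqP; split => w; rewrite /ysection /= inE.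
have sec1 w : xsection E w = [set u : R | (I w).1 <= u%:E <= (I w).2]%E.
  by apply/seteqP; split => u; rewrite /xsection /= inE.
have mI1 : measurable_fun setT (fun w => (I w).1) by apply: (measurableT_comp measurable_fst).
have mI2 : measurable_fun setT (fun w => (I w).2) by apply: (measurableT_comp measurable_snd).
split.
  under eq_fun do rewrite -sec2; exact: measurable_fun_ysection.
under eq_integral do rewrite -sec2.
have swap : (\int[P]_w mu (xsection E w) = \int[mu]_u P (ysection E u))%E.
  apply: (eq_trans _ (eq_trans (indic_fubini_tonelli P mu mE) _)); apply: eq_integral => v _.
    exact/esym/(congr1 (fun g => g v) (indic_fubini_tonelli_FE mu mE)).
  exact: (congr1 (fun g => g v) (indic_fubini_tonelli_GE P mE)).
rewrite -[leLHS]swap.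
apply: ge0_le_integral => //.
- exact: measurable_fun_xsection.
- apply: measurable_maxe => //; exact: emeasurable_funB.
- by move=> w _ /=; rewrite sec1; exact: lebesgue_measure_le_interval_length.
Qed.

End expected_length_coverage.

(** The antiderivative of [Phi] that vanishes at -oo; it is convex because [Phi] is increasing. *)
Definition Phi_primitive (R : realType) (x : R) : R := x * Phi x + normal_pdf 0 1 x.

Lemma integral_Phi_affine (R : realType) (p q s t : R) : q != 0 -> s <= t ->
  (\int[lebesgue_measure]_(u in `[s, t]) (Phi (p + q * u)%R)%:E =
   ((Phi_primitive (p + q * t) - Phi_primitive (p + q * s)) / q)%:E)%E.
Proof.
move=> q0; rewrite le_eqVlt => /predU1P[->|st].
  by rewrite set_itv1 integral_set1 subrr mul0r.
have dF (u : R) : is_derive u 1 (fun u => Phi_primitive (p + q * u) / q) (Phi (p + q * u)).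
  have d1 : is_derive u 1 (fun u => p + q * u) q.
    by apply: is_derive_eq; rewrite /GRing.scale /=; lra.
  have d2 := is_derive_PhiD_pdf (p + q * u).
  have d3 : is_derive u 1 (fun u => Phi_primitive (p + q * u)) (q * Phi (p + q * u)).
    have := @is_derive1_comp _ (@Phi_primitive R) (fun u => p + q * u) u _ _ d2 d1.
    by rewrite mulrC.
  have -> : (fun u => Phi_primitive (p + q * u) / q) =
            (q^-1 \*: (fun u => Phi_primitive (p + q * u))).
    by apply/funext => v /=; rewrite mulrC.
  by apply: is_derive_eq; rewrite /GRing.scale /= mulrA mulVf// mul1r.
rewrite (@continuous_FTC2 _ _ (fun u => Phi_primitive (p + q * u) / q))//.
- by rewrite -EFinB -mulrBl.
- apply: continuous_subspaceT => u.
  apply: (@continuous_comp _ _ _ (fun u => p + q * u) (@Phi R)); last exact: continuous_Phi.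
  by apply: differentiable_continuous; apply/derivable1_diffP.
- have cF (u : R) : {for u, continuous (fun u => Phi_primitive (p + q * u) / q)}.
    by apply: differentiable_continuous; apply/derivable1_diffP.
  split.
  + by move=> u _; case: (dF u).
  + exact: cvg_at_right_filter (cF s).
  + exact: cvg_at_left_filter (cF t).
- by move=> u _; rewrite derive1E; apply: derive_val.
Qed.

Lemma continuous_Phi_primitive (R : realType) : continuous (@Phi_primitive R).
Proof.
move=> x; apply: differentiable_continuous; apply/derivable1_diffP.
exact: (@ex_derive _ _ _ _ _ _ _ (is_derive_PhiD_pdf x)).
Qed.

Lemma Phi_primitive_mvt (R : realType) (x y : R) : x <= y ->
  Phi x * (y - x) <= Phi_primitive y - Phi_primitive x <= Phi y * (y - x).
Proof.
rewrite le_eqVlt => /predU1P[->|xy]; first by rewrite !subrr !mulr0 lexx.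
have [c] := @MVT R (@Phi_primitive R) (@Phi R) x y xy (fun z _ => is_derive_PhiD_pdf z)
  (continuous_subspaceT (@continuous_Phi_primitive R)).
rewrite in_itv /= => /andP[xc cy] ->; rewrite !ler_pM2r ?subr_gt0//.
by rewrite !ler_Phi !ltW.
Qed.

(** Convexity: moving an interval of length x to the right by y does not decrease the increment of
    [Phi_primitive] over it. *)
Lemma Phi_primitive_superadd (R : realType) (w x y : R) : 0 <= x -> 0 <= y ->
  Phi_primitive (w + x) + Phi_primitive (w + y) <=
  Phi_primitive w + Phi_primitive (w + x + y).
Proof.
wlog xy : x y / x <= y.
  move=> wlg x0 y0; have [xy|/ltW yx] := lerP x y; first exact: wlg.
  by rewrite addrC (addrAC w); exact: wlg.
move=> x0 y0; have /andP[_ h1] := @Phi_primitive_mvt _ w (w + x) (ler_wpDr x0 (lexx w)).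
have wy : w + y <= w + x + y by lra.
have /andP[h2 _] := Phi_primitive_mvt wy.
have /(ler_wpM2r x0) h3 : Phi (w + x) <= Phi (w + y) by rewrite ler_Phi lerD2l.
have e1 : w + x - w = x by lra.
have e2 : w + x + y - (w + y) = x by lra.
by rewrite e1 in h1; rewrite e2 in h2; lra.
Qed.

Lemma Phi_primitive_le_pdf (R : realType) (x : R) : x <= 0 -> Phi_primitive x <= normal_pdf 0 1 x.
Proof. by move=> x0; rewrite /Phi_primitive gerDr mulr_le0_ge0// Phi_ge0. Qed.

(** This is the Mills bound, since Phi_primitive x - x = phi x - x * Phi (- x). *)
Lemma Phi_primitive_ge (R : realType) (x : R) : 0 <= x -> x <= Phi_primitive x.
Proof.
move=> x0; have := Phi_tail_le x0; rewrite PhiN /Phi_primitive; lra.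
Qed.

Section expected_length_lower.
Context d (T : measurableType d) (R : realType) (P : probability T R).
Variable (W : R -> T -> R).
Hypothesis BW : brownian_motion P (- 2^-1) 2^-1 W.
Local Notation mu := (@lebesgue_measure R).

(* Only the total l + r of the two one-sided ranges is controlled; convexity of
   Phi_primitive makes the one-sided case the worst. *)
Lemma expected_length_lower (n alpha s l r : R) (f : R -> R)
    (CI : observation R -> \bar R * \bar R) :
  0 < n -> 0 < alpha < 1 -> confidence_intervals P W n alpha (@F_m R) CI ->
  F_m f -> 0 < s <= 2^-1 -> 0 <= l -> 0 <= r ->
  s = 2^-1 \/ f (- s) <= f 0 - l /\ f 0 + r <= f s ->
  l + r = 3 * z_ alpha / Num.sqrt (n * s) ->
  (((z_ alpha - normal_pdf 0 1 (2 * z_ alpha)) / Num.sqrt (n * s))%:E <=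
   expected_length P W n f CI)%E.
Proof.
move=> n0 a01 ci fm sI l0 r0 fs lr; set b := Num.sqrt (n * s) in lr *; set z := z_ alpha in lr *.
have /andP[s0 _] := sI.
have b0 : 0 < b by rewrite sqrtr_gt0 mulr_gt0.
have mCI : measurable_fun setT CI by case: ci.
have mI : measurable_fun setT (fun w => CI (white_noise W n f w)).
  apply: (measurableT_comp mCI).
  exact: (measurable_signal_plus_noise BW n (primitive f)).
have [mP leP] := ge0_integral_coverage P mI.
apply: le_trans leP.
set g := fun u : R => P [set w | _].
have gE u : g u = P (covers W n f CI u) by [].
have mPhi (p q : R) D : measurable_fun D (fun u => (Phi (p + q * u)%R)%:E).
  apply/measurable_EFinP; apply: (measurableT_comp (f := @Phi R)).
    exact: continuous_measurable_fun (@continuous_Phi R).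
  by apply: measurable_funD => //; exact: measurable_funM.
have Phi0 (p q u : R) : (0 <= (Phi (p + q * u)%R)%:E)%E by rewrite lee_fin Phi_ge0.
have right : (((Phi_primitive z - Phi_primitive (z - b * r)) / b)%:E <=
    \int[mu]_(u in `[f 0%R, (f 0 + r)%R]) g u)%E.
  have := @integral_Phi_affine _ (z + b * f 0) (- b) (f 0) (f 0 + r).
  rewrite oppr_eq0 gt_eqF// => /(_ isT); rewrite lerDl => /(_ r0).
  have -> : z + b * f 0 + - b * (f 0 + r) = z - b * r by lra.
  have -> : z + b * f 0 + - b * f 0 = z by lra.
  have -> : (Phi_primitive (z - b * r) - Phi_primitive z) / (- b) =
            (Phi_primitive z - Phi_primitive (z - b * r)) / b.
    by rewrite invrN mulrN -mulNr opprB.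
  move=> <-; apply: ge0_le_integral => //.
  - exact: mPhi.
  - exact: measurable_funTS.
  - move=> u /=; rewrite in_itv /= => /andP[fu uf]; rewrite gE.
    have := @coverage_shift_right _ _ _ _ _ BW n alpha (u - f 0) s f CI n0 a01 ci fm.
    rewrite subr_ge0 => /(_ fu sI).
    have -> : z_ alpha - (u - f 0) * Num.sqrt (n * s) = z + b * f 0 + - b * u.
      by rewrite -/b -/z; lra.
    rewrite (addrC (f 0)) subrK; apply; case: fs => [->|[_ fs]]; [by left|right].
    by rewrite (le_trans uf).
(* The point f 0 is left out here so that the two ranges are disjoint. *)
have left : (((Phi_primitive z - Phi_primitive (z - b * l)) / b)%:E <=
    \int[mu]_(u in `[(f 0 - l)%R, f 0%R[) g u)%E.
  rewrite integral_itv_bndo_bndc; last exact: measurable_funTS.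
  have := @integral_Phi_affine _ (z - b * f 0) b (f 0 - l) (f 0).
  rewrite gt_eqF// => /(_ isT); rewrite gerBl => /(_ l0).
  have -> : z - b * f 0 + b * (f 0 - l) = z - b * l by lra.
  have -> : z - b * f 0 + b * f 0 = z by lra.
  move=> <-; apply: ge0_le_integral => //.
  - exact: mPhi.
  - exact: measurable_funTS.
  - move=> u /=; rewrite in_itv /= => /andP[fu uf]; rewrite gE.
    have := @coverage_shift_left _ _ _ _ _ BW n alpha (f 0 - u) s f CI n0 a01 ci fm.
    rewrite subr_ge0 => /(_ uf sI).
    have -> : z_ alpha - (f 0 - u) * Num.sqrt (n * s) = z - b * f 0 + b * u.
      by rewrite -/b -/z; lra.
    rewrite opprB addrC subrK; apply; case: fs => [->|[fs _]]; [by left|right].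
    by rewrite (le_trans fs).
have lrE : b * l + b * r = 3 * z by rewrite -mulrDr lr mulrCA divff ?mulr1// gt_eqF.
apply: (@le_trans _ _ (\int[mu]_(u in `[(f 0 - l)%R, f 0%R[ `|` `[f 0%R, (f 0 + r)%R]) g u)%E); last first.
  apply: ge0_subset_integral => //; exact: measurableU.
rewrite ge0_integral_setU//; last 2 first.
- exact: measurable_funTS.
- apply/disj_setPS => u [/=]; rewrite !in_itv /= => /andP[_ uf] /andP[fu _].
  by move: (lt_le_trans uf fu); rewrite ltxx.
apply: le_trans (leeD left right); rewrite -EFinD lee_fin -mulrDl ler_pM2r ?invr_gt0//.
(* As b l + b r = 3 z, the lower limits z - b r and z - b l are -2 z + b l and -2 z + b r.
   Superadditivity replaces this pair by -2 z and z, the limits of the one-sided case. *)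
have := @Phi_primitive_superadd _ (- (2 * z)) (b * l) (b * r) (mulr_ge0 (ltW b0) l0) (mulr_ge0 (ltW b0) r0).
have -> : - (2 * z) + b * l + b * r = z by lra.
have -> : - (2 * z) + b * l = z - b * r by lra.
have -> : - (2 * z) + b * r = z - b * l by lra.
have z0 : 0 <= z by have := mulr_ge0 (ltW b0) l0; have := mulr_ge0 (ltW b0) r0; lra.
have := Phi_primitive_ge z0; have := @Phi_primitive_le_pdf _ (- (2 * z)).
rewrite normal_pdf01N => /(_ ltac:(lra)).
lra.
Qed.

End expected_length_lower.

(** * The statistics evaluated on the noise-free path, which are their means *)

Section dyadic_means.
Context (R : realType).
Variables (f : R -> R).
Hypothesis fm : F_m f.
Local Notation F := (primitive f : observation R).

Lemma dyadicS (i : nat) : (2 ^- i : R) = 2 * 2 ^- i.+1.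
Proof. by rewrite exprS invfM mulVKf// pnatr_eq0. Qed.

Lemma dyadic_gt0 (i : nat) : 0 < (2 ^- i : R).
Proof. by rewrite invr_gt0 exprn_gt0. Qed.

Lemma dyadic_le_half (i : nat) : (0 < i)%N -> (2 ^- i : R) <= 2^-1.
Proof. by case: i => // i _; rewrite lef_pV2 ?posrE ?exprn_gt0// exprS ler_peMr// exprn_ege1// ler1n. Qed.

Lemma scaled_primitive_incr (x y k : R) : - 2^-1 <= x -> x <= y -> y <= 2^-1 ->
  k * (y - x) = 1 -> f x <= k * (F y - F x) <= f y.
Proof.
move=> ax xy yb e; have /andP[h1 h2] := F_m_primitive_le fm ax xy yb.
have k0 : 0 <= k.
  have [k0//|k0] := leP 0 k; have := mulr_ge0_le0 (_ : 0 <= y - x) (ltW k0).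
  by rewrite subr_ge0 mulrC e => /(_ xy); rewrite leNgt ltr01.
have := ler_wpM2l k0 h1; have := ler_wpM2l k0 h2.
by rewrite !(mulrCA k) e !mulr1 => -> ->.
Qed.

Lemma F_m_le (x y : R) : - 2^-1 <= x -> x <= y -> y <= 2^-1 -> f x <= f y.
Proof. by move=> *; apply: fm; rewrite ?in_itv /=; lra. Qed.

(** With h = 2^-(i+1), twice xi is the difference of the averages of f over [h, 2 h] and [-2 h, -h].
    Monotonicity puts it between the differences of f at the inner and at the outer endpoints. *)
Lemma xi_primitive_bounds (i : nat) : (0 < i)%N ->
  f (2 ^- i.+1) - f (- 2 ^- i.+1) <= 2 * xi F i.+1 <= f (2 ^- i) - f (- 2 ^- i).
Proof.
move=> i0; rewrite /xi /=.
have h0 := dyadic_gt0 i.+1; have hi := dyadicS i; have hb := dyadic_le_half i0.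
have e2 : 2 * 2 ^+ i * 2 ^- i.+1 = 1 :> R by rewrite -exprS divff// expf_neq0// pnatr_eq0.
move: h0 hi hb e2; set h := (2 ^- i.+1 : R); set h' := (2 ^- i : R); set k := (2 ^+ i : R).
clearbody h h' k => h0 hi hb e2.
have := @scaled_primitive_incr h h' (2 * k); have := @scaled_primitive_incr (- h') (- h) (2 * k).
have -> : 2 * k * (- h - - h') = 1 by rewrite hi -[RHS]e2; lra.
have -> : 2 * k * (h' - h) = 1 by rewrite hi -[RHS]e2; lra.
move=> /(_ ltac:(lra) ltac:(lra) ltac:(lra) erefl)/andP[a1 a2].
move=> /(_ ltac:(lra) ltac:(lra) ltac:(lra) erefl)/andP[b1 b2].
by apply/andP; split; lra.
Qed.

(** The outer difference of a level is the inner difference of the coarser level before it, so the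
    bounds of [xi_primitive_bounds] chain. *)
Lemma xi_primitive_nonincr (i j : nat) : (1 < i)%N -> (i <= j)%N -> xi F j <= xi F i.
Proof.
move=> i1; elim: j => [|j ih]; first by rewrite leqn0 => /eqP <-.
rewrite leq_eqVlt => /predU1P[->//|]; rewrite ltnS => ij; apply: le_trans (ih ij).
case: j ij {ih} => [|j] ij; first by move: (leq_trans i1 ij).
have j0 : (0 < j)%N by exact: leq_trans i1 ij.
have /andP[h1 _] := xi_primitive_bounds j0; have /andP[_ h2] := @xi_primitive_bounds j.+1 isT.
lra.
Qed.

(** Here the averages are over the intervals adjacent to 0, so their difference is at most the inner
    difference f (2^-j) - f (- 2^-j) of xi_j. *)
Lemma delta_primitive_bounds (j : nat) : (1 < j)%N ->
  0 <= deltaR F j - deltaL F j <= 2 * xi F j.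
Proof.
case: j => // j; rewrite ltnS => j0; have /andP[h _] := xi_primitive_bounds j0.
have h0 := dyadic_gt0 j.+1; have hb := @dyadic_le_half j.+1 isT.
have e : 2 ^+ j.+1 * 2 ^- j.+1 = 1 :> R by rewrite divff// expf_neq0// pnatr_eq0.
rewrite /deltaR /deltaL; move: h0 hb h e.
set h := (2 ^- j.+1 : R); set k := (2 ^+ j.+1 : R); clearbody h k => h0 hb hx e.
have := @scaled_primitive_incr 0 h k; have := @scaled_primitive_incr (- h) 0 k.
rewrite subr0 add0r opprK e.
move=> /(_ ltac:(lra) ltac:(lra) ltac:(lra) erefl)/andP[a1 a2].
move=> /(_ ltac:(lra) ltac:(lra) ltac:(lra) erefl)/andP[b1 b2].
by apply/andP; split; lra.
Qed.

End dyadic_means.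

Section sigma.
Context (R : realType) (n : R).
Hypothesis n0 : 0 < n.

Lemma sigma_gt0 (i : nat) : 0 < sigma_ n i.
Proof. by rewrite sqrtr_gt0 divr_gt0// exprn_gt0. Qed.

Lemma sigmaS (i : nat) : (0 < i)%N -> sigma_ n i.+1 = Num.sqrt 2 * sigma_ n i.
Proof.
by case: i => // i _; rewrite /sigma_ /= exprS -mulrA sqrtrM.
Qed.

(** The scale 1 / sqrt (n s) of the lower bound at s = 2^-(i-1) is the standard deviation of xi_i,
    which makes the two bounds comparable. *)
Lemma sigma_inv (i : nat) : (Num.sqrt (n * 2 ^- i.-1))^-1 = sigma_ n i.
Proof. by rewrite /sigma_ -sqrtrV ?mulr_ge0 ?invr_ge0 ?exprn_ge0 ?(ltW n0)// invfM invrK mulrC. Qed.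

Lemma sigma_unbounded (M : R) : exists i, (1 < i)%N /\ M <= sigma_ n i.
Proof.
exists (Num.truncn (n * M ^+ 2)).+2; split=> //; rewrite /sigma_ /=.
rewrite (le_trans (ler_norm M))// -sqrtr_sqr ler_wsqrtr// ler_pdivlMr// mulrC.
have : n * M ^+ 2 < (Num.truncn (n * M ^+ 2)).+1%:R by exact: truncnS_gt.
move=> /ltW/le_trans; apply; rewrite -natrX ler_nat.
exact/ltnW/ltn_expl.
Qed.

End sigma.

Lemma z_gt0 (R : realType) (alpha : R) : 0 < alpha -> alpha < 2^-1 -> 0 < z_ alpha.
Proof.
move=> a0 a2; rewrite -ltr_Phi Phi0 Phi_z_//; lra.
Qed.

Section Lstar_lower.
Context d (T : measurableType d) (R : realType) (P : probability T R).
Variable (W : R -> T -> R).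
Hypothesis BW : brownian_motion P (- 2^-1) 2^-1 W.

Lemma Lstar_lower (n alpha : R) (f : R -> R) (J : nat) :
  0 < n -> 0 < alpha < 2^-1 -> F_m f -> (1 < J)%N ->
  (forall i, (1 < i)%N -> (i < J)%N -> ~~ stops n alpha (primitive f) i) ->
  normal_pdf 0 1 (2 * z_ alpha) <= z_ alpha ->
  ((sigma_ n J / Num.sqrt 2 * (z_ alpha - normal_pdf 0 1 (2 * z_ alpha)))%:E <=
   Lstar P W n alpha f (@F_m R))%E.
Proof.
move=> n0 a01 fm J1 nst zphi; have [a0 a2] := andP a01.
have a1 : 0 < alpha < 1 by lra.
have z0 := z_gt0 a0 a2.
apply: le_ereal_inf_tmp => _ [CI ci <-].
have s2 : 0 < Num.sqrt 2 :> R by rewrite sqrtr_gt0.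
have lower (s l r : R) := @expected_length_lower _ _ _ _ _ BW n alpha s l r f CI n0 a1 ci fm.
case: J J1 nst => // -[//|[|J]] _ nst.
(* For J = 2 no earlier level constrains f. The choice s = 1/2 allows perturbations of any size, and
   the whole range is put on the left. *)
- have h := @lower (2^-1) (3 * z_ alpha / Num.sqrt (n * 2^-1)) 0.
  have e1 : (2^-1 : R) = 2 ^- 2.-1 by rewrite expr1.
  have e : (Num.sqrt (n * 2^-1))^-1 = sigma_ n 2 by rewrite [in LHS]e1 sigma_inv.
  rewrite e addr0 in h; apply: le_trans (h _ _ _ _ _) => //.
  + rewrite lee_fin mulrC ler_wpM2l ?subr_ge0// ler_pdivrMr// ler_peMr ?(ltW (sigma_gt0 _ _))//.
    by rewrite -[leLHS]sqrtr1 ler_wsqrtr// ler1n.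
  + by rewrite invr_gt0 ltr0n lexx.
  + by rewrite !mulr_ge0// ?(ltW z0)// ltW// sigma_gt0.
  + by left.
  + by rewrite addr0.
- have := nst J.+2 isT (ltnSn _); rewrite /stops /= -ltNge => xiJ.
  have sI : 0 < (2 ^- J.+1 : R) <= 2^-1 by rewrite dyadic_gt0 dyadic_le_half.
  have /andP[s0 sb] := sI.
  have /andP[_ hx] := @xi_primitive_bounds _ f fm J.+1 isT.
  have sg := sigma_gt0 n0 J.+2.
  have e : (Num.sqrt (n * 2 ^- J.+1))^-1 = sigma_ n J.+2 by rewrite -sigma_inv.
  (* The preceding level did not stop, so f rises by more than 3 z_alpha sigma over the window. The
     right side takes as much of this as it can, and the left side supplies the remainder. *)
  pose r := Num.min (f (2 ^- J.+1) - f 0) (3 * z_ alpha * sigma_ n J.+2).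
  have f0 : f 0 <= f (2 ^- J.+1) by apply: (F_m_le fm); lra.
  have f1 : f (- 2 ^- J.+1) <= f 0 by apply: (F_m_le fm); lra.
  have zs : 0 < z_ alpha * sigma_ n J.+2 by rewrite mulr_gt0.
  have := @lower (2 ^- J.+1) (3 * z_ alpha * sigma_ n J.+2 - r) r.
  have -> : sigma_ n J.+3 / Num.sqrt 2 = sigma_ n J.+2.
    by rewrite sigmaS// mulrAC divff ?mul1r ?gt_eqF.
  rewrite e subrK (mulrC (sigma_ _ _)); apply => //.
  + by rewrite subr_ge0 ge_min lexx orbT.
  + by rewrite le_min subr_ge0 f0 /= -mulrA mulr_ge0// ltW.
  + right; split; last by rewrite addrC -lerBrDr ge_min lexx.
    rewrite /r /Num.min; case: ifP => _; lra.
Qed.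

(** Without noise, xi never exceeds its value at level 2, while sigma is unbounded. *)
Lemma stops_primitive_ex (n alpha : R) (f : R -> R) :
  0 < n -> 0 < alpha < 2^-1 -> F_m f ->
  exists J, [/\ (1 < J)%N, stops n alpha (primitive f) J &
    forall i, (i < J)%N -> ~~ stops n alpha (primitive f) i].
Proof.
move=> n0 /andP[a0 a2] fm; have z0 := z_gt0 a0 a2.
have ex : exists j, stops n alpha (primitive f) j.
  have [i [i1 hi]] := sigma_unbounded n0 (xi (primitive f) 2 / (3 / 2 * z_ alpha)).
  exists i; rewrite /stops i1 /= (le_trans (xi_primitive_nonincr fm _ i1))//.
  by rewrite mulrC -ler_pdivrMr// mulr_gt0.
exists (ex_minn ex); case: ex_minnP => J sJ minJ; split => //.
- by case/andP: sJ.
- by move=> i iJ; apply/negP => /minJ; rewrite leqNgt iJ.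
Qed.

End Lstar_lower.

(** * Upper bound *)

Section second_differences.
Context d (T : measurableType d) (R : realType) (P : probability T R).
Variable (W : R -> T -> R).
Hypothesis BW : brownian_motion P (- 2^-1) 2^-1 W.

Lemma normal_law_cst (m : R) : normal_law P (cst m) m 0.
Proof.
move=> A mA; have -> : (fun x => m + 0 * x) @^-1` A = cst m @^-1` A.
  by apply/seteqP; split => x /=; rewrite mul0r addr0.
have [Am|nAm] := pselect (A m).
  have -> : cst m @^-1` A = [set: T] by apply/seteqP; split.
  have -> : cst m @^-1` A = [set: R] by apply/seteqP; split.
  by rewrite !probability_setT.
have -> : cst m @^-1` A = set0 :> set T by apply/seteqP; split.
have -> : cst m @^-1` A = set0 :> set R by apply/seteqP; split.
by rewrite !measure0.
Qed.

Lemma normal_law_ext (X Y : T -> R) (m s m' s' : R) :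
  X =1 Y -> m = m' -> s = s' -> normal_law P X m s -> normal_law P Y m' s'.
Proof. by move=> /funext -> -> ->. Qed.

(** A combination of three consecutive increments with weights -r, 0 and r; the weight 0 on the gap
    from b to c also covers the case b = c. *)
Lemma brownian_second_difference_law (a b c e r : R) :
  - 2^-1 <= a -> a < b -> b <= c -> c < e -> e <= 2^-1 -> 0 <= r ->
  normal_law P (fun w => r * ((W e w - W c w) - (W b w - W a w))) 0
    (r * Num.sqrt ((e - c) + (b - a))).
Proof.
move=> ia ab bc ce ei r0.
pose t (i : nat) : R := nth 0 [:: a; b; c; e] i.
have tI i : (i <= 3)%N -> t i \in `[- 2^-1, 2^-1].
  by case: i => [|[|[|[|//]]]] _; rewrite /t /= in_itv /=; lra.
have tle i : (i < 3)%N -> t i <= t i.+1.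
  by case: i => [|[|[|//]]] _; rewrite /t /= ?(ltW ab) ?(ltW ce).
pose co (i : nat) : R := nth 0 [:: - r; 0; r] i.
have ind := mutually_independent_comp (g := fun i x => co i * x)
  (brownian_increments_independent BW tI tle).
pose sd (i : nat) : R := nth 0 [:: - r * Num.sqrt (b - a); 0; r * Num.sqrt (e - c)] i.
have mX i : (i < 3)%N -> measurable_fun [set: T] (fun w => co i * (W (t i.+1) w - W (t i) w)).
  move=> i3; apply: measurable_funM => //.
  by apply: measurable_funB; case: BW => mW _ _ _ _; apply: mW; apply: tI => //; exact: ltnW.
have law i : (i < 3)%N ->
    normal_law P (fun w => co i * (W (t i.+1) w - W (t i) w)) 0 (sd i).
  case: i => [|[|[|//]]] _; rewrite /co /sd /t /=.
  - apply: normal_law_ext (normal_law_affine 0 (- r) (brownian_increment_law BW ia ab _)).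
    + by move=> w; rewrite add0r.
    + by rewrite mulr0 addr0.
    + by [].
    + lra.
  - by apply: normal_law_ext (normal_law_cst 0) => // w /=; rewrite mul0r.
  - apply: normal_law_ext (normal_law_affine 0 r (brownian_increment_law BW _ ce ei)).
    + by move=> w; rewrite add0r.
    + by rewrite mulr0 addr0.
    + by [].
    + lra.
have nl := normal_law_sum mX (ind (fun i _ => mulrl_measurable (co i))) law.
apply: normal_law_ext nl.
- by move=> w; rewrite !big_ord_recr big_ord0 /= /co /t /=; lra.
- by rewrite big1.
- rewrite !big_ord_recr big_ord0 /= /sd /= !exprMn !sqr_sqrtr ?subr_ge0 ?ltW//.
  rewrite expr0n/= add0r addr0 sqrrN -mulrDr sqrtrM ?sqr_ge0// sqrtr_sqr ger0_norm//.
  by rewrite addrC.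
Qed.

Lemma signal_second_difference_law (n : R) (F : R -> R) (a b c e r s : R) :
  0 < n -> - 2^-1 <= a -> a < b -> b <= c -> c < e -> e <= 2^-1 -> 0 <= r -> 0 <= s ->
  s ^+ 2 = r ^+ 2 * ((e - c) + (b - a)) / n ->
  let Y := signal_plus_noise W n F in
  normal_law P (fun w => r * (Y w e - Y w c) - r * (Y w b - Y w a))
    (r * (F e - F c) - r * (F b - F a)) s.
Proof.
move=> n0 ia ab bc ce ei r0 s0 sE Y.
apply: normal_law_ext (normal_law_affine (r * (F e - F c) - r * (F b - F a)) (Num.sqrt n)^-1
  (brownian_second_difference_law ia ab bc ce ei r0)).
- move=> w; rewrite /Y /signal_plus_noise; set k := (Num.sqrt n)^-1; clearbody k; lra.
- by rewrite mulr0 addr0.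
- have -> : s = Num.sqrt (r ^+ 2 * (e - c + (b - a)) / n).
    by rewrite -sE sqrtr_sqr ger0_norm.
  have eb : 0 <= e - c + (b - a) by lra.
  rewrite -mulrA sqrtrM ?sqr_ge0// sqrtr_sqr ger0_norm// sqrtrM// sqrtrV ?ltW//.
  by rewrite mulrC mulrA.
Qed.

End second_differences.

(* The i-th statistic depends only on the i-th pair of symmetric increments of
   the grid -1/2, ..., -2^-j, 0, 2^-j, ..., 1/2. *)
Definition level_stat (R : realType) (y : observation R) (j i : nat) : R :=
  if (i.+1 < j)%N then xi y i.+2 else deltaR y j - deltaL y j.

Lemma mutually_independent_ext d (T : measurableType d) (R : realType) (P : probability T R)
    d' (T' : measurableType d') (k : nat) (X Y : nat -> T -> T') :
  (forall i, (i < k)%N -> X i =1 Y i) -> mutually_independent P k X ->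
  mutually_independent P k Y.
Proof.
move=> XY iX A mA; have := iX A mA.
have -> : [set w | forall i, (i < k)%N -> A i (X i w)] =
          [set w | forall i, (i < k)%N -> A i (Y i w)].
  by apply/seteqP; split => w /= h i ik; have := h i ik; rewrite XY.
move=> ->; apply: eq_bigr => i _; congr (P _).
by apply/seteqP; split => w /=; rewrite XY.
Qed.

(** * Laws and independence of the level statistics *)

Section level_statistics.
Context d (T : measurableType d) (R : realType) (P : probability T R).
Variable (W : R -> T -> R).
Hypothesis BW : brownian_motion P (- 2^-1) 2^-1 W.
Variables (n : R) (F : R -> R).
Hypothesis n0 : 0 < n.
Local Notation Y := (signal_plus_noise W n F).

Lemma xi_law (i : nat) : (1 < i)%N ->
  normal_law P (fun w => xi (Y w) i) (xi F i) (sigma_ n i).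
Proof.
case: i => // i; rewrite ltnS => i0.
have h0 := @dyadic_gt0 R i.+1; have hi := @dyadicS R i; have hb := @dyadic_le_half R _ i0.
apply: (signal_second_difference_law BW _ n0).
- lra.
- lra.
- lra.
- lra.
- lra.
- by rewrite exprn_ge0.
- exact: ltW (sigma_gt0 n0 _).
- rewrite /sigma_ /= sqr_sqrtr ?divr_ge0 ?exprn_ge0 ?(ltW n0)//; congr (_ / _).
  have -> : 2 ^- i - 2 ^- i.+1 + (- 2 ^- i.+1 - - 2 ^- i) = 2 ^- i :> R by lra.
  by rewrite expr2 mulfK// expf_neq0// pnatr_eq0.
Qed.

Lemma delta_law (j : nat) : (1 < j)%N ->
  normal_law P (fun w => deltaR (Y w) j - deltaL (Y w) j) (deltaR F j - deltaL F j)
    (2 * sigma_ n j).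
Proof.
case: j => // j; rewrite ltnS => j0.
have h0 := @dyadic_gt0 R j.+1; have hb := @dyadic_le_half R j.+1 isT.
apply: (signal_second_difference_law BW _ n0).
- lra.
- lra.
- lra.
- lra.
- lra.
- by rewrite exprn_ge0.
- by rewrite mulr_ge0// ltW// sigma_gt0.
- rewrite exprMn /sigma_ /= sqr_sqrtr ?divr_ge0 ?exprn_ge0 ?(ltW n0)// mulrA; congr (_ / _).
  have -> : 2 ^- j.+1 - 0 + (0 - - 2 ^- j.+1) = 2 ^- j :> R by rewrite (@dyadicS R j); lra.
  by rewrite [2 ^+ j.+1]exprS exprMn (expr2 (2 ^+ j)) !mulrA mulfK// expf_neq0// pnatr_eq0.
Qed.

Lemma level_stat_independent (j : nat) : (1 < j)%N ->
  mutually_independent P j (fun i w => level_stat (Y w) j i).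
Proof.
move=> j1.
(* Past the centre, index i carries the exponent 2 j + 1 - i, so that cells i and 2 j - (i + 1) are
   mirror images, as in [mutually_independent_pairs]. *)
pose t (i : nat) : R := if (i < j)%N then - 2 ^- i.+1 else
  if i == j then 0 else 2 ^- (j + j + 1 - i).
have tI i : (i <= j + j)%N -> t i \in `[- 2^-1, 2^-1].
  rewrite in_itv /= /t => ij; case: ltnP => ji.
    by have := @dyadic_gt0 R i.+1; have := @dyadic_le_half R i.+1 isT; lra.
  case: eqP => [_|/eqP ne]; first by lra.
  have k0 : (0 < j + j + 1 - i)%N by lia.
  by have := @dyadic_gt0 R (j + j + 1 - i); have := @dyadic_le_half R _ k0; lra.
have tle i : (i < j + j)%N -> t i <= t i.+1.
  rewrite /t => ij; case: ltngtP => ji.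
  - case: ltngtP => ji'; last first.
    + by have := @dyadic_gt0 R i.+1; lra.
    + by lia.
    + by have := @dyadic_gt0 R i.+2; rewrite (@dyadicS R i.+1); lra.
  - have -> : (i.+1 < j)%N = false by lia.
    have -> : (i.+1 == j)%N = false by lia.
    have -> : (j + j + 1 - i = (j + j + 1 - i.+1).+1)%N by lia.
    by have := @dyadic_gt0 R (j + j + 1 - i.+1).+1; rewrite (@dyadicS R (j + j + 1 - i.+1)); lra.
  - have -> : (i.+1 < j)%N = false by lia.
    have -> : (i.+1 == j)%N = false by lia.
    by have := @dyadic_gt0 R (j + j + 1 - i.+1); lra.
pose X (i : nat) (w : T) := W (t i.+1) w - W (t i) w.
have mX i : (i < j + j)%N -> measurable_fun [set: T] (X i).
  move=> ij; apply: (measurable_brownian_increment BW); apply: tI => //; exact: ltnW.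
have ind := mutually_independent_pairs mX (brownian_increments_independent BW tI tle).
(* [r i] scales the i-th pair of increments, and [m i] is the value of the statistic on the signal
   alone. *)
pose r i : R := if (i.+1 < j)%N then 2 ^+ i.+1 else 2 ^+ j.
pose m i : R := r i * (F (t (j + j - i.+1).+1) - F (t (j + j - i.+1)%N)) -
  r i * (F (t i.+1) - F (t i)).
apply: mutually_independent_ext (mutually_independent_comp
  (g := fun i (x : R * R) => m i + (Num.sqrt n)^-1 * (r i * (x.2 - x.1))) ind _).
  move=> i ij w; rewrite /= /X /m /r /level_stat /t.
  case: (ltnP i.+1 j) => ij'.
  - rewrite (ltnW ij').
    have -> : (j + j - i.+1 < j)%N = false by lia.
    have -> : (j + j - i.+1 == j)%N = false by lia.
    have -> : ((j + j - i.+1).+1 < j)%N = false by lia.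
    have -> : ((j + j - i.+1).+1 == j)%N = false by lia.
    have -> : (j + j + 1 - (j + j - i.+1).+1 = i.+1)%N by lia.
    have -> : (j + j + 1 - (j + j - i.+1) = i.+2)%N by lia.
    rewrite /xi /= /signal_plus_noise.
    set k := (Num.sqrt n)^-1; set u := (2 ^+ i.+1); clearbody k u; lra.
  - have ji : j = i.+1 by lia.
    rewrite ji addnK leqnn ltnn eqxx.
    have -> : (i.+2 < i.+1)%N = false by lia.
    have -> : (i.+2 == i.+1)%N = false by lia.
    have -> : (i.+1 + i.+1 + 1 - i.+2 = i.+1)%N by lia.
    rewrite /deltaR /deltaL /signal_plus_noise.
    set k := (Num.sqrt n)^-1; set u := (2 ^+ i.+1); clearbody k u; lra.
move=> i ij; apply: measurable_funD => //; apply: measurable_funM => //.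
by apply: measurable_funM => //; apply: measurable_funB; [exact: measurable_snd|exact: measurable_fst].
Qed.

Lemma measurable_level_stat (j i : nat) : (1 < j)%N -> measurable_fun [set: T] (fun w => level_stat (Y w) j i).
Proof.
have mY t : t \in `[- 2^-1, 2^-1] -> measurable_fun [set: T] (fun w => Y w t).
  move=> tI; apply: measurable_funD => //; apply: measurable_funM => //.
  by case: BW => mW _ _ _ _; exact: mW.
have dI k : (0 < k)%N -> (2 ^- k : R) \in `[- 2^-1, 2^-1] /\ (- 2 ^- k : R) \in `[- 2^-1, 2^-1].
  move=> k0; rewrite !in_itv /=; have := @dyadic_gt0 R k; have := @dyadic_le_half R _ k0.
  by split; lra.
move=> j1; rewrite /level_stat; case: (i.+1 < j)%N.
  rewrite /xi /=; have [a1 b1] := dI i.+1 isT; have [a2 b2] := dI i.+2 isT.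
  by apply: measurable_funB; apply: measurable_funM => //; apply: measurable_funB; exact: mY.
rewrite /deltaR /deltaL; have [a1 b1] := dI j (ltnW j1).
have c1 : (0 : R) \in `[- 2^-1, 2^-1] by rewrite in_itv /=; lra.
by apply: measurable_funB; apply: measurable_funM => //; apply: measurable_funB; exact: mY.
Qed.

End level_statistics.

Lemma normal_pdf01_nonincr (R : realType) (x y : R) : 0 <= x -> x <= y ->
  normal_pdf 0 1 y <= normal_pdf 0 1 x.
Proof.
move=> x0 xy; rewrite !normal_pdf01E ler_pM2l ?normal_peak1_gt0// ler_expR.
by rewrite !mulNr lerN2 ler_pM2r// lerXn2r// nnegrE (le_trans x0).
Qed.

(** * The stopped length as a product over independent levels *)

Section stopping.
Context (R : realType).
Variables (n alpha : R).
Hypothesis n0 : 0 < n.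
Implicit Types (y : observation R) (j : nat).

Lemma jhat_SomeP y j : reflect
  (stops n alpha y j /\ forall i, (i < j)%N -> ~~ stops n alpha y i) (jhat n alpha y == Some j).
Proof.
rewrite /jhat; case: pselect => [ex|nex]; last first.
  by apply: (iffP idP) => // -[sj _]; exfalso; apply: nex; exists j.
case: ex_minnP => m sm minm; apply: (iffP eqP) => [[<-]|[sj nj]].
  by split => // i im; apply/negP => /minm; rewrite leqNgt im.
congr Some; apply/eqP; rewrite eqn_leq minm//= leqNgt; apply/negP => mj.
by have := nj m mj; rewrite sm.
Qed.

Lemma interval_length_CIm y j : interval_length (CIm n alpha y j) =
  (Num.max (deltaR y j - deltaL y j + 2 * (Num.sqrt 2 * z_ (alpha / 2)) * sigma_ n j) 0)%:E.
Proof.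
rewrite /interval_length /CIm /= -EFinB -EFin_max; congr ((Num.max _ 0)%:E); lra.
Qed.

(** Factors whose product over i < j is the length of the level-j interval on the event jhat = j,
    and 0 off it. For i < j - 1 the coordinate is xi at level i + 2, which must continue, or stop if
    i = j - 2; coordinate j - 1 carries the length. *)
Definition level_weight (j i : nat) (x : R) : R :=
  if (i.+1 == j)%N then Num.max (x + 2 * (Num.sqrt 2 * z_ (alpha / 2)) * sigma_ n j) 0
  else if (i.+2 == j)%N then (x <= 3 / 2 * z_ alpha * sigma_ n j)%R%:R
  else (3 / 2 * z_ alpha * sigma_ n i.+2 < x)%R%:R.

Lemma level_weight_ge0 (j i : nat) (x : R) : 0 <= level_weight j i x.
Proof.
rewrite /level_weight; case: eqP => _; first by rewrite le_max lexx orbT.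
by case: eqP.
Qed.

Lemma measurable_level_weight (j i : nat) : measurable_fun setT (level_weight j i).
Proof.
rewrite /level_weight; case: eqP => _.
  by apply: measurable_maxr => //; exact: measurable_funD.
have mb (f : R -> bool) : measurable_fun setT f -> measurable_fun setT (fun x => (f x)%:R : R).
  by move=> mf; apply: (measurableT_comp (f := fun b : bool => b%:R : R)).
case: eqP => _; apply: mb.
  exact: measurable_fun_ler.
exact: measurable_fun_ltr.
Qed.

Lemma level_weight_length (k : nat) (x : R) : level_weight k.+2 k.+1 x =
  Num.max (x + 2 * (Num.sqrt 2 * z_ (alpha / 2)) * sigma_ n k.+2) 0.
Proof. by rewrite /level_weight eqxx. Qed.

Lemma level_weight_stop (k : nat) (x : R) :
  level_weight k.+2 k x = (x <= 3 / 2 * z_ alpha * sigma_ n k.+2)%R%:R.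
Proof. by rewrite /level_weight eqSS ltn_eqF// eqxx. Qed.

Lemma level_weight_continue (k i : nat) (x : R) : (i < k)%N ->
  level_weight k.+2 i x = (3 / 2 * z_ alpha * sigma_ n i.+2 < x)%R%:R.
Proof. by move=> ik; rewrite /level_weight !eqSS !ltn_eqF// ltnW. Qed.

Lemma prod_level_weight y (k : nat) :
  (\prod_(i < k.+2) level_weight k.+2 i (level_stat y k.+2 i))%:E =
  (if jhat n alpha y == Some k.+2 then interval_length (CIm n alpha y k.+2) else 0)%E.
Proof.
rewrite !big_ord_recr /= level_weight_length level_weight_stop interval_length_CIm.
have -> : \prod_(i < k) level_weight k.+2 i (level_stat y k.+2 i) =
    [forall i : 'I_k, ~~ stops n alpha y i.+2]%:R.
  have -> : [forall i : 'I_k, ~~ stops n alpha y i.+2]%:R =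
      \prod_(i < k) (~~ stops n alpha y i.+2)%:R :> R.
    have [/forallP h|] := boolP [forall i : 'I_k, ~~ stops n alpha y i.+2].
      by rewrite big1// => i _; rewrite h.
    by rewrite negb_forall => /existsP[i hi]; rewrite (bigD1 i)//= (negbTE hi) mul0r.
  apply: eq_bigr => i _; have ik := ltn_ord i.
  by rewrite level_weight_continue// /level_stat !ltnS (ltnW ik) /stops /= -ltNge.
rewrite /level_stat !ltnS ltnn leqnn.
have -> : (jhat n alpha y == Some k.+2) =
    [forall i : 'I_k, ~~ stops n alpha y i.+2] && (xi y k.+2 <= 3 / 2 * z_ alpha * sigma_ n k.+2).
  apply/jhat_SomeP/andP.
    by move=> [/andP[_ s] ns]; split => //; apply/forallP => i; apply: ns; rewrite !ltnS.
  move=> [/forallP h s]; split; first by rewrite /stops.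
  by move=> [|[|i]]// ik; exact: (h (Ordinal (ik : (i < k)%N))).
by case: [forall i, _]; case: (_ <= _)%R; rewrite /= ?mul1r ?mul0r.
Qed.

End stopping.

Lemma measurable_set_gt d (T : measurableType d) (R : realType) (g : T -> R) (c : R) : measurable_fun setT g ->
  measurable [set w | c < g w].
Proof.
move=> mg; have := mg measurableT _ (measurable_itv `]c, +oo[); rewrite setTI.
by congr measurable; apply/seteqP; split => w /=; rewrite in_itv /= andbT.
Qed.

Lemma measurable_set_le d (T : measurableType d) (R : realType) (g : T -> R) (c : R) : measurable_fun setT g ->
  measurable [set w | g w <= c].
Proof.
move=> mg; have := mg measurableT _ (measurable_itv `]-oo, c]); rewrite setTI.
by congr measurable; apply/seteqP; split => w /=; rewrite in_itv.
Qed.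

Section level_integrals.
Context d (T : measurableType d) (R : realType) (P : probability T R).
Variable (W : R -> T -> R).
Hypothesis BW : brownian_motion P (- 2^-1) 2^-1 W.
Variables (n alpha : R) (f : R -> R).
Hypotheses (n0 : 0 < n) (fm : F_m f).
Local Notation F := (primitive f : observation R).
Local Notation Y := (signal_plus_noise W n (primitive f)).
Local Notation tau := (3 / 2 * z_ alpha).
Local Notation h := (Num.sqrt 2 * z_ (alpha / 2)).

Definition signal_to_noise (i : nat) : R := xi F i.+2 / sigma_ n i.+2.

Lemma xi_continue_prob (i : nat) :
  P [set w | tau * sigma_ n i.+2 < xi (Y w) i.+2] = (Phi (signal_to_noise i - tau))%:E.
Proof.
rewrite (normal_law_gt _ (sigma_gt0 n0 _) (xi_law BW _ n0 _))//; congr ((Phi _)%:E).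
by rewrite mulrBl mulfK// gt_eqF// sigma_gt0.
Qed.

Lemma xi_stop_prob (i : nat) :
  P [set w | xi (Y w) i.+2 <= tau * sigma_ n i.+2] = (Phi (tau - signal_to_noise i))%:E.
Proof.
rewrite (normal_law_le _ (sigma_gt0 n0 _) (xi_law BW _ n0 _))//; congr ((Phi _)%:E).
by rewrite mulrBl mulfK// gt_eqF// sigma_gt0.
Qed.

Lemma integral_event (b : T -> bool) : measurable [set w | b w] ->
  (\int[P]_w ((b w)%:R : R)%:E = P [set w | b w])%E.
Proof.
move=> mb; apply: (eq_trans _ (eq_trans (integral_indic P measurableT mb) _)); last by rewrite setIT.
by apply: eq_integral => w _; rewrite indicE /=; congr ((_ : bool)%:R)%:E; apply/idP/idP; rewrite inE.
Qed.

(** The length is the positive part of a normal variable with standard deviation 2 sigma_j and mean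
    at least h times that, so the density in [ge0_integral_normal_law_pos_part] is at most the
    density at h. The bias is at most 2 xi. *)
Lemma expected_level_length (j : nat) : (1 < j)%N -> 0 <= z_ (alpha / 2) ->
  (\int[P]_w (Num.max (deltaR (Y w) j - deltaL (Y w) j + 2 * h * sigma_ n j) 0)%:E <=
   (2 * xi F j + (2 * h + 2 * normal_pdf 0 1 h) * sigma_ n j)%:E)%E.
Proof.
move=> j1 z0; have sg := sigma_gt0 n0 j.
have /andP[d0 d1] := delta_primitive_bounds fm j1.
have h0 : 0 <= h by rewrite mulr_ge0.
have hs : 0 <= 2 * h * sigma_ n j by rewrite !mulr_ge0// ltW.
have nl := normal_law_affine (2 * h * sigma_ n j) 1 (delta_law BW (primitive f) n0 j1).
have nl' : normal_law P (fun w => deltaR (Y w) j - deltaL (Y w) j + 2 * h * sigma_ n j)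
    (deltaR F j - deltaL F j + 2 * h * sigma_ n j) (2 * sigma_ n j).
  by apply: normal_law_ext nl => [w||]; rewrite !mul1r 1?addrC.
apply: le_trans (ge0_integral_normal_law_pos_part _ _ _ nl') _.
- have mj := @measurable_level_stat _ _ _ _ _ BW n (primitive f) j j.-1 j1.
  apply: measurable_funD => //; move: mj; rewrite /level_stat prednK ?ltnn//.
  exact: ltnW.
- by rewrite addr_ge0.
- by rewrite mulr_gt0.
rewrite lee_fin; have le : h <= (deltaR F j - deltaL F j + 2 * h * sigma_ n j) / (2 * sigma_ n j).
  by rewrite ler_pdivlMr ?mulr_gt0//; lra.
have := ler_wpM2l (mulr_ge0 (ler0n R 2) (ltW sg)) (normal_pdf01_nonincr h0 le).
lra.
Qed.

Lemma measurable_xi_signal (i : nat) : measurable_fun setT (fun w => xi (Y w) i.+2).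
Proof.
have := @measurable_level_stat _ _ _ _ _ BW n (primitive f) i.+3 i isT.
by rewrite /level_stat leqnSn.
Qed.

Lemma integral_level (k : nat) : 0 <= z_ (alpha / 2) ->
  (\int[P]_w (\prod_(i < k.+2) level_weight n alpha k.+2 i (level_stat (Y w) k.+2 i))%:E <=
   ((\prod_(i < k) Phi (signal_to_noise i - tau)) * (Phi (tau - signal_to_noise k) *
     (2 * xi F k.+2 + (2 * h + 2 * normal_pdf 0 1 h) * sigma_ n k.+2)))%:E)%E.
Proof.
move=> z0; set c := (2 * h + _) * _.
have mU (i : nat) : measurable_fun [set: T] (fun w => level_stat (Y w) k.+2 i).
  exact: (measurable_level_stat BW).
have lsE (i : nat) w : (i <= k)%N -> level_stat (Y w) k.+2 i = xi (Y w) i.+2.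
  by move=> ik; rewrite /level_stat !ltnS ik.
have mxi := measurable_xi_signal.
have Econt (i : nat) : (i < k)%N ->
    (\int[P]_w (level_weight n alpha k.+2 i (level_stat (Y w) k.+2 i))%:E =
     (Phi (signal_to_noise i - tau))%:E)%E.
  move=> ik; under eq_integral do rewrite level_weight_continue// (lsE _ _ (ltnW ik)).
  rewrite integral_event; first exact: xi_continue_prob.
  exact: measurable_set_gt (mxi i).
have Estop : (\int[P]_w (level_weight n alpha k.+2 k (level_stat (Y w) k.+2 k))%:E =
     (Phi (tau - signal_to_noise k))%:E)%E.
  under eq_integral do rewrite level_weight_stop (lsE _ _ (leqnn k)).
  rewrite integral_event; first exact: xi_stop_prob.
  exact: measurable_set_le (mxi k).
have Elen : (\int[P]_w (level_weight n alpha k.+2 k.+1 (level_stat (Y w) k.+2 k.+1))%:E <=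
     (2 * xi F k.+2 + c)%:E)%E.
  apply: le_trans (expected_level_length _ z0) => //.
  rewrite le_eqVlt; apply/orP; left; apply/eqP; apply: eq_integral => w _.
  by rewrite level_weight_length /level_stat ltnn.
have Elen0 : (0 <= \int[P]_w (level_weight n alpha k.+2 k.+1 (level_stat (Y w) k.+2 k.+1))%:E)%E.
  by apply: integral_ge0 => w _; rewrite lee_fin level_weight_ge0.
have Efin : (\int[P]_w (level_weight n alpha k.+2 k.+1 (level_stat (Y w) k.+2 k.+1))%:E)%E
    \is a fin_num.
  by rewrite ge0_fin_numE// (le_lt_trans Elen)// ltry.
rewrite (mutually_independent_integral_prod (u := level_weight n alpha k.+2)
  (X := fun i w => level_stat (Y w) k.+2 i)) //.
- rewrite !big_ord_recr /= Estop.
  have -> : (\prod_(i < k) \int[P]_w (level_weight n alpha k.+2 i (level_stat (Y w) k.+2 i))%:E =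
     (\prod_(i < k) Phi (signal_to_noise i - tau))%:E)%E.
    rewrite -prodEFin; apply: eq_bigr => i _; exact: Econt.
  rewrite -EFinM (mulrA (\prod_(i < k) _)) [leRHS]EFinM; apply: lee_wpmul2l Elen.
  rewrite lee_fin mulr_ge0 ?Phi_ge0// prodr_ge0// => i _; exact: Phi_ge0.
- exact: (level_stat_independent BW).
- exact: measurable_level_weight.
- by move=> i x; exact: level_weight_ge0.
- move=> i; rewrite ltnS leq_eqVlt => /predU1P[->//|].
  rewrite ltnS leq_eqVlt => /predU1P[->|ik]; first by rewrite Estop.
  by rewrite Econt.
Qed.

Lemma jhat_NoneE : [set w | jhat n alpha (Y w) = None] =
  \bigcap_i [set w | tau * sigma_ n i.+2 < xi (Y w) i.+2].
Proof.
apply/seteqP; split => w /=; rewrite /jhat; case: pselect => //.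
  move=> nex _ i _ /=; rewrite ltNge; apply/negP => le.
  by apply: nex; exists i.+2; rewrite /stops.
move=> [[|[|i]]] // s; case: ex_minnP => -[|[|m]]// /andP[_ sm] _ /(_ m I) /=.
by rewrite ltNge sm.
Qed.

Lemma measurable_jhat_None : measurable [set w | jhat n alpha (Y w) = None].
Proof.
rewrite jhat_NoneE; apply: bigcapT_measurable => i.
exact: measurable_set_gt (measurable_xi_signal i).
Qed.

Lemma never_stops_prob_le (k : nat) :
  (P [set w | jhat n alpha (Y w) = None] <= (\prod_(i < k) Phi (signal_to_noise i - tau))%:E)%E.
Proof.
have lsE (i : nat) w : (i <= k)%N -> level_stat (Y w) k.+2 i = xi (Y w) i.+2.
  by move=> ik; rewrite /level_stat !ltnS ik.
(* Levels 2 to k + 1 have to continue; the last two coordinates are left free. *)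
pose A i := if (i < k)%N then [set x : R | tau * sigma_ n i.+2 < x] else setT.
have mA i : measurable (A i) by rewrite /A; case: ifP => // _; exact: (measurable_set_gt (g := id) _ (@measurable_id _ _ setT)).
have := level_stat_independent BW (primitive f) n0 (j := k.+2) isT (fun i _ => mA i).
rewrite !big_ord_recr /= => PE.
rewrite (_ : (\prod_(i < k) Phi (signal_to_noise i - tau))%:E =
    P [set w | forall i, (i < k.+2)%N -> A i (level_stat (Y w) k.+2 i)])%E; last first.
  rewrite PE {2 3}/A ltnn ltnNge leqnSn /= !preimage_setT !probability_setT !mule1 -prodEFin.
  apply: eq_bigr => i _; rewrite -xi_continue_prob /A ltn_ord; congr (P _).
  by apply/seteqP; split => w /=; rewrite lsE// ltnW.
apply: le_measure; rewrite ?inE.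
- exact: measurable_jhat_None.
- have -> : [set w | forall i, (i < k.+2)%N -> A i (level_stat (Y w) k.+2 i)] =
      \bigcap_i (if (i < k.+2)%N then (fun w => level_stat (Y w) k.+2 i) @^-1` A i else setT).
    apply/seteqP; split => w /= hA i.
      by move=> _; case: ifP => // ik; exact: hA.
    by move=> ik; have := hA i I; rewrite ik.
  apply: bigcapT_measurable => i; case: ifP => // _; rewrite -[X in measurable X]setTI.
  exact: (measurable_level_stat BW).
- rewrite jhat_NoneE => w /= hw i ik; rewrite /A; case: ifP => // ik'.
  by rewrite lsE ?(ltnW ik')//; exact: hw.
Qed.

End level_integrals.

(** * The recursion that controls the expected length *)

Definition stopped_sum (R : realType) (q c : nat -> R) (N k : nat) : R :=
  \sum_(i < N) (\prod_(l < i) q (k + l)%N) * c (k + i)%N.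

(** First-step decomposition: pay c k at level k, then go on to level k + 1 with probability q k.
    The cost c k will already contain the probability of stopping at k. *)
Lemma stopped_sum_recl (R : realType) (q c : nat -> R) N k :
  stopped_sum q c N.+1 k = c k + q k * stopped_sum q c N k.+1.
Proof.
rewrite /stopped_sum big_ord_recl big_ord0 mul1r addn0 mulr_sumr; congr (_ + _).
apply: eq_bigr => i _; rewrite big_ord_recl addn0 -mulrA !addSnnS; congr (_ * (_ * _)).
by apply: eq_bigr => l _; rewrite addSnnS.
Qed.

Section stopping_sum.
Context (R : realType).
(** In the application m k is the mean of xi, t the stopping threshold in units of sigma, a the
    Gaussian density at 0, and e the noise part of the expected length in units of sigma; r bounds
    the probability of continuing after J. *)
Variables (q p m sg : nat -> R) (J : nat) (t a r e g : R).
Local Notation s := (Num.sqrt 2 : R).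
Hypotheses (pE : forall k, p k = 1 - q k) (q01 : forall k, 0 <= q k <= 1).
Hypotheses (sg0 : forall k, 0 <= sg k) (sgS : forall k, sg k.+1 = s * sg k).
Hypotheses (t0 : 0 <= t) (a0 : 0 <= a) (e0 : 0 <= e) (r0 : 0 <= r) (r1 : s * r < 1).
Hypothesis gE : g * (1 - s * r) = 1 - r.
Hypothesis m_early : forall k, (k < J)%N -> p k * m k <= sg k * (t * p k + a).
Hypothesis m_late : forall k, (J <= k)%N -> m k <= t * sg J.
Hypotheses (q_mid : q J <= 2^-1) (q_late : forall k, (J < k)%N -> q k <= r).

Local Notation S := (stopped_sum q (fun k => p k * (2 * m k + e * sg k))).

Let s2 : s * s = 2. Proof. by rewrite -expr2 sqr_sqrtr. Qed.

Let s1 : 1 <= s. Proof. by rewrite -[leLHS]sqrtr1 ler_wsqrtr// ler1n. Qed.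

Let g_eq : g - 1 = r * (s * g - 1).
Proof. by move: gE; lra. Qed.

Let sg1 : 0 <= s * g - 1.
Proof.
have d0 : 0 < 1 - s * r by rewrite subr_gt0.
by rewrite -(pmulr_lge0 _ d0) mulrBl -mulrA gE; move: s1; lra.
Qed.

Let p0 k : 0 <= p k. Proof. by rewrite pE subr_ge0; case/andP: (q01 k). Qed.

Let late N k : (J < k)%N -> S N k <= 2 * t * sg J + e * g * sg k.
Proof.
have g1 : 0 <= g by have := mulr_ge0 r0 sg1; have := g_eq; lra.
elim: N k => [|N ih] k Jk.
  by rewrite /stopped_sum big_ord0 addr_ge0// !mulr_ge0.
rewrite stopped_sum_recl; have /andP[q0 q1] := q01 k.
have h1 := ler_wpM2l (p0 k) (m_late (ltnW Jk)).
have := ler_wpM2l q0 (ih k.+1 (ltnW Jk)); rewrite sgS => h2.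
have h3 := ler_wpM2r (mulr_ge0 e0 (sg0 k)) (ler_wpM2r sg1 (q_late Jk)).
rewrite -g_eq in h3; rewrite pE in h1 *.
by lra.
Qed.

(** At J the bound increases with the probability of continuing, because s * g >= 1, so the worst
    case q J = 1/2 gives the average of the factors 1 (stop) and s * g (go on). *)
Let mid N : S N J <= sg J * (2 * t + e * (2^-1 + 2^-1 * (s * g))).
Proof.
case: N => [|N].
  have b0 : 0 <= 2^-1 + 2^-1 * (s * g) by have := sg1; lra.
  by rewrite /stopped_sum big_ord0 mulr_ge0// addr_ge0// mulr_ge0.
rewrite stopped_sum_recl; have /andP[q0 q1] := q01 J.
have h1 := ler_wpM2l (p0 J) (m_late (leqnn J)).
have := ler_wpM2l q0 (@late N J.+1 (ltnSn J)); rewrite sgS => h2.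
have h3 := ler_wpM2r (mulr_ge0 e0 (sg0 J)) (ler_wpM2r sg1 q_mid).
rewrite pE in h1 *.
by lra.
Qed.

Let sg_le k l : (k <= l)%N -> sg k <= sg l.
Proof.
elim: l => [|l ih]; first by rewrite leqn0 => /eqP ->.
rewrite leq_eqVlt => /predU1P[->//|]; rewrite ltnS => /ih/le_trans; apply.
by rewrite sgS ler_peMl.
Qed.

(** Before J each step has an extra cost 2 * a * sg k. Since (s + 1) * (s - 1) = 1, this is exactly
    the increment of 2 * a * (s + 1) * sg from k to k + 1, which the last term gives up. *)
Let early N k : (k <= J)%N -> S N k <=
  sg J * (2 * t + e * (2^-1 + 2^-1 * (s * g))) + 2 * a * (s + 1) * (sg J - sg k).
Proof.
set b := 2^-1 + 2^-1 * (s * g).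
have b1 : 1 <= b by rewrite /b; have := sg1; lra.
have sp : 0 <= s + 1 by have := s1; lra.
elim: N k => [|N ih] k.
  move=> kJ; have b0 : 0 <= b by exact: le_trans b1.
  rewrite /stopped_sum big_ord0 addr_ge0//; first by rewrite mulr_ge0// addr_ge0// mulr_ge0.
  by rewrite !mulr_ge0// subr_ge0 sg_le.
rewrite leq_eqVlt => /predU1P[->|kJ].
  by rewrite subrr mulr0 addr0; exact: mid.
rewrite stopped_sum_recl; have /andP[q0 q1] := q01 k.
have h1 := m_early kJ.
have h2 := ler_wpM2l q0 (ih k.+1 kJ).
have h3 : 0 <= (1 - q k) * (2 * a * (s + 1) * (sg J - sg k.+1)).
  by rewrite !mulr_ge0 ?subr_ge0// sg_le.
have h4 := ler_wpM2l (mulr_ge0 (p0 k) (addr_ge0 (mulr_ge0 (ler0n R 2) t0) e0)) (sg_le (ltnW kJ)).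
have h5 := ler_wpM2l (mulr_ge0 (mulr_ge0 (p0 k) (sg0 J)) e0) b1.
have h6 : 2 * a * (s + 1) * (s * sg k) = 2 * a * sg k * (2 + s).
  by have := congr1 (fun x => 2 * a * sg k * x) s2 => /=; lra.
rewrite sgS in h2 h3; rewrite pE in h1 h4 h5 *.
by clearbody b; lra.
Qed.

(* sg J * (...) dominates a supersolution of stopped_sum_recl: at levels after J
   it is 2 * t * sg J + e * g * sg k, where g is the fixed point of
   g = 1 - r + r * s * g. *)
Lemma stopping_sum_le N :
  \sum_(i < N) (\prod_(l < i) q l) * (p i * (2 * m i + e * sg i)) <=
  sg J * (2 * t + e * (2^-1 + 2^-1 * (s * g)) + 2 * a * (s + 1)).
Proof.
apply: le_trans (@early N 0%N (leq0n J)) _ => //.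
have sp : 0 <= s + 1 by have := s1; lra.
have := mulr_ge0 (mulr_ge0 (mulr_ge0 (ler0n R 2) a0) sp) (sg0 0%N).
lra.
Qed.

End stopping_sum.

(** * Upper bound for the expected length of the adaptive interval *)

Section expected_length_upper.
Context d (T : measurableType d) (R : realType) (P : probability T R).
Variable (W : R -> T -> R).
Hypothesis BW : brownian_motion P (- 2^-1) 2^-1 W.
Variables (n alpha : R) (f : R -> R) (J : nat).
Hypotheses (n0 : 0 < n) (a01 : 0 < alpha < 2^-1) (fm : F_m f).
Hypothesis stopsJ : stops n alpha (primitive f) J.+2.
Local Notation F := (primitive f : observation R).
Local Notation Y := (signal_plus_noise W n (primitive f)).
Local Notation tau := (3 / 2 * z_ alpha).
Local Notation h := (Num.sqrt 2 * z_ (alpha / 2)).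
Local Notation snr := (signal_to_noise n f).
Local Notation phi0 := (normal_pdf 0 1 (0 : R)).

Lemma tau_ge0 : 0 <= tau.
Proof. by case/andP: a01 => a0 a1; rewrite mulr_ge0 ?divr_ge0// ltW// z_gt0. Qed.

Lemma z_half_ge0 : 0 <= z_ (alpha / 2).
Proof. by case/andP: a01 => a0 a1; rewrite ltW// z_gt0//; lra. Qed.

Lemma snr_sigma k : xi F k.+2 = snr k * sigma_ n k.+2.
Proof. by rewrite /signal_to_noise divfK// gt_eqF// sigma_gt0. Qed.

Lemma snr_stop : snr J <= tau.
Proof. by rewrite /signal_to_noise ler_pdivrMr ?sigma_gt0//; case/andP: stopsJ. Qed.

Lemma sigma_le k l : (k <= l)%N -> sigma_ n k.+1 <= sigma_ n l.+1.
Proof.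
move=> kl; rewrite /sigma_ /= ler_wsqrtr// ler_pM2r ?invr_gt0//.
by rewrite ler_weXn2l// ler1n.
Qed.

Lemma xi_late k : (J <= k)%N -> xi F k.+2 <= tau * sigma_ n J.+2.
Proof.
move=> Jk; rewrite (le_trans (@xi_primitive_nonincr _ _ fm J.+2 k.+2 isT _))//.
Qed.

(** Past J the mean is still at most tau * sigma_J in the notation of the levels, while sigma has
    grown by a factor of at least sqrt 2. *)
Lemma snr_late k : (J < k)%N -> snr k - tau <= - (tau * (1 - (Num.sqrt 2)^-1)).
Proof.
move=> Jk; have sk := sigma_gt0 n0 k.+2; have s2 : 0 < Num.sqrt 2 :> R by rewrite sqrtr_gt0.
suff : snr k <= tau / Num.sqrt 2 by lra.
rewrite /signal_to_noise ler_pdivrMr//; apply: le_trans (xi_late (ltnW Jk)) _.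
rewrite -(mulrA tau); apply: (ler_wpM2l tau_ge0); rewrite mulrC ler_pdivlMr// mulrC -sigmaS//.
exact: sigma_le.
Qed.

(** From J on every continuation has probability at most 1/2, so passing k further levels has
    probability at most 2^-k. *)
Lemma never_stops_null : P [set w | jhat n alpha (Y w) = None] = 0.
Proof.
have q01 i : 0 <= Phi (snr i - tau) <= 1 by rewrite Phi_ge0 Phi_le1.
have half i : (J <= i)%N -> Phi (snr i - tau) <= 2^-1.
  rewrite -[leRHS](@Phi0 R) ler_Phi leq_eqVlt => /predU1P[<-|/snr_late/le_trans]; first by rewrite subr_le0 snr_stop.
  apply; rewrite oppr_le0 mulr_ge0 ?tau_ge0// subr_ge0 invf_le1 ?sqrtr_gt0//.
  by rewrite -[leLHS]sqrtr1 ler_wsqrtr// ler1n.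
have bound k : (P [set w | jhat n alpha (Y w) = None] <= (1 / 2 ^+ k)%:E)%E.
  apply: le_trans (never_stops_prob_le BW alpha f n0 (J + k)) _; rewrite lee_fin.
  elim: k => [|k ih].
    rewrite addn0 expr0 divr1; apply: prodr_ile1 => i _; exact: q01.
  rewrite addnS big_ord_recr /= exprSr invfM mulrA; apply: ler_pM => //.
  - by apply: prodr_ge0 => i _; case/andP: (q01 i).
  - by case/andP: (q01 (J + k)%N).
  - by apply: half; rewrite leq_addr.
apply/eqP; rewrite eq_le measure_ge0 andbT; apply/lee_addgt0Pr => e e0.
have [k _ /(_ k (leqnn k)) hk] := near_infty_natSinv_expn_lt (PosNum e0).
by rewrite add0e (le_trans (bound k))// lee_fin ltW.
Qed.

(** At most one term of the series is nonzero, the one at jhat; the extra summand is the length of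
    the whole line when no level stops. *)
Lemma interval_length_CIm_star (y : observation R) :
  interval_length (CIm_star n alpha y) =
  (\sum_(0 <= k <oo) (\prod_(i < k.+2) level_weight n alpha k.+2 i (level_stat y k.+2 i))%:E +
   (if jhat n alpha y is None then +oo else 0))%E.
Proof.
under eq_eseriesr do rewrite prod_level_weight.
rewrite /CIm_star; case E : (jhat n alpha y) => [j|].
  have /jhat_SomeP[] : jhat n alpha y == Some j by rewrite E.
  case: j E => [|[|j]]// E _ _; rewrite adde0; apply/esym/lim_near_cst => //.
  exists j.+1 => // N /= jN; rewrite big_mkord (bigD1 (Ordinal jN))//= eqxx big1 ?adde0// => i.
  by rewrite -val_eqE /= => ne; case: eqP => // -[ij]; rewrite ij eqxx in ne.
by rewrite eseries0 ?add0e.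
Qed.

Lemma expected_length_upper (r g : R) : 0 <= r -> Num.sqrt 2 * r < 1 ->
  g * (1 - Num.sqrt 2 * r) = 1 - r -> Phi (- (tau * (1 - (Num.sqrt 2)^-1))) <= r ->
  (expected_length P W n f (CIm_star n alpha) <=
   (sigma_ n J.+2 * (2 * tau +
     (2 * h + 2 * normal_pdf 0 1 h) * (2^-1 + 2^-1 * (Num.sqrt 2 * g)) +
     2 * phi0 * (Num.sqrt 2 + 1)))%:E)%E.
Proof.
move=> r0 r1 gE rP; have z0 := z_half_ge0.
rewrite /expected_length.
under eq_integral do rewrite interval_length_CIm_star.
pose u k w : \bar R := (\prod_(i < k.+2) level_weight n alpha k.+2 i (level_stat (Y w) k.+2 i))%:E.
have u0 k w : (0 <= u k w)%E.
  by rewrite lee_fin; apply: prodr_ge0 => i _; exact: level_weight_ge0.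
have mu k : measurable_fun setT (u k).
  apply/measurable_EFinP; apply: measurable_prod => i _.
  apply: (measurableT_comp (f := level_weight n alpha k.+2 i)).
    exact: measurable_level_weight.
  exact: (measurable_level_stat BW).
have mN := measurable_jhat_None BW n alpha f.
pose v : T -> \bar R := (cst +oo%E) \_ [set w | jhat n alpha (Y w) = None].
have vE w : (if jhat n alpha (white_noise W n f w) is None then +oo else 0)%E = v w.
  rewrite /v patchE; have -> : jhat n alpha (white_noise W n f w) = jhat n alpha (Y w) by [].
  case E : (jhat n alpha (Y w)) => [j|]; last by rewrite mem_set.
  by rewrite memNset//= E.
under eq_integral do rewrite vE.
rewrite ge0_integralD//; first last.
- by apply/(measurable_restrictT _ mN); exact: measurable_cst.
- by move=> w _; rewrite -vE; case: jhat.
- by apply: (ge0_emeasurable_sum (h := u)) => // k w _ _; exact: u0.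
- by move=> w _; apply: nneseries_ge0 => k _ _; exact: u0.
(* The infinite length sits on a null event and integrates to 0. *)
rewrite [X in (_ + X)%E](_ : _ = 0)%E ?adde0; last first.
  by rewrite -integral_mkcond; apply: null_set_integral => //; exact: never_stops_null.
rewrite integral_nneseries//; last by move=> k w _; exact: u0.
apply: lime_le.
  by apply: is_cvg_nneseries => k _ _; apply: integral_ge0 => w _; exact: u0.
exists 0%N => // N _ /=; rewrite big_mkord.
pose q k := Phi (snr k - tau); pose p k := Phi (tau - snr k).
apply: (@le_trans _ _ (\sum_(k < N) (\prod_(i < k) q i) * (p k * (2 * xi F k.+2 +
  (2 * h + 2 * normal_pdf 0 1 h) * sigma_ n k.+2)))%:E)%E.
  rewrite -sumEFin; apply: lee_sum => k _; exact: (integral_level BW).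
rewrite lee_fin; apply: (@stopping_sum_le _ q p (fun k => xi F k.+2) (fun k => sigma_ n k.+2) J tau phi0 r) => //.
- by move=> k; rewrite /p /q -PhiN opprB.
- by move=> k; rewrite Phi_ge0 Phi_le1.
- by move=> k; rewrite ltW// sigma_gt0.
- by move=> k; rewrite sigmaS.
- exact: tau_ge0.
- exact: normal_pdf_ge0.
- by rewrite addr_ge0// mulr_ge0// ?mulr_ge0// normal_pdf_ge0.
(* If the mean is at most tau sigma, the term with tau suffices. Otherwise the excess x = snr - tau
   times the probability of stopping is x * Phi (- x), which the Mills bound keeps below phi x,
   hence below phi 0. *)
- move=> k _; rewrite (snr_sigma k) mulrA [leRHS]mulrC ler_pM2r ?sigma_gt0//.
  rewrite /p; have [le|lt] := leP (snr k) tau.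
    have := ler_wpM2r (Phi_ge0 (tau - snr k)) le.
    by have := @normal_pdf_ge0 R 0 1 0; lra.
  have := @Phi_tail_le _ (snr k - tau); rewrite opprB subr_ge0 => /(_ (ltW lt)).
  have : normal_pdf 0 1 (snr k - tau) <= phi0 by apply: normal_pdf01_nonincr => //; rewrite subr_ge0 ltW.
  by lra.
- exact: xi_late.
- by rewrite /q -[leRHS](@Phi0 R) ler_Phi subr_le0 snr_stop.
- by move=> k Jk; apply: le_trans rP; rewrite /q ler_Phi; exact: snr_late.
Qed.

End expected_length_upper.

(** * Numerical constants *)

Section elementary_bounds.
Context (R : realType).

Lemma expR_ge_partial_sum (x : R) (N : nat) : 0 <= x ->
  \sum_(0 <= i < N) x ^+ i / i`!%:R <= expR x.
Proof.
move=> x0; have := nondecreasing_cvgn_le _ (is_cvg_series_exp_coeff x) N; apply.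
by apply: nondecreasing_series => i _ _; exact: exp_coeff_ge0.
Qed.

Lemma expR_ge_quartic (x : R) : 0 <= x ->
  1 + x + x ^+ 2 / 2 + x ^+ 3 / 6 + x ^+ 4 / 24 <= expR x.
Proof.
move=> x0; have := expR_ge_partial_sum 5 x0.
by rewrite !big_nat_recr//= big_nil add0r expr0 divr1 expr1 divr1.
Qed.

Lemma is_derive_atan (x : R) : is_derive x 1 (@atan R) (1 + x ^+ 2)^-1.
Proof.
by apply: DeriveDef; [exact: derivable_atan|rewrite -derive1E derive1_atan].
Qed.

Lemma atan_le (x : R) : 0 <= x -> atan x <= x.
Proof.
rewrite le_eqVlt => /predU1P[<-|x0]; first by rewrite atan0.
have cat : {within `[0, x], continuous (@atan R)}.
  exact: continuous_subspaceT (@continuous_atan R).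
have [c _] := MVT x0 (fun y _ => is_derive_atan y) cat.
rewrite atan0 !subr0 => ->; rewrite ler_piMl//; first exact: ltW.
by rewrite invf_le1 ?lerDl ?sqr_ge0// ltr_wpDr ?sqr_ge0.
Qed.

Lemma atan_ge (x : R) : 0 <= x -> x - x ^+ 3 / 3 <= atan x.
Proof.
rewrite le_eqVlt => /predU1P[<-|x0]; first by rewrite atan0 expr0n/= mul0r subr0.
pose F (y : R) := atan y - (y - y ^+ 3 / 3).
have dF (y : R) : is_derive y 1 F ((1 + y ^+ 2)^-1 - (1 - y ^+ 2)).
  have h := is_derive_atan y; rewrite /F; apply: is_derive_eq.
  rewrite /GRing.scale /=; lra.
have cF : {within `[0, x], continuous F}.
  apply: continuous_subspaceT => y; apply: differentiable_continuous; apply/derivable1_diffP.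
  exact: (@ex_derive _ _ _ _ _ _ _ (dF y)).
have [c _] := MVT x0 (fun y _ => dF y) cF.
rewrite {1 2}/F atan0 expr0n/= mul0r !subr0 => e.
rewrite -subr_ge0 e mulr_ge0//; last exact: ltW.
rewrite subr_ge0.
have c1 : 0 < 1 + c ^+ 2 by rewrite ltr_wpDr ?sqr_ge0.
rewrite -[leRHS]mul1r ler_pdivlMr//.
have := sqr_ge0 (c ^+ 2); rewrite !expr2; lra.
Qed.

(** The addition formula gives tan of the sum equal to 1, and each arctangent lies between 0 and pi
    / 4, so the sum is in the range where tan can be inverted. *)
Lemma atan_half_third : atan (2^-1) + atan (3^-1) = pi / 4 :> R.
Proof.
have h2 := @atan_ltpi2 R; have hN := @atan_gtNpi2 R.
have c0 (x : R) : cos (atan x) != 0.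
  by rewrite gt_eqF// cos_gt0_pihalf// hN h2.
have p2 : 0 < (pi / 2 : R) by rewrite divr_gt0// pi_gt0.
have lt1 (x : R) : x < 1 -> atan x < pi / 4 by rewrite -atan1 => /lt_atan.
have a0 (x : R) : 0 < x -> 0 < atan x by move=> /lt_atan; rewrite atan0.
have h3 : (3^-1 : R) < 1 by lra.
have h4 : (2^-1 : R) < 1 by lra.
have t1 : tan (atan (2^-1 : R) + atan 3^-1) = 1.
  rewrite tanD// !atanK.
    have -> : (2^-1 + 3^-1 : R) = 5 / 6 by lra.
    have -> : (1 - 2^-1 * 3^-1 : R) = 5 / 6 by lra.
    by rewrite divff//; lra.
rewrite -atan1 -[in RHS]t1 tanK//.
rewrite in_itv /=; apply/andP; split.
  by rewrite (lt_trans _ (addr_gt0 (a0 _ _) (a0 _ _)))// ?oppr_lt0//; lra.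
by have := lt1 _ h3; have := lt1 _ h4; move: (pi : R) => p; lra.
Qed.

(** Linear upper and cubic lower bounds for the two arctangents, multiplied by 4. *)
Lemma pi_bounds : 28 / 9 <= pi :> R /\ pi <= 10 / 3 :> R.
Proof.
have := atan_half_third; have := @atan_le (2^-1); have := @atan_le (3^-1).
have := @atan_ge (2^-1); have := @atan_ge (3^-1).
move: (pi : R) => p; move=> /(_ ltac:(lra)) h1 /(_ ltac:(lra)) h2 /(_ ltac:(lra)) h3 /(_ ltac:(lra)) h4 h5.
split; lra.
Qed.

End elementary_bounds.

(** * Rational bounds for Gaussian densities and quantiles *)

Section gaussian_numerics.
Context (R : realType).
Local Notation phi := (@normal_pdf R 0 1).

(** The bounds on pi place sqrt (2 pi) between 52/21 and 13/5. *)
Lemma normal_peak1_bounds : 5 / 13 <= normal_peak (1 : R) <= 21 / 52.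
Proof.
have [l u] := pi_bounds R; rewrite /normal_peak expr1n mul1r.
have p0 : 0 < Num.sqrt (pi *+ 2 : R) by rewrite sqrtr_gt0 mulrn_wgt0// pi_gt0.
have e : Num.sqrt (pi *+ 2 : R) ^+ 2 = 2 * pi.
  rewrite sqr_sqrtr; first by move: (pi : R) => p; lra.
  by rewrite mulrn_wge0// pi_ge0.
move: l u p0 e; move: (pi : R) (Num.sqrt (pi *+ 2) : R) => p s l u s0 e.
apply/andP; split.
- have h : s <= 13 / 5.
    by rewrite -(@ler_pXn2r _ 2) ?nnegrE ?e; [lra|by []|exact: ltW|lra].
  by rewrite -[leLHS]invf_div lef_pV2 // posrE; lra.
- have h : 52 / 21 <= s.
    by rewrite -(@ler_pXn2r _ 2) ?nnegrE ?e; [lra|by []|lra|exact: ltW].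
  by rewrite -[leRHS]invf_div lef_pV2 // posrE; lra.
Qed.

Lemma normal_pdf01_0 : phi 0 = normal_peak 1.
Proof. by rewrite normal_pdf01E expr0n/= oppr0 mul0r expR0 mulr1. Qed.

(** By the Mills lower bound the hypothesis forces Phi (- x) >= alpha; [z_le] uses the upper bound
    in the same way. *)
Lemma z_ge (alpha x : R) : 0 < alpha < 1 -> 0 < x ->
  alpha * (1 + x ^+ 2) <= x * phi x -> x <= z_ alpha.
Proof.
move=> /andP[a0 a1] x0 h; rewrite -ler_Phi Phi_z_//.
have := Phi_tail_ge x0; rewrite PhiN => t.
have x2 : 0 < 1 + x ^+ 2 by rewrite ltr_wpDr ?sqr_ge0.
have e : (1 + x ^- 2) * x ^+ 2 = 1 + x ^+ 2.
  by rewrite mulrDl mul1r mulVf ?expf_neq0 ?gt_eqF// addrC.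
have := ler_wpM2r (sqr_ge0 x) t.
have -> : phi x / x * x ^+ 2 = x * phi x by rewrite expr2 mulrA divfK ?gt_eqF// mulrC.
rewrite [leRHS]mulrAC e => t'.
have := le_trans h t'; rewrite mulrC ler_pM2l//; lra.
Qed.

Lemma z_le (alpha x : R) : 0 < alpha < 1 -> 0 < x -> phi x <= alpha * x -> z_ alpha <= x.
Proof.
move=> /andP[a0 a1] x0 h; rewrite -ler_Phi Phi_z_//.
have := Phi_tail_le (ltW x0); rewrite PhiN => /le_trans/(_ h).
by rewrite mulrC ler_pM2r//; lra.
Qed.

Lemma normal_pdf01_le_inv (x m : R) : 0 < m -> m <= expR (x ^+ 2 / 2) ->
  phi x <= 21 / 52 / m.
Proof.
move=> m0 mx; rewrite normal_pdf01E mulNr expRN; have /andP[_ pk] := normal_peak1_bounds.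
have p0 := normal_peak1_gt0 R.
apply: (ler_pM (ltW p0) _ pk); first by rewrite invr_ge0 expR_ge0.
by rewrite lef_pV2 ?posrE ?expR_gt0.
Qed.

Lemma normal_pdf01_ge_mul (x m : R) : 0 <= m -> m <= expR (- (x ^+ 2 / 2)) ->
  5 / 13 * m <= phi x.
Proof.
move=> m0 mx; rewrite normal_pdf01E mulNr; have /andP[pk _] := normal_peak1_bounds.
by apply: (ler_pM _ m0 pk mx); lra.
Qed.

(** The quartic Taylor polynomial is accurate only near 0, so the exponent is cut into k equal
    parts. [expRN_ge_pow] does the same with the tangent line. *)
Lemma expR_ge_pow (x q y : R) (k : nat) : 0 <= x -> 0 <= q ->
  q <= 1 + x + x ^+ 2 / 2 + x ^+ 3 / 6 + x ^+ 4 / 24 -> k%:R * x <= y -> q ^+ k <= expR y.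
Proof.
move=> x0 q0 qx kx; apply: (@le_trans _ _ (expR (k%:R * x))); last by rewrite ler_expR.
by rewrite expRM_natl lerXn2r ?nnegrE ?expR_ge0// (le_trans qx)// expR_ge_quartic.
Qed.

Lemma expRN_ge_pow (b y : R) (k : nat) : b <= 1 -> y <= k%:R * b -> (1 - b) ^+ k <= expR (- y).
Proof.
move=> b1 yb; apply: (@le_trans _ _ (expR (k%:R * - b))); last by rewrite ler_expR; lra.
rewrite expRM_natl lerXn2r ?nnegrE ?expR_ge0 ?subr_ge0//.
exact: expR_ge1Dx.
Qed.

(** By the mean value theorem Phi (1/2) - 1/2 is at least phi (1/2) / 2, and phi (1/2) >= (5/13)
    (7/8) makes this more than 1/6. *)
Lemma Phi_tail_third (x : R) : 2^-1 <= x -> Phi (- x) <= 3^-1.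
Proof.
move=> x2; apply: (@le_trans _ _ (Phi (- 2^-1))); first by rewrite ler_Phi lerN2.
rewrite PhiN; have h : 0 < (2^-1 : R) by rewrite invr_gt0.
have [c] := MVT h (fun y _ => @is_derive_Phi R y) (continuous_subspaceT (@continuous_Phi R)).
rewrite in_itv /= Phi0 subr0 => /andP[c0 c1] e.
have le : phi 2^-1 <= phi c by apply: normal_pdf01_nonincr; exact: ltW.
have : 5 / 13 * (7 / 8) <= phi 2^-1.
  apply: normal_pdf01_ge_mul; first by lra.
  by apply: le_trans (expR_ge1Dx _); rewrite exprVn; lra.
have := ler_wpM2r (ltW h) le; lra.
Qed.

Lemma sqrt2_bounds : 7 / 5 <= Num.sqrt 2 :> R /\ Num.sqrt 2 <= 17 / 12 :> R.
Proof.
have e : Num.sqrt 2 ^+ 2 = 2 :> R by rewrite sqr_sqrtr.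
have s0 := sqrtr_ge0 (2 : R).
by split; (rewrite -(@ler_pXn2r _ 2) ?nnegrE ?e; [lra|by []|lra|lra]).
Qed.

End gaussian_numerics.

(** * Comparison of the two bounds and the explicit constants *)

Section adaptivity.
Context (R : realType).
Local Notation phi := (@normal_pdf R 0 1).
Local Notation s := (Num.sqrt 2 : R).

(** Both bounds are multiples of sigma_J, so it is enough to compare coefficients, which is the last
    hypothesis. The factor 1 / s comes from the lower bound, obtained one level before J. *)
Lemma adaptive_of_bound (alpha c r g : R) : 0 < alpha < 2^-1 -> 0 <= c -> 0 <= r ->
  s * r < 1 -> g * (1 - s * r) = 1 - r ->
  Phi (- (3 / 2 * z_ alpha * (1 - s^-1))) <= r ->
  phi (2 * z_ alpha) <= z_ alpha ->
  2 * (3 / 2 * z_ alpha) + (2 * (s * z_ (alpha / 2)) + 2 * phi (s * z_ (alpha / 2))) *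
    (2^-1 + 2^-1 * (s * g)) + 2 * phi 0 * (s + 1) <=
    c / s * (z_ alpha - phi (2 * z_ alpha)) ->
  adaptive_with_constant alpha c.
Proof.
move=> a01 c0 r0 r1 gE rP zphi K n d T P W f n0 BW fm.
have [J [J1 stopJ minJ]] := stops_primitive_ex n0 a01 fm.
case: J J1 stopJ minJ => [|[|J]]// _ stopJ minJ.
apply: le_trans (expected_length_upper BW n0 a01 fm stopJ r0 r1 gE rP) _.
have nst i : (1 < i)%N -> (i < J.+2)%N -> ~~ stops n alpha (primitive f) i.
  by move=> _; exact: minJ.
have := @Lstar_lower _ _ _ _ _ BW n alpha f J.+2 n0 a01 fm isT nst zphi.
move=> /(@lee_wpmul2l _ c%:E); rewrite lee_fin => /(_ c0); apply: le_trans.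
rewrite -EFinM lee_fin; have := ler_wpM2l (ltW (sigma_gt0 n0 J.+2)) K.
by move=> /le_trans; apply; rewrite !mulrA [c * _]mulrC.
Qed.

(** This is where alpha <= 0.2 enters: the density is at most 1/2, so Phi (1/2) <= 3/4 < 1 - alpha.
    It makes phi (2 z_alpha) < z_alpha, so the lower bound is positive. *)
Lemma z_gt_half (alpha : R) : 0 < alpha -> alpha <= 2 / 10 -> 2^-1 < z_ alpha.
Proof.
move=> a0 a2; rewrite -ltr_Phi Phi_z_//; last by lra.
have h : 0 < (2^-1 : R) by rewrite invr_gt0.
have [c] := MVT h (fun y _ => @is_derive_Phi R y) (continuous_subspaceT (@continuous_Phi R)).
rewrite Phi0 subr0 => _ e.
have := ler_wpM2r (ltW h) (le_trans (normal_pdf01_le_peak c) (normal_peak1_le R)).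
lra.
Qed.

Lemma one_minus_invsqrt2_ge : 2 / 7 <= 1 - s^-1.
Proof.
have [l u] := sqrt2_bounds R.
have s0 : 0 < s by rewrite sqrtr_gt0.
have : s^-1 <= (7 / 5)^-1 by rewrite lef_pV2 // posrE; lra.
lra.
Qed.

(** For mere existence r = 1/2 suffices: sqrt 2 / 2 < 1, and [Phi] is at most 1/2 at any nonpositive
    point. *)
Lemma adaptive_constant_exists (alpha : R) : 0 < alpha -> alpha <= 2 / 10 ->
  exists c, adaptive_with_constant alpha c.
Proof.
move=> a0 a2; have zh := z_gt_half a0 a2.
have zphi : phi (2 * z_ alpha) < z_ alpha.
  have := normal_pdf01_le_peak (2 * z_ alpha); have := normal_peak1_le R; lra.
have s0 : 0 < s by rewrite sqrtr_gt0.
have [l u] := sqrt2_bounds R.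
have d0 : 0 < 1 - s * 2^-1 by lra.
have [g gE] : exists g, g * (1 - s * 2^-1) = 1 - 2^-1.
  by exists ((1 - 2^-1) / (1 - s * 2^-1)); rewrite divfK// gt_eqF.
have g0 : 0 <= g by rewrite -(pmulr_lge0 _ d0) gE; lra.
have z2 : 0 <= z_ (alpha / 2) by rewrite ltW// z_gt0//; lra.
have [K KE] : exists K, K = 2 * (3 / 2 * z_ alpha) + (2 * (s * z_ (alpha / 2)) +
  2 * phi (s * z_ (alpha / 2))) * (2^-1 + 2^-1 * (s * g)) + 2 * phi 0 * (s + 1) by eexists.
have K0 : 0 <= K.
  have p0 x : 0 <= phi x by exact: normal_pdf_ge0.
  have sg : 0 <= s * g by rewrite mulr_ge0// ltW.
  have sz : 0 <= s * z_ (alpha / 2) by rewrite mulr_ge0// ltW.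
  have h0 := p0 (s * z_ (alpha / 2)).
  rewrite KE addr_ge0//; last by rewrite !mulr_ge0// addr_ge0// ltW.
  by rewrite addr_ge0//; [lra|apply: mulr_ge0; lra].
have zp : 0 < z_ alpha - phi (2 * z_ alpha) by rewrite subr_gt0.
exists (K * s / (z_ alpha - phi (2 * z_ alpha))).
apply: (@adaptive_of_bound _ _ (2^-1) g).
- by apply/andP; split; lra.
- by rewrite !mulr_ge0// ?ltW// invr_gt0.
- by [].
- lra.
- exact: gE.
- rewrite -[leRHS](@Phi0 R) ler_Phi oppr_le0 mulr_ge0//; first by lra.
  by have := one_minus_invsqrt2_ge; lra.
- exact: ltW.
- by rewrite -KE mulrAC divfK ?mulfK ?gt_eqF.
Qed.

(* 17/12 bounds sqrt 2, 21/52 bounds the density at 0, 7/5 bounds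
   1/2 + (sqrt 2 * g) / 2 for r = 1/3, and 1/10, 1/100 bound Gaussian densities
   in the tails. *)
Lemma adaptive_numeric (alpha c zl zu z2 : R) : 0 < alpha < 2^-1 -> 0 <= c ->
  3 / 2 <= zl -> zl <= z_ alpha -> z_ alpha <= zu -> z_ (alpha / 2) <= z2 ->
  3 * zu + (17 / 6 * z2 + 1 / 10) * (7 / 5) + 2 * (21 / 52) * (29 / 12) <=
    c * (12 / 17) * (zl - 1 / 100) ->
  adaptive_with_constant alpha c.
Proof.
move=> a01 c0 zl0 lz zu1 z21 K; have [a0 a2] := andP a01.
have z1 : 3 / 2 <= z_ alpha := le_trans zl0 lz.
have zz : z_ alpha <= z_ (alpha / 2).
  by rewrite -ler_Phi !Phi_z_ //; lra.
have [sl su] := sqrt2_bounds R.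
have s0 : 0 < s by rewrite sqrtr_gt0.
have szl : 21 / 10 <= s * z_ (alpha / 2).
  apply: (@le_trans _ _ (7 / 5 * (3 / 2))); first by clear; lra.
  by apply: ler_pM => //; lra.
have szu : s * z_ (alpha / 2) <= 17 / 12 * z2.
  by apply: ler_pM => //; lra.
have phi2z : phi (2 * z_ alpha) <= 1 / 100.
  apply: (@le_trans _ _ (phi 3)).
    by apply: normal_pdf01_nonincr; move: z1; clear; lra.
  apply: le_trans (@normal_pdf01_le_inv _ 3 (3 ^+ 4) _ _) _; [by clear; lra| |by clear; lra].
  by apply: (@expR_ge_pow _ (9 / 8)); clear; lra.
have phih : phi (s * z_ (alpha / 2)) <= 1 / 20.
  apply: (@le_trans _ _ (phi (21 / 10))).
    by apply: normal_pdf01_nonincr => //; clear; lra.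
  apply: le_trans (@normal_pdf01_le_inv _ (21 / 10) ((12 / 7) ^+ 4) _ _) _; [by clear; lra| |by clear; lra].
  by apply: (@expR_ge_pow _ (11 / 20)); clear; lra.
have d0 : 0 < 3 - s by lra.
(* The relation defining g for r = 1/3, multiplied by 3. *)
have [g gE] : exists g, g * (3 - s) = 2 by exists (2 / (3 - s)); rewrite divfK// gt_eqF.
(* From sqrt 2 <= 17/12 one gets s * g <= 34/19 < 9/5, which gives the factor 7/5. *)
have sg : s * g <= 9 / 5.
  by rewrite -(ler_pM2r d0) -mulrA gE; lra.
have g0 : 0 <= g by rewrite -(pmulr_lge0 _ d0) gE.
have sg0 : 0 <= s * g by rewrite mulr_ge0// ltW.
have ph0 : 0 <= phi (s * z_ (alpha / 2)) by exact: normal_pdf_ge0.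
apply: (@adaptive_of_bound _ _ (3^-1) g) => //.
- by move: su; clear; lra.
- by move: gE; clear; lra.
- apply: Phi_tail_third; apply: (@le_trans _ _ (3 / 2 * (3 / 2) * (2 / 7))); first by clear; lra.
  apply: ler_pM; [by clear; lra|by clear; lra| |exact: one_minus_invsqrt2_ge].
  by move: z1; clear; lra.
- by move: phi2z z1; clear; lra.
- have /andP[_ pk] := normal_peak1_bounds R; have pk0 := normal_peak1_gt0 R.
  have h2 : (2 * (s * z_ (alpha / 2)) + 2 * phi (s * z_ (alpha / 2))) * (2^-1 + 2^-1 * (s * g))
      <= (17 / 6 * z2 + 1 / 10) * (7 / 5).
    by apply: ler_pM; lra.
  have h3 : 2 * phi 0 * (s + 1) <= 2 * (21 / 52) * (29 / 12).
    by rewrite normal_pdf01_0; apply: ler_pM; lra.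
  have h4 : c * (12 / 17) * (zl - 1 / 100) <= c / s * (z_ alpha - phi (2 * z_ alpha)).
    apply: ler_pM; [|by lra| |by lra].
      by rewrite mulr_ge0//; clear; lra.
    by apply: ler_wpM2l => //; rewrite -invf_div lef_pV2 // posrE; lra.
  by apply: le_trans h4; move: h2 h3 K zu1; clear; lra.
Qed.

(** The quantile is about 1.645; the bracket from the Mills bounds is wider, but 14.40 leaves room
    for it. In the lower bound 16 * (3/40) = 1.2 exceeds (77/50)^2 / 2, and in the upper one 4 *
    (49/128) is exactly (7/4)^2 / 2. *)
Lemma z_005_bounds : 77 / 50 <= z_ (5 / 100 : R) <= 7 / 4.
Proof.
apply/andP; split.
  apply: z_ge; [by apply/andP; split; lra|lra|].
  have : 5 / 13 * (1 - 3 / 40) ^+ 16 <= phi (77 / 50).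
    by apply: normal_pdf01_ge_mul; [lra|apply: expRN_ge_pow; lra].
  lra.
apply: z_le; [by apply/andP; split; lra|lra|].
apply: le_trans (@normal_pdf01_le_inv _ (7 / 4) ((107 / 73) ^+ 4) _ _) _; [lra| |lra].
by apply: (@expR_ge_pow _ (49 / 128)); lra.
Qed.

Lemma z_0025_le : z_ (5 / 100 / 2 : R) <= 41 / 20.
Proof.
apply: z_le; [by apply/andP; split; lra|lra|].
apply: le_trans (@normal_pdf01_le_inv _ (41 / 20) ((27 / 16) ^+ 4) _ _) _; [lra| |lra].
by apply: (@expR_ge_pow _ (21 / 40)); lra.
Qed.

Lemma z_001_bounds : 29 / 13 <= z_ (1 / 100 : R) <= 12 / 5.
Proof.
apply/andP; split.
  apply: z_ge; [by apply/andP; split; lra|lra|].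
  (* The exponent is cut into 32 parts, because 16 would lose too much; 32 * (7/90) barely exceeds
     (29/13)^2 / 2. *)
  have : 5 / 13 * (1 - 7 / 90) ^+ 32 <= phi (29 / 13).
    by apply: normal_pdf01_ge_mul; [lra|apply: expRN_ge_pow; lra].
  lra.
apply: z_le; [by apply/andP; split; lra|lra|].
apply: le_trans (@normal_pdf01_le_inv _ (12 / 5) ((41 / 20) ^+ 4) _ _) _; [lra| |lra].
by apply: (@expR_ge_pow _ (18 / 25)); lra.
Qed.

Lemma z_0005_le : z_ (1 / 100 / 2 : R) <= 53 / 20.
Proof.
apply: z_le; [by apply/andP; split; lra|lra|].
apply: le_trans (@normal_pdf01_le_inv _ (53 / 20) ((19 / 8) ^+ 4) _ _) _; [lra| |lra].
by apply: (@expR_ge_pow _ (7 / 8)); lra.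
Qed.

End adaptivity.

Theorem mainTheorem4 (R : realType) :
  (forall alpha : R, 0 < alpha -> alpha <= 2 / 10 ->
     exists c1 : R, adaptive_with_constant alpha c1)
  /\ adaptive_with_constant (5 / 100 : R) (1440 / 100)
  /\ adaptive_with_constant (1 / 100 : R) (1267 / 100).
Proof.
split; first by move=> alpha; exact: adaptive_constant_exists.
have /andP[l5 u5] := z_005_bounds R; have /andP[l1 u1] := z_001_bounds R.
split.
  apply: adaptive_numeric l5 u5 (z_0025_le R) _; [|lra|lra|lra].
  by apply/andP; split; lra.
apply: adaptive_numeric l1 u1 (z_0005_le R) _; [|lra|lra|lra].
by apply/andP; split; lra.
Qed.
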